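(* Let $T$ be one of $C_2,C_3^0,C_3,C_4,C_5,C_6,C_7,C_8,C_9,C_{10},C_{12},C_2\times C_2,C_2\times C_4,C_2\times C_6,C_2\times C_8$, and let $E_T$ be the corresponding Weierstrass model with integer parameters satisfying the parameter conditions (P) below. Then the minimal discriminant of $E_T$ over $\mathbb{Q}$ is $u_T^{-12}\gamma_T$, where $u_T$ is the positive integer given as follows: - $T=C_5,C_7,C_9,C_3^0$: $u_T=1$. - $T=C_3$: write $a=c^3d^2e$ with $c$ a positive integer and $d,e$ positive squarefree integers with $\gcd(d,e)=1$; then $u_T=c^2d$. - $T=C_4$: write $a=c^2d$ with $c$ a positive integer and $d$ a squarefree integer; then $u_T=2c$ if $v_2(a)\ge 8$ is even and $bd\equiv 3\pmod 4$, and $u_T=c$ if $v_2(a)\le 7$ or $bd\not\equiv 3\pmod 4$. - $T=C_2$: $u_T=4$ iff $v_2(b^2d-a^2)\ge 8$, $v_2(a)=v_2(b)=1$ and $a\equiv 2\pmod 8$; $u_T=2$ iff one of: (i) $v_2(b^2d-a^2)\ge 8$, $v_2(a)=v_2(b)=1$ and $a\equiv 6\pmod 8$; (ii) $4\le v_2(b^2d-a^2)\le 7$ with $v_2(a)=v_2(b)=1$; (iii) $v_2(b)\ge 3$ and $a\equiv 3\pmod 4$; and $u_T=1$ otherwise. - $T=C_6$: $u_T=2$ iff $v_2(a+b)\ge 3$, else $u_T=1$. - $T=C_8$: $u_T=2$ iff $v_2(a)=1$, else $u_T=1$. - $T=C_{10}$ and $T=C_{12}$: $u_T=2$ iff $a$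 is even, else $u_T=1$. - $T=C_2\times C_2$: $u_T=2$ iff $v_2(a)\ge 4$ and $bd\equiv 1\pmod 4$; $u_T=1$ iff $v_2(a)\le 3$ or $bd\not\equiv 1\pmod 4$. - $T=C_2\times C_4$: $u_T=4$ iff $v_2(a)=2$ and $v_2(a+4b)\ge 4$; $u_T=2$ iff $v_2(a)\ge 2$ and $v_2(a+4b)\le 3$; $u_T=1$ iff $v_2(a)\le 1$. - $T=C_2\times C_6$: $u_T=16$ iff $v_2(a+b)=1$; $u_T=4$ iff $v_2(a+b)\ge 2$; $u_T=1$ iff $v_2(a+b)=0$. - $T=C_2\times C_8$: $u_T=64$ iff $v_2(a)\ge 2$; $u_T=16$ iff $v_2(a)=1$; $u_T=1$ iff $v_2(a)=0$.
   Context: For each $T$, $E_T$ is the Weierstrass model $y^2+a_1xy+a_3y=x^3+a_2x^2+a_4x$ with coefficients (with $a_4=0$ unless stated): $T=C_2$ (parameters $a,b,d$): $a_1=a_3=0$, $a_2=2a$, $a_4=a^2-b^2d$. $T=C_3^0$ (parameter $a$): $a_1=a_2=0$, $a_3=a$, i.e. $y^2+ay=x^3$. $T=C_3$: $a_1=a$, $a_2=0$, $a_3=a^2b$. $T=C_4$: $a_1=a$, $a_2=-ab$, $a_3=-a^2b$. $T=C_5$: $a_1=a-b$, $a_2=-ab$, $a_3=-a^2b$. $T=C_6$: $a_1=a-b$, $a_2=-ab-b^2$, $a_3=-a^2b-ab^2$. $T=C_7$: $a_1=a^2+ab-b^2$, $a_2=a^2b^2-ab^3$, $a_3=a^4b^2-a^3b^3$.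 $T=C_8$: $a_1=-a^2+4ab-2b^2$, $a_2=-a^2b^2+3ab^3-2b^4$, $a_3=-a^3b^3+3a^2b^4-2ab^5$. $T=C_9$: $a_1=a^3+ab^2-b^3$, $a_2=a^4b^2-2a^3b^3+2a^2b^4-ab^5$, $a_3=a^3a_2$. $T=C_{10}$: $a_1=a^3-2a^2b-2ab^2+2b^3$, $a_2=-a^3b^3+3a^2b^4-2ab^5$, $a_3=(a^3-3a^2b+ab^2)a_2$. $T=C_{12}$: $a_1=-a^4+2a^3b+2a^2b^2-8ab^3+6b^4$, $a_2=b(a-2b)(a-b)^2(a^2-3ab+3b^2)(a^2-2ab+2b^2)$, $a_3=a(b-a)^3a_2$. $T=C_2\times C_2$ (parameters $a,b,d$): $a_1=a_3=0$, $a_2=ad+bd$, $a_4=abd^2$. $T=C_2\times C_4$: $a_1=a$, $a_2=-ab-4b^2$, $a_3=-a^2b-4ab^2$. $T=C_2\times C_6$: $a_1=-19a^2+2ab+b^2$, $a_2=-10a^4+22a^3b-14a^2b^2+2ab^3$, $a_3=90a^6-198a^5b+116a^4b^2+4a^3b^3-14a^2b^4+2ab^5$. $T=C_2\times C_8$: $a_1=-a^4-8a^3b-24a^2b^2+64b^4$, $a_2=-4ab^2(a+2b)(a+4b)^2(a^2+4ab+8b^2)$, $a_3=-2b(a+4b)(a^2-8b^2)a_2$. $\gamma_T$ denotes the discriminant of this Weierstrass model (a polynomial in the parameters). Parameter conditions (P): all parameters are integers, chosen so that $\gamma_T\neq 0$; for $T\in\{C_3,C_4,\dots,C_{12},C_2\times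 C_4,C_2\times C_6,C_2\times C_8\}$: $\gcd(a,b)=1$ and $a>0$; for $T=C_2$: $b\neq 0$, $d\neq 1$, $d$ squarefree and $\gcd(a,b)$ squarefree; for $T=C_3^0$: $a$ a positive cubefree integer; for $T=C_2\times C_2$: $\gcd(a,b)=1$, $a$ even, $d$ a positive squarefree integer. $v_p$ is the $p$-adic valuation; the minimal discriminant of a rational elliptic curve is the discriminant of a global minimal Weierstrass model. *)

(* Defs.v *)
From HB Require Import structures.
From mathcomp Require Import all_boot all_order all_algebra.
From mathcomp Require Import constructive_ereal.
From mathcomp Require Import ring.

Set Implicit Arguments.
Unset Strict Implicit.
Unset Printing Implicit Defensive.

Import Order.TTheory GRing.Theory Num.Theory.
Local Open Scope ring_scope.

(* The p-adic valuation on Q, with v_p(0) = +oo; p is meant to be prime. *)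
Definition padic_val (p : nat) (x : rat) : \bar int :=
  if x == 0 then +oo%E
  else ((logn p `|numq x|)%:Z - (logn p `|denq x|)%:Z)%:E.

Definition v2 (n : int) : \bar int := padic_val 2 n%:~R.

(* In both predicates k ranges over all integers; n = 0 satisfies neither. *)
Definition squarefree (n : int) : Prop :=
  forall k : int, (k ^+ 2 %| n)%Z -> `|k| = 1.

Definition cubefree (n : int) : Prop :=
  forall k : int, (k ^+ 3 %| n)%Z -> `|k| = 1.

(* y^2 + wa1 xy + wa3 y = x^3 + wa2 x^2 + wa4 x + wa6 *)
Record weierstrass (R : Type) := Weierstrass {
  wa1 : R; wa2 : R; wa3 : R; wa4 : R; wa6 : R }.

Definition map_weierstrass (R S : Type) (f : R -> S) (W : weierstrass R) :
    weierstrass S :=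
  Weierstrass (f (wa1 W)) (f (wa2 W)) (f (wa3 W)) (f (wa4 W)) (f (wa6 W)).

Definition over_rat (W : weierstrass int) : weierstrass rat :=
  map_weierstrass (fun n : int => n%:~R) W.

Section Invariants.
Variables (R : comNzRingType) (W : weierstrass R).

Definition b2 : R := wa1 W ^+ 2 + 4 * wa2 W.
Definition b4 : R := 2 * wa4 W + wa1 W * wa3 W.
Definition b6 : R := wa3 W ^+ 2 + 4 * wa6 W.
Definition b8 : R :=
  wa1 W ^+ 2 * wa6 W + 4 * wa2 W * wa6 W - wa1 W * wa3 W * wa4 W
  + wa2 W * wa3 W ^+ 2 - wa4 W ^+ 2.

Definition disc : R :=
  - b2 ^+ 2 * b8 - 8 * b4 ^+ 3 - 27 * b6 ^+ 2 + 9 * b2 * b4 * b6.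
End Invariants.

(* The model in x', y' obtained by the admissible change of variables
   x = u^2 x' + r,  y = u^3 y' + u^2 s x' + t. *)
Definition change_vars (F : fieldType) (u r s t : F) (W : weierstrass F) :
    weierstrass F :=
  let: Weierstrass a1 a2 a3 a4 a6 := W in
  Weierstrass
    ((a1 + 2 * s) / u)
    ((a2 - s * a1 + 3 * r - s ^+ 2) / u ^+ 2)
    ((a3 + r * a1 + 2 * t) / u ^+ 3)
    ((a4 - s * a3 + 2 * r * a2 - (t + r * s) * a1 + 3 * r ^+ 2 - 2 * s * t)
       / u ^+ 4)
    ((a6 + r * a4 + r ^+ 2 * a2 + r ^+ 3 - t * a3 - t ^+ 2 - r * t * a1)
       / u ^+ 6).

Definition isomorphic (F : fieldType) (W W' : weierstrass F) : Prop :=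
  exists u r s t : F, u != 0 /\ W' = change_vars u r s t W.

Definition p_integral (p : nat) (W : weierstrass rat) : Prop :=
  [/\ (0 <= padic_val p (wa1 W))%E, (0 <= padic_val p (wa2 W))%E,
      (0 <= padic_val p (wa3 W))%E, (0 <= padic_val p (wa4 W))%E
    & (0 <= padic_val p (wa6 W))%E].

(* W0 has integer coefficients, is Q-isomorphic to W, and at every prime p its
   discriminant has least valuation among the p-integral models of W. *)
Definition global_minimal_model (W : weierstrass rat) (W0 : weierstrass int) :
    Prop :=
  isomorphic W (over_rat W0) /\
  forall p : nat, prime p -> forall W' : weierstrass rat,
    isomorphic W W' -> p_integral p W' ->
    (padic_val p (disc (over_rat W0)) <= padic_val p (disc W'))%E.

Definition minimal_discriminant (W : weierstrass rat) (D : rat) : Prop :=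
  exists W0 : weierstrass int,
    global_minimal_model W W0 /\ D = disc (over_rat W0).

Lemma padic_val_int (p : nat) (n : int) :
  padic_val p n%:~R = if n == 0 then +oo%E else ((logn p `|n|)%:Z)%:E.
Proof. by rewrite /padic_val intr_eq0 numq_int denq_int logn1 subr0. Qed.

Lemma p_integral_over_rat (p : nat) (W : weierstrass int) :
  p_integral p (over_rat W).
Proof. by split; rewrite padic_val_int; case: ifP. Qed.

Lemma disc_change_vars (F : fieldType) (u r s t : F) (W : weierstrass F) :
  u != 0 -> disc (change_vars u r s t W) = disc W / u ^+ 12.
Proof.
by case: W => a1 a2 a3 a4 a6 u0; rewrite /disc /b8 /b6 /b4 /b2 /=; field.
Qed.

Lemma disc_over_rat (W : weierstrass int) : disc (over_rat W) = (disc W)%:~R.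
Proof. by case: W => *; rewrite /disc /b8 /b6 /b4 /b2 /=; ring. Qed.

(* The minimal discriminant is well defined. *)
Lemma minimal_discriminant_unique (W : weierstrass rat) (D D' : rat) :
  disc W != 0 -> minimal_discriminant W D -> minimal_discriminant W D' ->
  D = D'.
Proof.
move=> W0 [W1 [[iso1 min1] ->]] [W2 [[iso2 min2] ->]].
have sg V : isomorphic W (over_rat V) ->
    Num.sg (disc V)%:~R = Num.sg (disc W) /\ disc V != 0.
  move=> [u [r [s [t [u0 eV]]]]].
  have u12 : 0 < u ^+ 12 by rewrite (exprM u 2 6) exprn_gt0 ?exprn_even_gt0.
  have -> : (disc V)%:~R = disc W / u ^+ 12.
    by rewrite -disc_over_rat eV disc_change_vars.
  split; first by rewrite sgrM sgrV (gtr0_sg u12) mulr1.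
  rewrite -(intr_eq0 rat) -disc_over_rat eV disc_change_vars //.
  by rewrite mulf_neq0 // invr_eq0 gt_eqF.
have [sg1 nz1] := sg _ iso1; have [sg2 nz2] := sg _ iso2.
have val_eq p : prime p -> logn p `|disc W1| = logn p `|disc W2|.
  move=> pp; apply/eqP; rewrite eqn_leq; apply/andP; split.
    have := min1 p pp _ iso2 (p_integral_over_rat p W2).
    by rewrite !disc_over_rat !padic_val_int (negPf nz1) (negPf nz2) lee_fin.
  have := min2 p pp _ iso1 (p_integral_over_rat p W1).
  by rewrite !disc_over_rat !padic_val_int (negPf nz1) (negPf nz2) lee_fin.
have abs_eq : `|disc W1|%N = `|disc W2|%N.
  apply: eqn_from_log; rewrite ?absz_gt0 // => p.
  by case: (boolP (prime p)) => [/val_eq//|/negPf np]; rewrite /logn np.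
rewrite !disc_over_rat [in LHS](numEsg (disc W1)%:~R) sg1 -sg2.
rewrite -(intr_norm) -abszE abs_eq abszE intr_norm.
by rewrite -numEsg.
Qed.

Inductive torsion :=
  | C2 | C3_0 | C3 | C4 | C5 | C6 | C7 | C8 | C9 | C10 | C12
  | C2xC2 | C2xC4 | C2xC6 | C2xC8.

(* All the families are given the three parameters a, b, d: d matters only for
   C2 and C2xC2, and b is irrelevant for C3_0. *)
Definition E (T : torsion) (a b d : int) : weierstrass int :=
  match T with
  | C2 => Weierstrass 0 (2 * a) 0 (a ^+ 2 - b ^+ 2 * d) 0
  | C3_0 => Weierstrass 0 0 a 0 0
  | C3 => Weierstrass a 0 (a ^+ 2 * b) 0 0
  | C4 => Weierstrass a (- (a * b)) (- (a ^+ 2 * b)) 0 0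
  | C5 => Weierstrass (a - b) (- (a * b)) (- (a ^+ 2 * b)) 0 0
  | C6 =>
      Weierstrass (a - b) (- (a * b) - b ^+ 2) (- (a ^+ 2 * b) - a * b ^+ 2)
        0 0
  | C7 =>
      Weierstrass (a ^+ 2 + a * b - b ^+ 2)
        (a ^+ 2 * b ^+ 2 - a * b ^+ 3)
        (a ^+ 4 * b ^+ 2 - a ^+ 3 * b ^+ 3) 0 0
  | C8 =>
      Weierstrass (- a ^+ 2 + 4 * a * b - 2 * b ^+ 2)
        (- (a ^+ 2 * b ^+ 2) + 3 * a * b ^+ 3 - 2 * b ^+ 4)
        (- (a ^+ 3 * b ^+ 3) + 3 * a ^+ 2 * b ^+ 4 - 2 * a * b ^+ 5) 0 0
  | C9 =>
      let a2 := a ^+ 4 * b ^+ 2 - 2 * a ^+ 3 * b ^+ 3 + 2 * a ^+ 2 * b ^+ 4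
                - a * b ^+ 5 in
      Weierstrass (a ^+ 3 + a * b ^+ 2 - b ^+ 3) a2 (a ^+ 3 * a2) 0 0
  | C10 =>
      let a2 := - (a ^+ 3 * b ^+ 3) + 3 * a ^+ 2 * b ^+ 4 - 2 * a * b ^+ 5 in
      Weierstrass (a ^+ 3 - 2 * a ^+ 2 * b - 2 * a * b ^+ 2 + 2 * b ^+ 3) a2
        ((a ^+ 3 - 3 * a ^+ 2 * b + a * b ^+ 2) * a2) 0 0
  | C12 =>
      let a2 := b * (a - 2 * b) * (a - b) ^+ 2
                * (a ^+ 2 - 3 * a * b + 3 * b ^+ 2)
                * (a ^+ 2 - 2 * a * b + 2 * b ^+ 2) in
      Weierstrass
        (- a ^+ 4 + 2 * a ^+ 3 * b + 2 * a ^+ 2 * b ^+ 2 - 8 * a * b ^+ 3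
         + 6 * b ^+ 4) a2 (a * (b - a) ^+ 3 * a2) 0 0
  | C2xC2 => Weierstrass 0 (a * d + b * d) 0 (a * b * d ^+ 2) 0
  | C2xC4 =>
      Weierstrass a (- (a * b) - 4 * b ^+ 2)
        (- (a ^+ 2 * b) - 4 * a * b ^+ 2) 0 0
  | C2xC6 =>
      Weierstrass (- (19 * a ^+ 2) + 2 * a * b + b ^+ 2)
        (- (10 * a ^+ 4) + 22 * a ^+ 3 * b - 14 * a ^+ 2 * b ^+ 2
         + 2 * a * b ^+ 3)
        (90 * a ^+ 6 - 198 * a ^+ 5 * b + 116 * a ^+ 4 * b ^+ 2
         + 4 * a ^+ 3 * b ^+ 3 - 14 * a ^+ 2 * b ^+ 4 + 2 * a * b ^+ 5) 0 0
  | C2xC8 =>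
      let a2 := - (4 * a * b ^+ 2 * (a + 2 * b) * (a + 4 * b) ^+ 2
                   * (a ^+ 2 + 4 * a * b + 8 * b ^+ 2)) in
      Weierstrass
        (- a ^+ 4 - 8 * a ^+ 3 * b - 24 * a ^+ 2 * b ^+ 2 + 64 * b ^+ 4) a2
        (- (2 * b * (a + 4 * b) * (a ^+ 2 - 8 * b ^+ 2) * a2)) 0 0
  end.

Definition gamma (T : torsion) (a b d : int) : int := disc (E T a b d).

Definition param_cond (T : torsion) (a b d : int) : Prop :=
  gamma T a b d != 0 /\
  match T with
  | C2 => [/\ b != 0, d != 1, squarefree d & squarefree (gcdz a b)]
  | C3_0 => 0 < a /\ cubefree a
  | C2xC2 => [/\ gcdz a b = 1, (2 %| a)%Z, 0 < d & squarefree d]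
  | _ => gcdz a b = 1 /\ 0 < a
  end.

(* "u is the value of u_T at the given parameters" *)
Definition is_u (T : torsion) (a b d : int) (u : nat) : Prop :=
  (0 < u)%N /\
  match T with
  | C5 | C7 | C9 | C3_0 => u = 1%N
  | C3 => exists c k e : int,
      [/\ 0 < c, 0 < k /\ squarefree k, 0 < e /\ squarefree e,
          gcdz k e = 1 & a = c ^+ 3 * k ^+ 2 * e] /\
      u%:Z = c ^+ 2 * k
  | C4 => exists c k : int,
      [/\ 0 < c, squarefree k & a = c ^+ 2 * k] /\
      ([/\ (8%:E <= v2 a)%E, exists m : int, v2 a = (2 * m)%:E
         & (b * k = 3 %[mod 4])%Z] -> u%:Z = 2 * c) /\
      ((v2 a <= 7%:E)%E \/ (b * k <> 3 %[mod 4])%Z -> u%:Z = c)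
  | C2 =>
      let w := v2 (b ^+ 2 * d - a ^+ 2) in
      let four := [/\ (8%:E <= w)%E, v2 a = 1%:E, v2 b = 1%:E
                    & (a = 2 %[mod 8])%Z] in
      let two := [\/ [/\ (8%:E <= w)%E, v2 a = 1%:E, v2 b = 1%:E
                       & (a = 6 %[mod 8])%Z],
                     [/\ (4%:E <= w)%E, (w <= 7%:E)%E, v2 a = 1%:E
                       & v2 b = 1%:E]
                   | (3%:E <= v2 b)%E /\ (a = 3 %[mod 4])%Z] in
      [/\ u = 4%N <-> four, u = 2%N <-> two & u = 1%N <-> ~ four /\ ~ two]
  | C6 =>
      (u = 2%N <-> (3%:E <= v2 (a + b)%R)%E) /\
      (u = 1%N <-> ~ (3%:E <= v2 (a + b)%R)%E)
  | C8 => (u = 2%N <-> v2 a = 1%:E) /\ (u = 1%N <-> v2 a <> 1%:E)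
  | C10 | C12 => (u = 2%N <-> (2 %| a)%Z) /\ (u = 1%N <-> ~ (2 %| a)%Z)
  | C2xC2 =>
      (u = 2%N <-> (4%:E <= v2 a)%E /\ (b * d = 1 %[mod 4])%Z) /\
      (u = 1%N <-> (v2 a <= 3%:E)%E \/ (b * d <> 1 %[mod 4])%Z)
  | C2xC4 =>
      [/\ u = 4%N <-> v2 a = 2%:E /\ (4%:E <= v2 (a + 4 * b)%R)%E,
          u = 2%N <-> (2%:E <= v2 a)%E /\ (v2 (a + 4 * b)%R <= 3%:E)%E
        & u = 1%N <-> (v2 a <= 1%:E)%E]
  | C2xC6 =>
      [/\ u = 16%N <-> v2 (a + b) = 1%:E,
          u = 4%N <-> (2%:E <= v2 (a + b)%R)%E
        & u = 1%N <-> v2 (a + b) = 0%:E]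
  | C2xC8 =>
      [/\ u = 64%N <-> (2%:E <= v2 a)%E, u = 16%N <-> v2 a = 1%:E
        & u = 1%N <-> v2 a = 0%:E]
  end.

(* Main.v *)
(* A scaling factor u > 0 between two models of a curve divides their c4, c6
   and discriminants by u^4, u^6 and u^12.  Hence an integral model is minimal
   at p unless p^4, p^6 and p^12 divide its c4, c6 and discriminant; at p = 2,
   Kraus' congruences, which (c4, c6) of any integral model satisfies, must
   moreover hold for (c4 / 16, c6 / 64).  For each family we exhibit the model
   obtained by scaling by u_T and show that no prime passes this test.  For the
   families with gcd(a, b) = 1 and polynomial parameters, c4 is coprime to every
   factor of the discriminant away from 2 and one odd prime q in {3, 5, 7}: this
   is certified by Bezout relations, and q is dealt with by looking at all
   residues modulo a power of q.  The other families and the prime 2 are treated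
   by hand; at 2 the first coefficient a1 of the scaled model is usually odd,
   which forces c4 to be odd. *)

Require Import Defs.
From Stdlib Require Import ZArith Znumtheory Lia List.
From HB Require Import structures.
From mathcomp Require Import all_boot all_order all_algebra.
From mathcomp Require Import constructive_ereal.

Local Arguments Z.mul : simpl never.
Local Arguments Z.pow : simpl never.
Local Arguments Z.add : simpl never.
Local Arguments Z.sub : simpl never.
Local Arguments Z.opp : simpl never.
Local Arguments Z.eqb : simpl never.

Local Open Scope Z_scope.

(** A competing model is only [p]-integral over the rationals, so its scaling factor against the
    exhibited model is a fraction. Clearing denominators by some [N] prime to [p] gives relations
    [N^k inv(V) = p^k inv(V')] between integral models, for [k = 4, 6, 12]; Gauss' lemma and, at 2,
    the congruence [N^2 = 1 mod 8] turn them into the test, which serves as a necessary condition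
    for a smaller model. The two Bezout relations of a factor eliminate [a] and [b] in turn: a prime
    dividing [c4] and that factor divides an explicit constant, or both parameters. They can be
    applied to the unscaled forms, because at odd primes the test passes back along integral changes
    of variables. In the other families a prime may divide all the invariants through [k], [e], [d]
    or [gcd(a, b)]; there the invariants are factored, and squarefreeness or cubefreeness bounds the
    share of [p^4], [p^6], [p^12] that these factors absorb. At 2, when [a1] stays even, either the
    discriminant has valuation below 12 or Kraus' congruences fail. *)

Definition b2Z (W : weierstrass Z) := wa1 W ^ 2 + 4 * wa2 W.
Definition b4Z W := 2 * wa4 W + wa1 W * wa3 W.
Definition b6Z W := wa3 W ^ 2 + 4 * wa6 W.
Definition b8Z W :=
  wa1 W ^ 2 * wa6 W + 4 * wa2 W * wa6 W - wa1 W * wa3 W * wa4 W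
  + wa2 W * wa3 W ^ 2 - wa4 W ^ 2.
Definition c4Z W := b2Z W ^ 2 - 24 * b4Z W.
Definition c6Z W := - b2Z W ^ 3 + 36 * b2Z W * b4Z W - 216 * b6Z W.
Definition discZ W :=
  - b2Z W ^ 2 * b8Z W - 8 * b4Z W ^ 3 - 27 * b6Z W ^ 2
  + 9 * b2Z W * b4Z W * b6Z W.

(* Kraus' condition for (x, y) to be the (c4, c6) of a 2-integral model. *)
Definition kraus2 (x y : Z) :=
  y mod 4 = 3 \/ x mod 16 = 0 /\ (y mod 32 = 0 \/ y mod 32 = 8).

(** By [c4^3 - c6^2 = 1728 disc] the third divisibility follows from the first two only for [p] at
    least 5, so it is recorded separately. The divisions by 16 and 64 are exact at 2 by the
    preceding clauses. *)
Definition reducible p W :=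
  (p ^ 4 | c4Z W) /\ (p ^ 6 | c6Z W) /\ (p ^ 12 | discZ W) /\
  (p = 2 -> kraus2 (c4Z W / 16) (c6Z W / 64)).

Lemma Z_mod_cases m a : 0 < m -> exists q r, a = m * q + r /\ 0 <= r < m.
Proof.
by move=> m0; exists (a / m), (a mod m); split;
  [apply: Z.div_mod; lia | apply: Z.mod_pos_bound].
Qed.

Lemma kraus2_of_model W : kraus2 (c4Z W) (c6Z W).
Proof.
case: W => a1 a2 a3 a4 a6.
rewrite /kraus2 /c4Z /c6Z /b6Z /b4Z /b2Z /=.
have mod_eq m x y k : 0 <= y < m -> x = y + k * m -> x mod m = y.
  by move=> ym ->; rewrite Z.mod_add ?Z.mod_small //; lia.
have [k [r [-> hr]]] := @Z_mod_cases 2 a1 ltac:(lia).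
have [->|->] : r = 0 \/ r = 1 by lia.
  right; have [l [s [-> hs]]] := @Z_mod_cases 2 a3 ltac:(lia).
  split.
    apply: (mod_eq _ _ _ ((k ^ 2 + a2) ^ 2 - 3 * (a4 + k * (2 * l + s)))); first lia.
    by ring.
  have [->|->] : s = 0 \/ s = 1 by lia.
    left; apply: (mod_eq _ _ _ (- 2 * (k ^ 2 + a2) ^ 3
       + 9 * (k ^ 2 + a2) * (a4 + 2 * k * l) - 27 * (l ^ 2 + a6))); first lia.
    by ring.
  right; apply: (mod_eq _ _ _ (- 2 * (k ^ 2 + a2) ^ 3
     + 9 * (k ^ 2 + a2) * (a4 + k * (2 * l + 1)) - 27 * (l ^ 2 + l + a6) - 7)); first lia.
  by ring.
left; pose c := k ^ 2 + k + a2.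
apply: (mod_eq _ _ _ (9 * (4 * c + 1) * (2 * a4 + (2 * k + 1) * a3)
   - 54 * (a3 ^ 2 + 4 * a6) - 16 * c ^ 3 - 12 * c ^ 2 - 3 * c - 1)); first lia.
by rewrite /c; ring.
Qed.

Lemma prime_ndvd_pow p n k : Znumtheory.prime p -> ~ (p | n) -> 0 <= k -> ~ (p | n ^ k).
Proof.
move=> pp pn k0; move: k k0; apply: natlike_ind => [/Z.divide_1_r_nonneg|k k0 IH].
  by have := prime_ge_2 _ pp; lia.
by rewrite Z.pow_succ_r // => /(prime_mult _ pp) [].
Qed.

Lemma rel_prime_powr m n k : rel_prime m n -> 0 <= k -> rel_prime m (n ^ k).
Proof.
move=> mn; move: k; apply: natlike_ind => [|k k0 IH].
  exact: rel_prime_sym (rel_prime_1 _).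
by rewrite Z.pow_succ_r //; apply: rel_prime_mult.
Qed.

Lemma rel_prime_pow p n k l : Znumtheory.prime p -> ~ (p | n) ->
  0 <= k -> 0 <= l -> rel_prime (p ^ k) (n ^ l).
Proof.
move=> pp pn k0 l0; apply: rel_prime_powr => //; apply: rel_prime_sym.
by apply: rel_prime_powr => //; apply: rel_prime_sym; apply: prime_rel_prime.
Qed.

(** At 2, [N] is odd, so [N^4 = 1 mod 16] and [N^6 = 1 mod 8]; this is enough to carry Kraus'
    condition from the integral model [V'] to the quotients of the invariants of [V]. *)
Lemma reducible_of_descent p N V V' : Znumtheory.prime p -> ~ (p | N) ->
  N ^ 4 * c4Z V = p ^ 4 * c4Z V' -> N ^ 6 * c6Z V = p ^ 6 * c6Z V' ->
  N ^ 12 * discZ V = p ^ 12 * discZ V' -> reducible p V.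
Proof.
move=> pp pN e4 e6 e12.
have dv k x y : 0 <= k -> N ^ k * x = p ^ k * y -> (p ^ k | x).
  move=> k0 e; apply: (Gauss _ (N ^ k)); last exact: rel_prime_pow.
  by exists y; rewrite e; ring.
split; first exact: (dv 4 _ _ ltac:(lia) e4).
split; first exact: (dv 6 _ _ ltac:(lia) e6).
split=> [|p2]; first exact: (dv 12 _ _ ltac:(lia) e12).
have [x ex] := dv 4 _ _ ltac:(lia) e4; have [y ey] := dv 6 _ _ ltac:(lia) e6.
rewrite ex ey p2 -[2 ^ 4]/16 -[2 ^ 6]/64 !Z.div_mul //.
(* An odd square is 1 modulo 8; the invariants of [V'] become [(8 M + 1)^2 x] and
   [(8 M + 1)^3 y]. *)
have [M eM] : exists M, N ^ 2 = 8 * M + 1.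
  have [q [r [eN hr]]] := @Z_mod_cases 2 N ltac:(lia).
  have rn0 : r <> 0 by move=> r0; apply: pN; exists q; lia.
  have [h [s [eq hs]]] := @Z_mod_cases 2 q ltac:(lia).
  have -> : N = 4 * h + 2 * s + 1 by lia.
  have [->|->] : s = 0 \/ s = 1 by lia.
    by exists (2 * h ^ 2 + h); ring.
  by exists (2 * h ^ 2 + 3 * h + 1); ring.
have e4' : c4Z V' = (8 * M + 1) ^ 2 * x.
  apply: (Z.mul_reg_l _ _ 16) => //.
  by rewrite -[16]/(2 ^ 4) -p2 -e4 ex -eM p2; ring.
have e6' : c6Z V' = (8 * M + 1) ^ 3 * y.
  apply: (Z.mul_reg_l _ _ 64) => //.
  by rewrite -[64]/(2 ^ 6) -p2 -e6 ey -eM p2; ring.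
have := kraus2_of_model V'; rewrite /kraus2 e4' e6'.
have mod_eq m u v k : 0 < m -> u = v + k * m -> u mod m = v mod m.
  by move=> m0 ->; rewrite Z.mod_add //; lia.
rewrite (mod_eq 4 _ y (y * (128 * M ^ 3 + 48 * M ^ 2 + 6 * M))) //; last by ring.
rewrite (mod_eq 16 _ x (x * (4 * M ^ 2 + M))) //; last by ring.
case=> [->|[-> hy]]; [by left | right; split=> //].
(* [N^6 = 8 M' + 1] compares [N^6 y] with [y] only modulo 8; once 8 is known to divide [y], the
   comparison holds modulo 64, hence modulo 32. *)
pose M' := 64 * M ^ 3 + 24 * M ^ 2 + 3 * M.
have eu : (8 * M + 1) ^ 3 * y = y + 8 * (M' * y) by rewrite /M'; ring.
have [q eq8] : exists q, y = 8 * q.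
  have := Z_div_mod_eq_full ((8 * M + 1) ^ 3 * y) 32; rewrite {1}eu.
  move: (_ / 32) (M' * y) => Q t; clear - hy.
  case: hy => -> e; first by exists (4 * Q - t); lia.
  by exists (4 * Q + 1 - t); lia.
by rewrite -(mod_eq 32 ((8 * M + 1) ^ 3 * y) y (2 * M' * q)) // eu eq8; ring.
Qed.

(** * Admissible changes of variables over Z *)

(** The transformation formulas cleared of denominators, as a relation: the existence of an integral
    [V] carries the divisibility by powers of [u]. *)
Definition changeZ (u r s t : Z) (W V : weierstrass Z) : Prop :=
  [/\ u * wa1 V = wa1 W + 2 * s,
      u ^ 2 * wa2 V = wa2 W - s * wa1 W + 3 * r - s ^ 2,
      u ^ 3 * wa3 V = wa3 W + r * wa1 W + 2 * t,
      u ^ 4 * wa4 V = wa4 W - s * wa3 W + 2 * r * wa2 W - (t + r * s) * wa1 W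
                      + 3 * r ^ 2 - 2 * s * t
    & u ^ 6 * wa6 V = wa6 W + r * wa4 W + r ^ 2 * wa2 W + r ^ 3 - t * wa3 W
                      - t ^ 2 - r * t * wa1 W].

(** Weighted homogeneity, [a_i] having weight [i]: the equations of [changeZ] can then be
    substituted on the right without any division. *)
Lemma c4Z_weight u a1 a2 a3 a4 a6 :
  u ^ 4 * c4Z (Weierstrass a1 a2 a3 a4 a6) =
  c4Z (Weierstrass (u * a1) (u ^ 2 * a2) (u ^ 3 * a3) (u ^ 4 * a4) (u ^ 6 * a6)).
Proof. by rewrite /c4Z /b2Z /b4Z /=; ring. Qed.

Lemma c6Z_weight u a1 a2 a3 a4 a6 :
  u ^ 6 * c6Z (Weierstrass a1 a2 a3 a4 a6) =
  c6Z (Weierstrass (u * a1) (u ^ 2 * a2) (u ^ 3 * a3) (u ^ 4 * a4) (u ^ 6 * a6)).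
Proof. by rewrite /c6Z /b2Z /b4Z /b6Z /=; ring. Qed.

Lemma discZ_weight u a1 a2 a3 a4 a6 :
  u ^ 12 * discZ (Weierstrass a1 a2 a3 a4 a6) =
  discZ (Weierstrass (u * a1) (u ^ 2 * a2) (u ^ 3 * a3) (u ^ 4 * a4) (u ^ 6 * a6)).
Proof. by rewrite /discZ /b2Z /b4Z /b6Z /b8Z /=; ring. Qed.

Lemma changeZ_c4 u r s t W V : changeZ u r s t W V -> u ^ 4 * c4Z V = c4Z W.
Proof.
case: W V => w1 w2 w3 w4 w6 [a1 a2 a3 a4 a6] [/= e1 e2 e3 e4 e6].
by rewrite c4Z_weight e1 e2 e3 e4 e6 /c4Z /b2Z /b4Z /=; ring.
Qed.

Lemma changeZ_c6 u r s t W V : changeZ u r s t W V -> u ^ 6 * c6Z V = c6Z W.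
Proof.
case: W V => w1 w2 w3 w4 w6 [a1 a2 a3 a4 a6] [/= e1 e2 e3 e4 e6].
by rewrite c6Z_weight e1 e2 e3 e4 e6 /c6Z /b2Z /b4Z /b6Z /=; ring.
Qed.

Lemma changeZ_disc u r s t W V : changeZ u r s t W V -> u ^ 12 * discZ V = discZ W.
Proof.
case: W V => w1 w2 w3 w4 w6 [a1 a2 a3 a4 a6] [/= e1 e2 e3 e4 e6].
by rewrite discZ_weight e1 e2 e3 e4 e6 /discZ /b2Z /b4Z /b6Z /b8Z /=; ring.
Qed.

(** Away from 2 the Kraus clause is vacuous and the invariants of [W] are multiples of those of [V],
    so these primes can be handled on whichever model has the simpler invariants. *)
Lemma changeZ_reducible u r s t W V p : changeZ u r s t W V -> p <> 2 ->
  reducible p V -> reducible p W.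
Proof.
move=> h p2 [h4 [h6 [h12 _]]].
rewrite /reducible -(changeZ_c4 _ _ _ _ _ _ h) -(changeZ_c6 _ _ _ _ _ _ h).
rewrite -(changeZ_disc _ _ _ _ _ _ h); split; first exact: Z.divide_mul_r.
by split; [exact: Z.divide_mul_r | split; [exact: Z.divide_mul_r |]].
Qed.

Definition minimal_scaling (u : Z) (W : weierstrass Z) : Prop :=
  exists V r s t, changeZ u r s t W V /\
    forall p, Znumtheory.prime p -> ~ reducible p V.

(** * Binary forms with integer coefficients *)

(* [:: c0; ...; cn] stands for c0 a^n + c1 a^(n-1) b + ... + cn b^n. *)
Fixpoint form (l : list Z) (a b : Z) : Z :=
  if l is c :: l' then c * a ^ Z.of_nat (length l') + b * form l' a b else 0.

Fixpoint form_add (l m : list Z) : list Z :=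
  match l, m with
  | x :: l', y :: m' => x + y :: form_add l' m'
  | _, _ => nil
  end.

(** The length of a list fixes the degree of the form, so partial products are padded with zeros to
    a common length; [form_add] truncates lists of unequal lengths. *)
Fixpoint form_mul (l m : list Z) : list Z :=
  match l with
  | nil => repeat 0 (length m).-1
  | c :: nil => List.map (Z.mul c) m
  | c :: l' =>
      form_add (List.map (Z.mul c) m ++ repeat 0 (length l'))
               (0 :: form_mul l' m)
  end.

Lemma form_repeat0 n a b : form (repeat 0 n) a b = 0.
Proof. by elim: n => //= n ->; ring. Qed.

Lemma form_cat0 l n a b :
  form (l ++ repeat 0 n) a b = form l a b * a ^ Z.of_nat n.
Proof.
elim: l => [|c l IH] /=; first by rewrite form_repeat0.
by rewrite IH length_app repeat_length Nat2Z.inj_add Z.pow_add_r; [ring|lia..].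
Qed.

Lemma form_scale c l a b : form (List.map (Z.mul c) l) a b = c * form l a b.
Proof. by elim: l => [|x l IH] /=; rewrite ?IH ?length_map; ring. Qed.

Lemma length_form_add l m : length l = length m -> length (form_add l m) = length l.
Proof. by elim: l m => [|x l IH] [|y m] //= [/IH ->]. Qed.

Lemma form_addE l m a b : length l = length m ->
  form (form_add l m) a b = form l a b + form m a b.
Proof.
elim: l m => [|x l IH] [|y m] //= [e].
by rewrite IH // length_form_add // e; ring.
Qed.

Lemma length_form_mul l m : m <> nil -> l <> nil ->
  length (form_mul l m) = (length l + length m).-1.
Proof.
move=> m0; have lm : (0 < length m)%coq_nat by case: m m0 => //= *; lia.
elim: l => // c [|c' l] IH _; first by rewrite /= length_map; lia.
have {}IH := IH ltac:(done).
rewrite [form_mul _ _]/= -/(form_mul (c' :: l) m).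
have e : length (List.map (Z.mul c) m ++ repeat 0 (length (c' :: l)))
  = length (0 :: form_mul (c' :: l) m).
  rewrite length_app length_map repeat_length [RHS]/= IH /=.
  by lia.
by rewrite length_form_add // e [LHS]/= IH /=; lia.
Qed.

Lemma form_mulE l m a b : m <> nil -> l <> nil ->
  form (form_mul l m) a b = form l a b * form m a b.
Proof.
move=> m0; have lm : (0 < length m)%coq_nat by case: m m0 => //= *; lia.
elim: l => // c [|c' l] IH _.
  by rewrite /= form_scale Z.pow_0_r; ring.
rewrite [form_mul _ _]/= -/(form_mul (c' :: l) m)
  -[0 :: repeat _ _]/(repeat 0 (length (c' :: l))) form_addE; last first.
  rewrite length_app length_map repeat_length.
  change (length (0 :: form_mul (c' :: l) m)) with (S (length (form_mul (c' :: l) m))).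
  rewrite length_form_mul //=.
  by lia.
have formS x l' : form (x :: l') a b
    = x * a ^ Z.of_nat (length l') + b * form l' a b by [].
by rewrite form_cat0 form_scale !formS -/(form (c' :: l) a b) IH // formS; ring.
Qed.

(** * Bezout relations between binary forms *)

Definition power_b_coef (l : list Z) : Z :=
  if forallb (Z.eqb 0) (removelast l) then List.last l 0 else 0.

Definition power_a_coef (l : list Z) : Z :=
  if l is c :: l' then if forallb (Z.eqb 0) l' then c else 0 else 0.

Lemma form_zeros l a b : forallb (Z.eqb 0) l -> form l a b = 0.
Proof. by elim: l => //= c l IH /andP[/Z.eqb_eq <- /IH ->]; ring. Qed.

(** The default 0 of [power_b_coef] on lists that are not multiples of a power of [b] makes a
    nonzero coefficient the whole certificate. *)
Lemma form_power_b l a b : power_b_coef l <> 0 ->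
  exists n : nat, form l a b = power_b_coef l * b ^ Z.of_nat n.
Proof.
rewrite /power_b_coef; case: ifP => // + _.
elim: l => [|c l IH] //=; first by exists 0%N.
case: l IH => [|c' l] IH /=; first by exists 0%N => /=; rewrite !Z.pow_0_r; ring.
case/andP => /Z.eqb_eq <- /IH [n] /= e; exists n.+1.
by rewrite e Nat2Z.inj_succ Z.pow_succ_r; [ring | lia].
Qed.

Lemma form_power_a l a b : power_a_coef l <> 0 ->
  exists n : nat, form l a b = power_a_coef l * a ^ Z.of_nat n.
Proof.
case: l => //= c l; case: ifP => // /form_zeros z _.
by exists (length l); rewrite z; ring.
Qed.

(* A factor f of the discriminant, with its multiplicity, and two Bezout
   relations u c4 + v f = R b^n and u' c4 + v' f = R' a^n'. *)
Record cert := Cert {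
  factor : list Z; mult : Z; ub : list Z; vb : list Z; ua : list Z; va : list Z }.

Definition combination (u g v f : list Z) := form_add (form_mul u g) (form_mul v f).

Definition nonnil (l : list Z) := if l is nil then false else true.

(** The last test makes the constant of the relation a divisor of [m^24], so that its prime factors
    divide [m]; 24 is a bound large enough for the exponents that occur. The length test is what
    makes [form_add] faithful. *)
Definition check_combination (m : Z) coef (u g v f : list Z) : bool :=
  let l := combination u g v f in
  [&& nonnil u, nonnil g, nonnil v, nonnil f,
      Nat.eqb (length (form_mul u g)) (length (form_mul v f)),
      negb (Z.eqb (coef l) 0) & Z.eqb (m ^ 24 mod coef l) 0].

Definition check_cert (m : Z) (g : list Z) (c : cert) : bool :=
  [&& Z.ltb 0 (mult c),
      check_combination m power_b_coef (ub c) g (vb c) (factor c)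
    & check_combination m power_a_coef (ua c) g (va c) (factor c)].

Lemma nonnilP l : nonnil l -> l <> nil. Proof. by case: l. Qed.

Lemma prime_pos p : Znumtheory.prime p -> 0 < p.
Proof. by move/prime_ge_2; lia. Qed.

Lemma prime_dvd_pow p n k : Znumtheory.prime p -> 0 <= k -> (p | n ^ k) -> (p | n).
Proof.
move=> pp k0 h; case: (Zdivide_dec p n) => // pn.
by case: (prime_ndvd_pow _ _ _ pp pn k0).
Qed.

Lemma combination_dvd m coef u g v f p a b x :
  (forall l, coef l <> 0 -> exists n : nat, form l a b = coef l * x ^ Z.of_nat n) ->
  check_combination m coef u g v f -> Znumtheory.prime p ->
  (p | form g a b) -> (p | form f a b) -> (p | m) \/ (p | x).
Proof.
move=> hc /and5P[/nonnilP u0 /nonnilP g0 /nonnilP v0 /nonnilP f0].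
case/and3P => /Nat.eqb_eq len /negP/Z.eqb_eq c0 /Z.eqb_eq/Z.mod_divide-/(_ c0) hm pp pg pf.
have [n en] := hc _ c0.
have : (p | form (combination u g v f) a b).
  rewrite form_addE // !form_mulE //.
  by apply: Z.divide_add_r; apply: Z.divide_mul_r.
rewrite en => /(prime_mult _ pp)[/Z.divide_trans h|].
  by left; apply: (prime_dvd_pow _ _ 24) => //; apply: h.
by move/prime_dvd_pow => h; right; apply: h => //; lia.
Qed.

Fixpoint form_prod (cs : list cert) (a b : Z) : Z :=
  if cs is c :: cs' then form (factor c) a b ^ mult c * form_prod cs' a b else 1.

(** For the factor that [p] divides, the relation in [b^n] leaves [p | m] or [p | b], and the one in
    [a^n] leaves [p | m] or [p | a]. *)
Lemma form_prod_dvd m g cs p a b : forallb (check_cert m g) cs ->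
  Znumtheory.prime p -> (p | form g a b) -> (p | form_prod cs a b) ->
  (p | m) \/ (p | a) /\ (p | b).
Proof.
move=> + pp pg; elim: cs => [_ /Z.divide_1_r_nonneg|c cs IH] /=.
  by have := prime_ge_2 _ pp; lia.
case/andP => /and3P[/Z.ltb_lt m0 cb ca] /IH {}IH /(prime_mult _ pp)[|//].
move/prime_dvd_pow => /(_ pp) pf; have {}pf := pf ltac:(lia).
have [|hb] := combination_dvd _ _ _ _ _ _ _ _ _ _ (form_power_b^~ a^~ b) cb pp pg pf; first by left.
have [|ha] := combination_dvd _ _ _ _ _ _ _ _ _ _ (form_power_a^~ a^~ b) ca pp pg pf; first by left.
by right.
Qed.

(** * Values of forms modulo a prime power *)

Definition congr_mod (M x y : Z) := (M | x - y).

Lemma congr_mod_mul M x x' y y' :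
  congr_mod M x x' -> congr_mod M y y' -> congr_mod M (x * y) (x' * y').
Proof.
move=> [u eu] [v ev]; exists (u * y + x' * v).
transitivity ((x - x') * y + x' * (y - y')); first by ring.
by rewrite eu ev; ring.
Qed.

Lemma congr_mod_pow M x y k : 0 <= k -> congr_mod M x y -> congr_mod M (x ^ k) (y ^ k).
Proof.
move=> k0 h; move: k k0; apply: natlike_ind => [|k k0 IH].
  by exists 0; rewrite !Z.pow_0_r.
by rewrite !Z.pow_succ_r //; apply: congr_mod_mul.
Qed.

Lemma congr_mod_form M l a b x y :
  congr_mod M a x -> congr_mod M b y -> congr_mod M (form l a b) (form l x y).
Proof.
move=> ha hb; elim: l => [|c l IH] /=; first by exists 0.
have [u eu] := congr_mod_pow _ _ _ _ (Nat2Z.is_nonneg (length l)) ha.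
have [v ev] := congr_mod_mul _ _ _ _ _ hb IH.
exists (c * u + v).
by rewrite Z.mul_add_distr_r -ev -Z.mul_assoc -eu; ring.
Qed.

Lemma congr_mod_form_prod M cs a b x y : forallb (fun c => Z.ltb 0 (mult c)) cs ->
  congr_mod M a x -> congr_mod M b y ->
  congr_mod M (form_prod cs a b) (form_prod cs x y).
Proof.
move=> + ha hb; elim: cs => [_|c cs IH] /=; first by exists 0.
case/andP => /Z.ltb_lt m0 /IH {}IH; apply: congr_mod_mul => //.
by apply: congr_mod_pow; [lia | apply: congr_mod_form].
Qed.

Lemma congr_mod_dvd M x y : congr_mod M x y -> (M | x) -> (M | y).
Proof. by move=> [u e] [v ev]; exists (v - u); lia. Qed.

(** The extra [t] on the left turns the exponent [length l - 1], the degree, into [length l], which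
    also makes sense for the empty list. *)
Lemma form_homogeneous l t a b :
  t * form l (t * a) (t * b) = t ^ Z.of_nat (length l) * form l a b.
Proof.
elim: l => [|c l IH]; first by rewrite /=; ring.
rewrite [length _]/= Nat2Z.inj_succ Z.pow_succ_r; last exact: Nat2Z.is_nonneg.
rewrite [form _ _ _]/= [form _ a b]/=.
transitivity (t * (c * (t * a) ^ Z.of_nat (length l)
  + b * (t * form l (t * a) (t * b)))); first by ring.
by rewrite IH Z.pow_mul_l; ring.
Qed.

Lemma form_dvd_scale l t a b : (form l a b | form l (t * a) (t * b)).
Proof.
case: l => [|c l]; first exact: Z.divide_refl.
exists (t ^ Z.of_nat (length l)) => /=.
transitivity (c * (t * a) ^ Z.of_nat (length l)
  + b * (t * form l (t * a) (t * b))); first by ring.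
by rewrite form_homogeneous Z.pow_mul_l; ring.
Qed.

Lemma form_prod_dvd_scale cs t a b : (form_prod cs a b | form_prod cs (t * a) (t * b)).
Proof.
elim: cs => [|c cs [v ev]] /=; first exact: Z.divide_refl.
have [u eu] := form_dvd_scale (factor c) t a b.
by exists (u ^ mult c * v); rewrite eu ev Z.pow_mul_l; ring.
Qed.

Definition residues (M : Z) := List.map Z.of_nat (List.seq 0 (Z.to_nat M)).

Definition nonvanishing (M : Z) (g : list Z) (c0 : Z) (cs : list cert) (x y : Z) : bool :=
  if Z.eqb (form g x y mod M) 0
  then negb (Z.eqb (c0 * form_prod cs x y mod M) 0) else true.

(* By homogeneity it suffices to look at the points (x, 1) and (1, x). *)
Definition check_residues (M : Z) (g : list Z) (c0 : Z) (cs : list cert) : bool :=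
  forallb (fun x => nonvanishing M g c0 cs x 1 && nonvanishing M g c0 cs 1 x)
    (residues M).

Lemma nonvanishing_ndvd M g c0 cs a b x y : M <> 0 ->
  forallb (fun c => Z.ltb 0 (mult c)) cs -> nonvanishing M g c0 cs x y ->
  congr_mod M a x -> congr_mod M b y ->
  (M | form g a b) -> ~ (M | c0 * form_prod cs a b).
Proof.
move=> M0 hm + ax by_ hg hD.
have /Z.mod_divide-/(_ M0) hg' := congr_mod_dvd _ _ _ (congr_mod_form _ g _ _ _ _ ax by_) hg.
have /Z.mod_divide-/(_ M0) hD' := congr_mod_dvd _ _ _ (congr_mod_mul _ _ _ _ _
  (ex_intro _ 0 (Z.sub_diag c0)) (congr_mod_form_prod _ cs _ _ _ _ hm ax by_)) hD.
by rewrite /nonvanishing hg' hD'.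
Qed.

(** A coordinate prime to [M] has an inverse [t] modulo [M]. Multiplying the point by [t] keeps both
    divisibilities and brings it to [(1, x)] or [(x, 1)], so [2 M] points are inspected instead of
    [M^2]. *)
Lemma residues_ndvd M g c0 cs a b : 0 < M ->
  forallb (fun c => Z.ltb 0 (mult c)) cs -> check_residues M g c0 cs ->
  rel_prime a M \/ rel_prime b M ->
  (M | form g a b) -> ~ (M | c0 * form_prod cs a b).
Proof.
move=> M0 hm /forallb_forall chk rel hg hD.
have M1 : M <> 0 by lia.
have chk' z : nonvanishing M g c0 cs (z mod M) 1 && nonvanishing M g c0 cs 1 (z mod M).
  have hz := Z.mod_pos_bound z M M0; apply: chk; apply/in_map_iff.
  by exists (Z.to_nat (z mod M)); split; [|apply/in_seq]; lia.
have cong z : congr_mod M z (z mod M).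
  by exists (z / M); have := Z.div_mod z M M1; lia.
have inverse z : rel_prime z M -> exists t, congr_mod M (t * z) 1.
  by case/rel_prime_bezout => u v e; exists u, (- v); lia.
have scaled t : (M | form g (t * a) (t * b)) /\ (M | c0 * form_prod cs (t * a) (t * b)).
  split; first exact: Z.divide_trans (form_dvd_scale g t a b).
  apply: (Z.divide_trans _ _ _ hD); apply: Z.mul_divide_mono_l.
  exact: form_prod_dvd_scale.
case: rel => /inverse [t ht]; have [hg' hD'] := scaled t.
  have /andP[_ nv] := chk' (t * b).
  exact: (nonvanishing_ndvd _ _ _ _ _ _ _ _ M1 hm nv ht (cong _) hg' hD').
have /andP[nv _] := chk' (t * a).
exact: (nonvanishing_ndvd _ _ _ _ _ _ _ _ M1 hm nv (cong _) ht hg' hD').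
Qed.

(** * Family certificates and odd primes *)

Lemma prime_5 : Znumtheory.prime 5.
Proof.
apply/prime_alt; split=> // n n1 [z hz].
by have : n = 2 \/ n = 3 \/ n = 4; [lia | case=> [|[]] *; lia].
Qed.

Lemma prime_7 : Znumtheory.prime 7.
Proof.
apply/prime_alt; split=> // n n1 [z hz].
have : n = 2 \/ n = 3 \/ n = 4 \/ n = 5 \/ n = 6 by lia.
by case=> [|[|[|[]]]] *; lia.
Qed.

(* q is the only odd prime at which the family can have additive reduction
   (q = 1 when there is none). *)
Record family_cert := FamilyCert {
  odd_prime : Z; odd_prime_power : Z; c4_form : list Z; disc_coef : Z;
  disc_factors : list cert }.

Definition check_family (F : family_cert) : bool :=
  let q := odd_prime F in let M := odd_prime_power F in
  [&& [|| Z.eqb q 1, Z.eqb q 3, Z.eqb q 5 | Z.eqb q 7],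
      Z.eqb (M mod q) 0, Z.ltb 0 M, Z.eqb (q ^ 4 mod M) 0,
      Z.eqb ((2 * q) ^ 24 mod disc_coef F) 0, Z.ltb 0 (Z.abs (disc_coef F)),
      forallb (check_cert (2 * q) (c4_form F)) (disc_factors F)
    & Z.eqb q 1 || check_residues M (c4_form F) (disc_coef F) (disc_factors F)].

(** An odd [p] dividing [c4] and the discriminant divides [2 q], hence equals [q]. As [M | q^4], the
    divisibilities then hold modulo [M], which the residue table excludes; coprimality of [a] and
    [b] supplies the coordinate prime to [M]. *)
Lemma family_irreducible F W a b p : check_family F -> Z.gcd a b = 1 ->
  c4Z W = form (c4_form F) a b ->
  discZ W = disc_coef F * form_prod (disc_factors F) a b ->
  Znumtheory.prime p -> p <> 2 -> (p ^ 4 | c4Z W) -> (p ^ 12 | discZ W) -> False.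
Proof.
case: F => q M g c0 cs; rewrite /check_family /=.
case/and5P => hq /Z.eqb_eq qM /Z.ltb_lt M0 /Z.eqb_eq qM4.
case/and4P => /Z.eqb_eq hc0 /Z.ltb_lt c00 hcs hres gab ec eD pp p2 h4 h12.
have c01 : c0 <> 0 by clear - c00; lia.
have M1 : M <> 0 by clear - M0; lia.
have coprime_ab r : Znumtheory.prime r -> (r | a) /\ (r | b) -> False.
  move=> rp [ra rb]; have := Z.gcd_greatest _ _ _ ra rb; rewrite gab.
  by move/Z.divide_1_r_nonneg; have := prime_ge_2 _ rp; lia.
have dvd_pow k : 0 < k -> (p | p ^ k).
  by move=> k0; exists (p ^ (k - 1)); rewrite -{3}(Z.pow_1_r p) -Z.pow_add_r ?Z.sub_add //; lia.
have p4 : (p | form g a b) by rewrite -ec; apply: Z.divide_trans h4; exact: dvd_pow.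
have p12 : (p | c0 * form_prod cs a b) by rewrite -eD; apply: Z.divide_trans h12; exact: dvd_pow.
(* The constant [c0] divides [(2 q)^24]; the forms are covered by the Bezout relations. *)
have p2q : (p | 2 * q).
  case/(prime_mult _ pp): p12 => [h|h].
    apply: (prime_dvd_pow _ _ 24 pp) => //; apply: (Z.divide_trans _ _ _ h).
    exact/Z.mod_divide.
  by case: (form_prod_dvd _ _ _ _ _ _ hcs pp p4 h) => // /(coprime_ab _ pp).
have qq : q = 1 \/ Znumtheory.prime q.
  case/or4P: hq => /Z.eqb_eq ->; first by left.
  - by right; apply: prime_3.
  - by right; apply: prime_5.
  by right; apply: prime_7.
have pq : p = q.
  case/(prime_mult _ pp): p2q => h; first by case: p2; apply: prime_div_prime => //; exact: prime_2.
  case: qq => [q1|qp]; last exact: prime_div_prime.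
  by move: h; rewrite q1 => /Z.divide_1_r_nonneg; have := prime_ge_2 _ pp; lia.
have qpos : 0 < q by rewrite -pq; exact: prime_pos.
have q1 : Z.eqb q 1 = false by apply/Z.eqb_neq; have := prime_ge_2 _ pp; rewrite pq; clear; lia.
rewrite q1 /= in hres.
have Mq4 : (M | q ^ 4) by exact/Z.mod_divide.
have hm : forallb (fun c => Z.ltb 0 (mult c)) cs.
  by apply/forallb_forall => c hc; move/forallb_forall: hcs => /(_ c hc) /and3P[].
have rel z : ~ (q | z) -> rel_prime z M.
  rewrite -pq => pz; apply: rel_prime_sym; apply: (rel_prime_div (p ^ 4)); last by rewrite pq.
  by rewrite -(Z.pow_1_r z); apply: rel_prime_pow.
apply: (residues_ndvd M g c0 cs a b) => //.
- have [qa|qa] := Zdivide_dec q a; last by left; exact: rel.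
  right; apply: rel => qb; apply: (coprime_ab _ pp); by rewrite pq.
- by rewrite -ec; apply: Z.divide_trans h4; rewrite pq.
rewrite -eD; apply: Z.divide_trans h12; rewrite pq.
apply: (Z.divide_trans _ _ _ Mq4).
by exists (q ^ 8); rewrite -Z.pow_add_r.
Qed.

(** In this table and the next ones, a factor [a] or [b] has one trivial relation, where [c4] has
    multiplier 0. For a linear factor the multiplier of [c4] is a constant: the relation is
    Euclidean division, with remainder given by the value of [c4] at the root of the factor. *)
Definition cert_C5 := FamilyCert 5 25
  [:: 1; 12; 14; -12; 1] (-1)
  [:: Cert [:: 1; 0] 5 [:: 1] [:: -1; -12; -14; 12] [:: 0] [:: 1; 0; 0; 0];
   Cert [:: 0; 1] 5 [:: 0] [:: 0; 0; 0; 1] [:: 1] [:: -12; -14; 12; -1];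
   Cert [:: 1; 11; -1] 1 [:: 11; 122] [:: -11; -133; -166; 117] [:: 122; -11] [:: -117; -166;
     133; -11]].

Definition cert_C6 := FamilyCert 3 81
  [:: 1; 12; 30; 12; 9] (1)
  [:: Cert [:: 1; 0] 2 [:: 1] [:: -1; -12; -30; -12] [:: 0] [:: 1; 0; 0; 0];
   Cert [:: 0; 1] 6 [:: 0] [:: 0; 0; 0; 1] [:: 1] [:: -12; -30; -12; -9];
   Cert [:: 1; 1] 3 [:: 1] [:: -1; -11; -19; 7] [:: 1] [:: 15; -27; -3; -9];
   Cert [:: 1; 9] 1 [:: 1] [:: -1; -3; -3; 15] [:: 729] [:: -713; -2331; -891; -729]].

Definition cert_C7 := FamilyCert 7 343
  [:: 1; 4; -14; 0; 35; -56; 42; -12; 1] (-1)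
  [:: Cert [:: 1; 0] 7 [:: 1] [:: -1; -4; 14; 0; -35; 56; -42; 12] [:: 0] [:: 1; 0; 0; 0; 0; 0;
     0; 0];
   Cert [:: 0; 1] 7 [:: 0] [:: 0; 0; 0; 0; 0; 0; 0; 1] [:: 1] [:: -4; 14; 0; -35; 56; -42;
     12; -1];
   Cert [:: 1; -1] 7 [:: 1] [:: -1; -5; 9; 9; -26; 30; -12; 0] [:: 1] [:: 0; -4; 10; 10; -25;
     31; -11; 1];
   Cert [:: 1; 5; -8; 1] 1 [:: -444; -2117; 4271] [:: 444; 1673; -6832; 378; 17115;
     -26488; 19593; -4222] [:: 1710; 3005; -444] [:: -1661; -1540; 6776; -693;
     -6853; 12530; -4781; 444]].

Definition cert_C8 := FamilyCert 1 1
  [:: 1; -16; 96; -288; 480; -448; 224; -64; 16] (1)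
  [:: Cert [:: 1; 0] 2 [:: 1] [:: -1; 16; -96; 288; -480; 448; -224; 64] [:: 0] [:: 1; 0; 0; 0;
     0; 0; 0; 0];
   Cert [:: 0; 1] 8 [:: 0] [:: 0; 0; 0; 0; 0; 0; 0; 1] [:: 1] [:: 16; -96; 288; -480; 448;
     -224; 64; -16];
   Cert [:: 1; -2] 4 [:: 1] [:: -1; 14; -68; 152; -176; 96; -32; 0] [:: 16] [:: -15; 226;
     -1084; 2440; -2800; 1568; -448; 128];
   Cert [:: 1; -1] 8 [:: 1] [:: -1; 15; -81; 207; -273; 175; -49; 15] [:: 1] [:: 0; 16; -80;
     208; -272; 176; -48; 16];
   Cert [:: 1; -8; 8] 1 [:: -204; 1393] [:: 204; -3025; 16040; -39960; 51104; -31520;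
     8768; -2784] [:: 256; 0] [:: -255; 2056; -6088; 8576; -5568; 1536; -512; 0]].

Definition cert_C9 := FamilyCert 3 27
  [:: 1; 0; -12; 28; -18; -36; 114; -180; 189; -128; 54; -12; 1] (-1)
  [:: Cert [:: 1; 0] 9 [:: 1] [:: -1; 0; 12; -28; 18; 36; -114; 180; -189; 128; -54; 12]
     [:: 0] [:: 1; 0; 0; 0; 0; 0; 0; 0; 0; 0; 0; 0];
   Cert [:: 0; 1] 9 [:: 0] [:: 0; 0; 0; 0; 0; 0; 0; 0; 0; 0; 0; 1] [:: 1] [:: 0; 12; -28; 18;
     36; -114; 180; -189; 128; -54; 12; -1];
   Cert [:: 1; -1] 9 [:: 1] [:: -1; -1; 11; -17; 1; 37; -77; 103; -86; 42; -12; 0] [:: 1]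
     [:: 0; 0; 12; -16; 2; 38; -76; 104; -85; 43; -11; 1];
   Cert [:: 1; -1; 1] 3 [:: 1; -1] [:: -1; 0; 13; -27; 6; 51; -105; 138; -126; 53; -3;
     10] [:: 0; -1] [:: 9; 10; 1; -21; 6; 9; -33; 72; -75; 42; -11; 1];
   Cert [:: 1; 3; -6; 1] 1 [:: -377; -1171; 2171] [:: 377; 40; -4553; 10026; -5382;
     -14583; 41331; -62319; 62505; -38917; 14251; -2162] [:: 623; 1925; -377]
     [:: -614; -83; 4418; -7482; 1827; 12843; -28593; 40128; -33054; 16582;
     -4187; 377]].

Definition cert_C10 := FamilyCert 5 25
  [:: 1; -8; 16; 40; -240; 432; -256; -288; 720; -720; 416; -128; 16] (1)
  [:: Cert [:: 1; 0] 5 [:: 1] [:: -1; 8; -16; -40; 240; -432; 256; 288; -720; 720; -416;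
     128] [:: 0] [:: 1; 0; 0; 0; 0; 0; 0; 0; 0; 0; 0; 0];
   Cert [:: 0; 1] 10 [:: 0] [:: 0; 0; 0; 0; 0; 0; 0; 0; 0; 0; 0; 1] [:: 1] [:: 8; -16; -40;
     240; -432; 256; 288; -720; 720; -416; 128; -16];
   Cert [:: 1; -2] 5 [:: 1] [:: -1; 6; -4; -48; 144; -144; -32; 224; -272; 176; -64; 0]
     [:: 256] [:: -255; 1538; -1020; -12280; 36880; -36832; -8128; 57472; -69376;
     45568; -15360; 2048];
   Cert [:: 1; -1] 10 [:: 1] [:: -1; 7; -9; -49; 191; -241; 15; 303; -417; 303; -113;
     15] [:: 1] [:: 0; 8; -8; -48; 192; -240; 16; 304; -416; 304; -112; 16];
   Cert [:: 1; 2; -4] 1 [:: 1292; 4181] [:: -1292; 8739; -9870; -63880; 231120;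
     -272464; -6032; 364640; -479520; 337520; -120272; 16704] [:: 1280; 4096]
     [:: -1275; 8694; -10200; -61560; 225680; -267520; -4032; 355200; -468480;
     330240; -117760; 16384];
   Cert [:: 1; -3; 1] 2 [:: -8; 21] [:: 8; -61; 105; 360; -1785; 2781; -992; -2685;
     4745; -3960; 1823; -331] [:: 6765; -2584] [:: -6760; 36424; -12880; -304320;
     826880; -757680; -251792; 1289120; -1495840; 954640; -314960; 41344]].

Definition cert_C12 := FamilyCert 3 27
  [:: 1; -24; 264; -1776; 8208; -27696; 70656; -139008; 212880; -253920; 234000;
     -163584; 84048; -30240; 7200; -1152; 144] (1)
  [:: Cert [:: 1; 0] 2 [:: 1] [:: -1; 24; -264; 1776; -8208; 27696; -70656; 139008;
     -212880; 253920; -234000; 163584; -84048; 30240; -7200; 1152] [:: 0] [:: 1; 0;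
     0; 0; 0; 0; 0; 0; 0; 0; 0; 0; 0; 0; 0; 0];
   Cert [:: 0; 1] 12 [:: 0] [:: 0; 0; 0; 0; 0; 0; 0; 0; 0; 0; 0; 0; 0; 0; 0; 1] [:: 1]
     [:: 24; -264; 1776; -8208; 27696; -70656; 139008; -212880; 253920; -234000;
     163584; -84048; 30240; -7200; 1152; -144];
   Cert [:: 1; -2] 6 [:: 1] [:: -1; 22; -220; 1336; -5536; 16624; -37408; 64192;
     -84496; 84928; -64144; 35296; -13456; 3328; -544; 64] [:: 4096] [:: -4095;
     90114; -901116; 5472264; -22675440; 68091936; -153223104; 262930560;
     -346095360; 347865600; -262732800; 144574464; -55111680; 13639680;
     -2211840; 294912];
   Cert [:: 1; -1] 12 [:: 1] [:: -1; 23; -241; 1535; -6673; 21023; -49633; 89375;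
     -123505; 130415; -103585; 59999; -24049; 6191; -1009; 143] [:: 1] [:: 0; 24;
     -240; 1536; -6672; 21024; -49632; 89376; -123504; 130416; -103584; 60000;
     -24048; 6192; -1008; 144];
   Cert [:: 1; -6; 6] 1 [:: -10864; 51409] [:: 10864; -246961; 2554962; -16054902;
     68814912; -213635532; 496727784; -880357320; 1196479968; -1241511072;
     968003040; -549797904; 215981664; -54673584; 8897472; -1233792] [:: 11664;
     0] [:: -11663; 209958; -1749570; 8958096; -31492116; 80344872; -153109656;
     220662144; -240401520; 195340896; -114921504; 46469376; -11990592;
     1959552; -279936; 0];
   Cert [:: 1; -2; 2] 3 [:: 0; 1] [:: 0; -1; 22; -218; 1296; -5180; 14744; -30808;
     47904; -55456; 47200; -28688; 11808; -3056; 512; -64] [:: 16; 0] [:: -15; 354;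
     -3486; 20736; -82884; 235896; -492936; 766464; -887280; 755232; -458976;
     188928; -48960; 8064; -1152; 0];
   Cert [:: 1; -3; 3] 4 [:: -1; 1] [:: 1; -22; 219; -1317; 5376; -15825; 34749; -57942;
     73815; -71529; 51888; -27333; 9969; -2382; 387; -45] [:: 729; 0] [:: -728;
     15312; -144336; 815760; -3103344; 8433072; -16898976; 25340688;
     -28470528; 23674032; -14152320; 5773680; -1492992; 244944; -34992; 0]].

Definition cert_C2xC4 := FamilyCert 1 1
  [:: 1; 16; 80; 128; 256] (1)
  [:: Cert [:: 1; 0] 2 [:: 1] [:: -1; -16; -80; -128] [:: 0] [:: 1; 0; 0; 0];
   Cert [:: 0; 1] 4 [:: 0] [:: 0; 0; 0; 1] [:: 1] [:: -16; -80; -128; -256];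
   Cert [:: 1; 4] 4 [:: 1] [:: -1; -12; -32; 0] [:: 1] [:: 0; -16; -16; -64];
   Cert [:: 1; 8] 2 [:: 1] [:: -1; -8; -16; 0] [:: 16] [:: -15; -136; -192; -512]].

Definition cert_C2xC6 := FamilyCert 3 27
  [:: 144081; -86904; 2604; 6552; -330; -648; 204; -24; 1] (64)
  [:: Cert [:: 1; 0] 6 [:: 1] [:: -144081; 86904; -2604; -6552; 330; 648; -204; 24] [:: 0]
     [:: 1; 0; 0; 0; 0; 0; 0; 0];
   Cert [:: 1; -1] 6 [:: 1] [:: -144081; -57177; -59781; -66333; -66003; -65355;
     -65559; -65535] [:: 1] [:: -78545; 8359; 5755; -797; -467; 181; -23; 1];
   Cert [:: 5; -1] 6 [:: 390625] [:: -11256328125; 4538109375; 704184375; -371038125;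
     -48426375; 40939725; -7749555; 325089] [:: 1] [:: -15709; 14239; 2327; -845;
     -103; 109; -19; 1];
   Cert [:: 3; -1] 2 [:: 729] [:: -35011683; 9447111; 2516265; -753381; -170937;
     100485; -16077; 473] [:: 1] [:: -47259; 13215; 3537; -1005; -225; 141; -21; 1];
   Cert [:: 3; 1] 2 [:: 729] [:: -35011683; 32788233; -11562183; 2261925; -673785;
     382059; -176925; 64807] [:: 1] [:: 148581; -20559; 5985; -4179; 1503; -285; 27;
     -1];
   Cert [:: 9; -1] 2 [:: 4782969] [:: -76570550721; 37676509695; 2802406491;
     -3170622933; -176915907; 324716445; -72334359; 4717433] [:: 1] [:: 49527;
     15159; 1395; -573; -27; 69; -15; 1]].

Definition cert_C2xC8 := FamilyCert 1 1
  [:: 1; 32; 448; 3584; 17664; 51200; 51200; -237568; -1183744; -1900544;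
     3276800; 26214400; 72351744; 117440512; 117440512; 67108864; 16777216]
     (256)
  [:: Cert [:: 1; 0] 8 [:: 1] [:: -1; -32; -448; -3584; -17664; -51200; -51200; 237568;
     1183744; 1900544; -3276800; -26214400; -72351744; -117440512; -117440512;
     -67108864] [:: 0] [:: 1; 0; 0; 0; 0; 0; 0; 0; 0; 0; 0; 0; 0; 0; 0; 0];
   Cert [:: 0; 1] 8 [:: 0] [:: 0; 0; 0; 0; 0; 0; 0; 0; 0; 0; 0; 0; 0; 0; 0; 1] [:: 1]
     [:: -32; -448; -3584; -17664; -51200; -51200; 237568; 1183744; 1900544;
     -3276800; -26214400; -72351744; -117440512; -117440512; -67108864;
     -16777216];
   Cert [:: 1; 2] 8 [:: 1] [:: -1; -30; -388; -2808; -12048; -27104; 3008; 231552;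
     720640; 459264; -4195328; -17823744; -36704256; -44032000; -29376512;
     -8355840] [:: 1] [:: 0; -32; -384; -2816; -12032; -27136; 3072; 231424; 720896;
     458752; -4194304; -17825792; -36700160; -44040192; -29360128; -8388608];
   Cert [:: 1; 4] 8 [:: 1] [:: -1; -28; -336; -2240; -8704; -16384; 14336; 180224;
     462848; 49152; -3473408; -12320768; -23068672; -25165824; -16777216; 0]
     [:: 256] [:: -255; -7172; -86000; -573504; -2227968; -4195328; 3674112;
     46120960; 118554624; 12320768; -888143872; -3158310912; -5888802816;
     -6509559808; -4026531840; -1073741824];
   Cert [:: 1; 0; -8] 2 [:: -204; 577] [:: 204; 5951; 74560; 520248; 2131968; 4414656;
     -2041856; -42689024; -120741888; -46202880; 799145984; 3087400960;
     6027214848; 6910115840; 4412407808; 1207959552] [:: 577; -1632] [:: -576;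
     -16832; -210880; -1471488; -6030080; -12486656; 5775360; 120741888;
     341512192; 130678784; -2260303872; -8732540928; -17047486464;
     -19545456640; -12480151552; -3422552064];
   Cert [:: 1; 8; 8] 2 [:: 204; 1393] [:: -204; -6289; -84024; -632696; -2862208;
     -7091520; -2136576; 50967040; 181772288; 174751744; -873201664;
     -4324720640; -9693036544; -12601786368; -9193914368; -2919235584] [:: 1393;
     1632] [:: -1392; -35072; -384576; -2366464; -8446720; -13643776; 21843968;
     181772288; 407736320; -136740864; -3630858240; -11723603968;
     -20732182528; -22026387456; -13188988928; -3422552064];
   Cert [:: 1; 4; 8] 4 [:: 0; 1] [:: 0; -1; -28; -328; -2048; -6848; -7424; 33280;
     163840; 262144; -458752; -3538944; -8388608; -10485760; -8388608; 0] [:: 1;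
     0] [:: 0; -32; -320; -2048; -6912; -7168; 32768; 163840; 266240; -475136;
     -3506176; -8388608; -10747904; -7340032; -2097152; 0]].

Lemma check_C5 : check_family cert_C5.
Proof. by vm_compute. Qed.

Lemma check_C6 : check_family cert_C6.
Proof. by vm_compute. Qed.

Lemma check_C7 : check_family cert_C7.
Proof. by vm_compute. Qed.

Lemma check_C8 : check_family cert_C8.
Proof. by vm_compute. Qed.

Lemma check_C9 : check_family cert_C9.
Proof. by vm_compute. Qed.

Lemma check_C10 : check_family cert_C10.
Proof. by vm_compute. Qed.

Lemma check_C12 : check_family cert_C12.
Proof. by vm_compute. Qed.

Lemma check_C2xC4 : check_family cert_C2xC4.
Proof. by vm_compute. Qed.

Lemma check_C2xC6 : check_family cert_C2xC6.
Proof. by vm_compute. Qed.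

Lemma check_C2xC8 : check_family cert_C2xC8.
Proof. by vm_compute. Qed.

(** * Irreducibility at 2 *)

Lemma even_cases x : (exists y, x = 2 * y) \/ (exists y, x = 2 * y + 1).
Proof.
have [y [r [-> hr]]] := @Z_mod_cases 2 x ltac:(lia).
have [->|->] : r = 0 \/ r = 1 by lia.
  by left; exists y; ring.
by right; exists y.
Qed.

Lemma dvd2_even x : (2 | x) <-> Z.even x = true.
Proof.
split=> [[y ->]|/Z.even_spec [y ->]]; first by rewrite Z.even_mul orbT.
by exists y; ring.
Qed.

Lemma even_Zpow a (n : positive) : Z.even (a ^ Z.pos n) = Z.even a.
Proof. by rewrite Z.even_pow. Qed.

Definition parityE := (Z.even_add, Z.even_sub, Z.even_mul, Z.even_opp, even_Zpow).

(** Modulo 2, [c4] is [a1], and the discriminant is [a3] once [a1] is even; all 32 parities of the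
    coefficients are checked. A model with [a1] odd is thus never reducible at 2. *)
Lemma reducible2_even V : reducible 2 V ->
  Z.even (wa1 V) = true /\ Z.even (wa3 V) = true.
Proof.
case: V => a1 a2 a3 a4 a6 [h4 [_ [h12 _]]] /=.
have /dvd2_even : (2 | c4Z (Weierstrass a1 a2 a3 a4 a6)).
  by apply: Z.divide_trans h4; exists 8.
have /dvd2_even : (2 | discZ (Weierstrass a1 a2 a3 a4 a6)).
  by apply: Z.divide_trans h12; exists 2048.
rewrite /c4Z /discZ /b2Z /b4Z /b6Z /b8Z /= !parityE /=.
by move: (Z.even a1) (Z.even a2) (Z.even a3) (Z.even a4) (Z.even a6) => [] [] [] [] [].
Qed.

Lemma pow2_odd_ndvd D j x : 0 <= j < 12 -> Z.even x = false -> D = 2 ^ j * x ->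
  ~ (2 ^ 12 | D).
Proof.
move=> hj hx -> h; suff /dvd2_even : (2 | x) by rewrite hx.
have e : 2 ^ 12 = 2 ^ j * 2 ^ (12 - j) by rewrite -Z.pow_add_r; [congr Z.pow; lia|lia..].
have {}h : (2 ^ (12 - j) | x).
  case: h => y ey; exists y; apply: (Z.mul_reg_l _ _ (2 ^ j)).
    by apply: Z.pow_nonzero; lia.
  by rewrite ey e; ring.
apply: Z.divide_trans h; exists (2 ^ (11 - j)).
have -> : 12 - j = (11 - j) + 1 by lia.
by rewrite Z.pow_add_r //; lia.
Qed.

Lemma kraus2_odd x y : kraus2 x y -> Z.even x = false -> (4 | y + 1).
Proof.
case=> [hy _|[hx _]].
  by exists (y / 4 + 1); have := Z_div_mod_eq_full y 4; lia.
have -> : x = 2 * (8 * (x / 16)) by have := Z_div_mod_eq_full x 16; lia.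
by rewrite parityE.
Qed.

Lemma kraus2_even x y : kraus2 x y -> Z.even y = true -> (16 | x) /\ (8 | y).
Proof.
case=> [hy|[hx hy] _].
  have -> : y = 2 * (2 * (y / 4) + 1) + 1.
    by have := Z_div_mod_eq_full y 4; lia.
  by rewrite !parityE.
split; first by exists (x / 16); have := Z_div_mod_eq_full x 16; lia.
have := Z_div_mod_eq_full y 32; case: hy => -> e.
  by exists (4 * (y / 32)); lia.
by exists (4 * (y / 32) + 1); lia.
Qed.

(** With [bt = x^2 + a2] odd, [c4 / 16 = bt^2 - 12 x z] is odd, so Kraus requires
    [c6 / 64 = - bt^3 + 18 bt x z - 54 z^2] to be 3 modulo 4. It is 1 in both cases: through
    [bt = -1] in the first, through [-1 - 54] in the second. *)
Lemma tate_irreducible2 x a2 z k :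
  x ^ 2 + a2 = 4 * k - 1 /\ (2 | z) \/
  [/\ x ^ 2 + a2 = 4 * k + 1, (2 | x) & Z.even z = false] ->
  ~ reducible 2 (Weierstrass (2 * x) a2 (4 * z) 0 0).
Proof.
move=> hk [_ [_ [_ /(_ erefl)]]].
pose bt := x ^ 2 + a2.
have -> : c4Z (Weierstrass (2 * x) a2 (4 * z) 0 0) = (bt ^ 2 - 12 * x * z) * 16.
  by rewrite /c4Z /b2Z /b4Z /bt /=; ring.
have -> : c6Z (Weierstrass (2 * x) a2 (4 * z) 0 0)
    = (- bt ^ 3 + 18 * bt * x * z - 54 * z ^ 2) * 64.
  by rewrite /c6Z /b2Z /b4Z /b6Z /bt /=; ring.
rewrite !Z.div_mul // => /kraus2_odd hkr.
have {hkr} [q] : (4 | - bt ^ 3 + 18 * bt * x * z - 54 * z ^ 2 + 1).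
  by apply: hkr; case: hk => [[e _]|[e _ _]]; rewrite /bt e !parityE.
rewrite /bt; case: hk => [[-> [y ->]]|[-> [y ->]]].
  move=> e; suff : 2 = 4 * (q + 16 * k ^ 3 - 12 * k ^ 2 + 3 * k - 9 * (4 * k - 1) * x * y + 54 * y ^ 2) by lia.
  by ring_simplify; ring_simplify in e; lia.
have [[w ->]|[w ->]] := even_cases z; first by rewrite !parityE.
move=> _ e; suff : -54 = 4 * (q + 16 * k ^ 3 + 12 * k ^ 2 + 3 * k - 9 * (4 * k + 1) * y * (2 * w + 1) + 54 * w ^ 2 + 54 * w) by lia.
by ring_simplify; ring_simplify in e; lia.
Qed.

(** * Families with coprime parameters *)

(** Odd primes are settled on the unscaled [W], whose invariants are binary forms in [a] and [b];
    only the prime 2 is left to [V]. *)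
Lemma family_minimal F W u V a b : check_family F -> Z.gcd a b = 1 ->
  c4Z W = form (c4_form F) a b ->
  discZ W = disc_coef F * form_prod (disc_factors F) a b ->
  changeZ u 0 0 0 W V -> ~ reducible 2 V -> minimal_scaling u W.
Proof.
move=> hF gab e4 eD hV red2; exists V, 0, 0, 0; split=> // p pp.
have [->|p2] := Z.eq_dec p 2; first by [].
move=> /(changeZ_reducible _ _ _ _ _ _ _ hV p2) [h4 [_ [h12 _]]].
exact: (family_irreducible _ _ _ _ _ hF gab e4 eD pp p2 h4 h12).
Qed.

Lemma coprime_parity a b : Z.gcd a b = 1 -> Z.even a && Z.even b = false.
Proof.
move=> g; apply/negP => /andP[/dvd2_even ha /dvd2_even hb].
by have := Z.gcd_greatest _ _ _ ha hb; rewrite g => /Z.divide_1_r_nonneg; lia.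
Qed.

Definition EZ (T : torsion) (a b d : Z) : weierstrass Z :=
  match T with
  | C2 => Weierstrass 0 (2 * a) 0 (a ^ 2 - b ^ 2 * d) 0
  | C3_0 => Weierstrass 0 0 a 0 0
  | C3 => Weierstrass a 0 (a ^ 2 * b) 0 0
  | C4 => Weierstrass a (- (a * b)) (- (a ^ 2 * b)) 0 0
  | C5 => Weierstrass (a - b) (- (a * b)) (- (a ^ 2 * b)) 0 0
  | C6 => Weierstrass (a - b) (- (a * b) - b ^ 2) (- (a ^ 2 * b) - a * b ^ 2) 0 0
  | C7 =>
      Weierstrass (a ^ 2 + a * b - b ^ 2) (a ^ 2 * b ^ 2 - a * b ^ 3)
        (a ^ 4 * b ^ 2 - a ^ 3 * b ^ 3) 0 0
  | C8 =>
      Weierstrass (- a ^ 2 + 4 * a * b - 2 * b ^ 2)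
        (- (a ^ 2 * b ^ 2) + 3 * a * b ^ 3 - 2 * b ^ 4)
        (- (a ^ 3 * b ^ 3) + 3 * a ^ 2 * b ^ 4 - 2 * a * b ^ 5) 0 0
  | C9 =>
      let a2 := a ^ 4 * b ^ 2 - 2 * a ^ 3 * b ^ 3 + 2 * a ^ 2 * b ^ 4 - a * b ^ 5 in
      Weierstrass (a ^ 3 + a * b ^ 2 - b ^ 3) a2 (a ^ 3 * a2) 0 0
  | C10 =>
      let a2 := - (a ^ 3 * b ^ 3) + 3 * a ^ 2 * b ^ 4 - 2 * a * b ^ 5 in
      Weierstrass (a ^ 3 - 2 * a ^ 2 * b - 2 * a * b ^ 2 + 2 * b ^ 3) a2
        ((a ^ 3 - 3 * a ^ 2 * b + a * b ^ 2) * a2) 0 0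
  | C12 =>
      let a2 := b * (a - 2 * b) * (a - b) ^ 2 * (a ^ 2 - 3 * a * b + 3 * b ^ 2)
                * (a ^ 2 - 2 * a * b + 2 * b ^ 2) in
      Weierstrass
        (- a ^ 4 + 2 * a ^ 3 * b + 2 * a ^ 2 * b ^ 2 - 8 * a * b ^ 3 + 6 * b ^ 4)
        a2 (a * (b - a) ^ 3 * a2) 0 0
  | C2xC2 => Weierstrass 0 (a * d + b * d) 0 (a * b * d ^ 2) 0
  | C2xC4 =>
      Weierstrass a (- (a * b) - 4 * b ^ 2) (- (a ^ 2 * b) - 4 * a * b ^ 2) 0 0
  | C2xC6 =>
      Weierstrass (- (19 * a ^ 2) + 2 * a * b + b ^ 2)
        (- (10 * a ^ 4) + 22 * a ^ 3 * b - 14 * a ^ 2 * b ^ 2 + 2 * a * b ^ 3)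
        (90 * a ^ 6 - 198 * a ^ 5 * b + 116 * a ^ 4 * b ^ 2 + 4 * a ^ 3 * b ^ 3
         - 14 * a ^ 2 * b ^ 4 + 2 * a * b ^ 5) 0 0
  | C2xC8 =>
      let a2 := - (4 * a * b ^ 2 * (a + 2 * b) * (a + 4 * b) ^ 2
                   * (a ^ 2 + 4 * a * b + 8 * b ^ 2)) in
      Weierstrass (- a ^ 4 - 8 * a ^ 3 * b - 24 * a ^ 2 * b ^ 2 + 64 * b ^ 4) a2
        (- (2 * b * (a + 4 * b) * (a ^ 2 - 8 * b ^ 2) * a2)) 0 0
  end.

Definition has_cert (T : torsion) (F : family_cert) : Prop :=
  check_family F /\ forall a b d,
    c4Z (EZ T a b d) = form (c4_form F) a b /\
    discZ (EZ T a b d) = disc_coef F * form_prod (disc_factors F) a b.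

Ltac cert_identity :=
  split; [rewrite /c4Z /b2Z /b4Z /=; ring | rewrite /discZ /b2Z /b4Z /b6Z /b8Z /=; ring].

Lemma has_cert_C5 : has_cert C5 cert_C5.
Proof. by split=> [|a b d]; [exact: check_C5 | cert_identity]. Qed.
Lemma has_cert_C6 : has_cert C6 cert_C6.
Proof. by split=> [|a b d]; [exact: check_C6 | cert_identity]. Qed.
Lemma has_cert_C7 : has_cert C7 cert_C7.
Proof. by split=> [|a b d]; [exact: check_C7 | cert_identity]. Qed.
Lemma has_cert_C8 : has_cert C8 cert_C8.
Proof. by split=> [|a b d]; [exact: check_C8 | cert_identity]. Qed.
Lemma has_cert_C9 : has_cert C9 cert_C9.
Proof. by split=> [|a b d]; [exact: check_C9 | cert_identity]. Qed.
Lemma has_cert_C10 : has_cert C10 cert_C10.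
Proof. by split=> [|a b d]; [exact: check_C10 | cert_identity]. Qed.
Lemma has_cert_C2xC4 : has_cert C2xC4 cert_C2xC4.
Proof. by split=> [|a b d]; [exact: check_C2xC4 | cert_identity]. Qed.
Lemma has_cert_C2xC6 : has_cert C2xC6 cert_C2xC6.
Proof. by split=> [|a b d]; [exact: check_C2xC6 | cert_identity]. Qed.
Lemma has_cert_C12 : has_cert C12 cert_C12.
Proof. by split=> [|a b d]; [exact: check_C12 | cert_identity]. Qed.
Lemma has_cert_C2xC8 : has_cert C2xC8 cert_C2xC8.
Proof. by split=> [|a b d]; [exact: check_C2xC8 | cert_identity]. Qed.

Lemma has_cert_minimal T F u V a b d : has_cert T F -> Z.gcd a b = 1 ->
  changeZ u 0 0 0 (EZ T a b d) V -> ~ reducible 2 V ->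
  minimal_scaling u (EZ T a b d).
Proof.
move=> [hF /(_ a b d) [e4 eD]] gab; exact: (family_minimal F _ u V a b hF gab e4 eD).
Qed.

Ltac change_identity := by split=> /=; ring.

Ltac parity_contradiction a b gab :=
  move=> /reducible2_even [] /=; rewrite !parityE /=;
  move: (coprime_parity _ _ gab);
  by move: (Z.even a) (Z.even b) => [] [].

Section Minimal.
Variables (a b d : Z).
Hypothesis gab : Z.gcd a b = 1.

Lemma minimal_C5 : minimal_scaling 1 (EZ C5 a b d).
Proof.
apply: (has_cert_minimal _ _ _ (EZ C5 a b d) _ _ _ has_cert_C5) => //; first by change_identity.
by parity_contradiction a b gab.
Qed.

Lemma minimal_C7 : minimal_scaling 1 (EZ C7 a b d).
Proof.
apply: (has_cert_minimal _ _ _ (EZ C7 a b d) _ _ _ has_cert_C7) => //; first by change_identity.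
by parity_contradiction a b gab.
Qed.

Lemma minimal_C9 : minimal_scaling 1 (EZ C9 a b d).
Proof.
apply: (has_cert_minimal _ _ _ (EZ C9 a b d) _ _ _ has_cert_C9) => //; first by change_identity.
by parity_contradiction a b gab.
Qed.

Lemma even_coprimer : Z.even a = true -> Z.even b = false.
Proof. by move=> ha; have := coprime_parity _ _ gab; rewrite ha. Qed.

(** Since [a2 = - b (a + b)] and [a3 = a a2], the hypothesis is what the division of [a3] by 8 asks
    for; the new [a1 = 4 n - b] is odd. *)
Lemma minimal_C6_2 : (8 | a + b) -> minimal_scaling 2 (EZ C6 a b d).
Proof.
move=> [n en]; have ea : a = 8 * n - b by lia.
have hb : Z.even b = false.
  by have := coprime_parity _ _ gab; rewrite ea !parityE /=; case: (Z.even b).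
apply: (has_cert_minimal _ _ _
  (Weierstrass (4 * n - b) (- (2 * n * b)) (- ((8 * n - b) * b * n)) 0 0)
  _ _ _ has_cert_C6) => //; first by rewrite ea; change_identity.
by move=> /reducible2_even [] /=; rewrite !parityE /= hb.
Qed.

Lemma minimal_C6_1 : ~ (8 | a + b) -> minimal_scaling 1 (EZ C6 a b d).
Proof.
move=> h8.
apply: (has_cert_minimal _ _ _ (EZ C6 a b d) _ _ _ has_cert_C6) => //; first by change_identity.
move=> red; have [_ [_ [h12 _]]] := red; move: h12.
case/reducible2_even: red => /= + _; rewrite !parityE => eab.
have hb : Z.even b = false.
  by have := coprime_parity _ _ gab; move: eab; case: (Z.even a); case: (Z.even b).
have [[m em]|[m em]] := even_cases (a + b); last first.
  by have := congr1 Z.even em; move: eab; rewrite !parityE /=; case: (Z.even a); case: (Z.even b).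
have ha : Z.even a = false by move: eab; rewrite hb; case: (Z.even a).
have ea : a = 2 * m - b by lia.
rewrite (has_cert_C6.2 a b d).2 [disc_coef _]/= /=.
(* The discriminant is [a^2 b^6 (a + b)^3 (a + 9 b)] with [a + 9 b = (a + b) + 8 b], so its
   valuation is 4 or 8 according as 2 or 4 exactly divides [a + b]. *)
have [[n en]|[n en]] := even_cases m; last first.
  apply: (pow2_odd_ndvd _ 4 (a ^ 2 * b ^ 6 * m ^ 3 * (m + 4 * b))) => //.
    by rewrite en !parityE /= ha hb.
  by rewrite ea; ring.
have hn : Z.even n = false.
  by apply/negbTE/negP => /dvd2_even [k ek]; apply: h8; exists k; lia.
apply: (pow2_odd_ndvd _ 8 (a ^ 2 * b ^ 6 * n ^ 3 * (n + 2 * b))) => //.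
  by rewrite !parityE /= ha hb hn.
by rewrite ea en; ring.
Qed.

Lemma minimal_C8_2 : (2 | a) -> ~ (4 | a) -> minimal_scaling 2 (EZ C8 a b d).
Proof.
move=> h2 h4; have hb := even_coprimer ((dvd2_even a).1 h2); have [m em] := h2.
have hm : Z.even m = false.
  by apply/negbTE/negP => /dvd2_even [k ek]; apply: h4; exists k; lia.
(* [a - 2 b = 4 n] is the factor that makes [a2 = - b^2 (a - b) (a - 2 b)] divisible by 4 and
   [a3 = a b a2] by 8. *)
have [n en] : exists n, m = b + 2 * n.
  have /dvd2_even[n en] : Z.even (m - b) = true by rewrite parityE hm hb.
  by exists n; lia.
apply: (has_cert_minimal _ _ _
  (Weierstrass (- (2 * m ^ 2) + 4 * m * b - b ^ 2) (- (b ^ 2 * (2 * m - b) * n))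
     (- (m * b ^ 3 * (2 * m - b) * n)) 0 0)
  _ _ _ has_cert_C8) => //; first by rewrite em en; change_identity.
by move=> /reducible2_even [] /=; rewrite !parityE /= hb.
Qed.

Lemma minimal_C8_1 : ~ (2 | a) \/ (4 | a) -> minimal_scaling 1 (EZ C8 a b d).
Proof.
move=> h.
apply: (has_cert_minimal _ _ _ (EZ C8 a b d) _ _ _ has_cert_C8) => //; first by change_identity.
case: h => [h2|[m em]].
  move=> /reducible2_even [] /=; rewrite !parityE /= => ha _.
  by apply/h2/dvd2_even; move: ha; case: (Z.even a).
have hb : Z.even b = false by apply: even_coprimer; rewrite em !parityE orbT.
have [k ek] : exists k, b = 2 * k + 1.
  by case: (even_cases b) => // -[k ek]; move: hb; rewrite ek !parityE.
pose a2 := - (16 * m ^ 2 * b ^ 2) + 12 * m * b ^ 3 - 2 * b ^ 4.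
have -> : EZ C8 a b d = Weierstrass (2 * (- (8 * m ^ 2) + 8 * m * b - b ^ 2)) a2
    (4 * (m * b * a2)) 0 0.
  by rewrite /EZ /a2 em; congr Weierstrass; ring.
(* [b^4 = 8 t + 1]. Modulo 4, [x^2 + a2] is [- b^4], and [z = m b a2] is even: the first case of
   [tate_irreducible2]. *)
pose t := 2 * k ^ 4 + 4 * k ^ 3 + 3 * k ^ 2 + k.
apply: (tate_irreducible2 _ _ _ (16 * (m * b - m ^ 2) ^ 2 - 4 * (m * b - m ^ 2) * b ^ 2
  - 4 * m ^ 2 * b ^ 2 + 3 * m * b ^ 3 - 2 * t)); left; split.
  by rewrite /a2 /t ek; ring.
by apply/dvd2_even; rewrite /a2 !parityE /= !orbT /= ?orbT.
Qed.

Lemma minimal_C10_2 : (2 | a) -> minimal_scaling 2 (EZ C10 a b d).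
Proof.
move=> h2; have hb := even_coprimer ((dvd2_even a).1 h2); have [m em] := h2.
(* The 4 divided out of [- a b^3 (a - b) (a - 2 b)] comes from the two even factors [a] and
   [a - 2 b]. *)
pose a2 := - (m * b ^ 3 * (2 * m - b) * (m - b)).
apply: (has_cert_minimal _ _ _
  (Weierstrass (4 * m ^ 3 - 4 * m ^ 2 * b - 2 * m * b ^ 2 + b ^ 3) a2
     (m * (4 * m ^ 2 - 6 * m * b + b ^ 2) * a2) 0 0)
  _ _ _ has_cert_C10) => //; first by rewrite em /a2; change_identity.
by move=> /reducible2_even [] /=; rewrite !parityE /= hb.
Qed.

Lemma minimal_C10_1 : ~ (2 | a) -> minimal_scaling 1 (EZ C10 a b d).
Proof.
move=> h2.
apply: (has_cert_minimal _ _ _ (EZ C10 a b d) _ _ _ has_cert_C10) => //; first by change_identity.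
move=> /reducible2_even [] /=; rewrite !parityE /= => ha _.
by apply/h2/dvd2_even; move: ha; case: (Z.even a).
Qed.

Lemma minimal_C12_2 : (2 | a) -> minimal_scaling 2 (EZ C12 a b d).
Proof.
move=> h2; have hb := even_coprimer ((dvd2_even a).1 h2); have [m em] := h2.
pose a2 := b * (m - b) * (2 * m - b) ^ 2 * (4 * m ^ 2 - 6 * m * b + 3 * b ^ 2)
  * (2 * m ^ 2 - 2 * m * b + b ^ 2).
apply: (has_cert_minimal _ _ _
  (Weierstrass (- (8 * m ^ 4) + 8 * m ^ 3 * b + 4 * m ^ 2 * b ^ 2 - 8 * m * b ^ 3
                + 3 * b ^ 4) a2 (m * (b - 2 * m) ^ 3 * a2) 0 0)
  _ _ _ has_cert_C12) => //; first by rewrite em /a2; change_identity.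
by move=> /reducible2_even [] /=; rewrite !parityE /= hb.
Qed.

Lemma minimal_C12_1 : ~ (2 | a) -> minimal_scaling 1 (EZ C12 a b d).
Proof.
move=> h2.
apply: (has_cert_minimal _ _ _ (EZ C12 a b d) _ _ _ has_cert_C12) => //; first by change_identity.
move=> /reducible2_even [] /=; rewrite !parityE /= => ha _.
by apply/h2/dvd2_even; move: ha; case: (Z.even a).
Qed.

(** Here [a2 = - b (a + 4 b)] and [a3 = a a2]: the factor 16 comes from [a + 4 b], and
    [a / 4 = 4 k - b] is odd. *)
Lemma minimal_C2xC4_4 : (4 | a) -> (16 | a + 4 * b) -> minimal_scaling 4 (EZ C2xC4 a b d).
Proof.
move=> [n en] [k ek]; have hb : Z.even b = false by apply: even_coprimer; rewrite en !parityE orbT.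
have ea : a = 4 * (4 * k - b) by lia.
apply: (has_cert_minimal _ _ _
  (Weierstrass (4 * k - b) (- (k * b)) (- ((4 * k - b) * b * k)) 0 0)
  _ _ _ has_cert_C2xC4) => //; first by rewrite ea; change_identity.
by move=> /reducible2_even [] /=; rewrite !parityE /= hb.
Qed.

Lemma minimal_C2xC4_2 : (4 | a) -> ~ (16 | a + 4 * b) -> minimal_scaling 2 (EZ C2xC4 a b d).
Proof.
move=> [n en] h16; have hb : Z.even b = false by apply: even_coprimer; rewrite en !parityE orbT.
pose V := Weierstrass (2 * n) (- (n * b) - b ^ 2) (- (2 * n * b * (n + b))) 0 0.
have hV : changeZ 2 0 0 0 (EZ C2xC4 a b d) V by rewrite en /V; change_identity.
apply: (has_cert_minimal _ _ _ V _ _ _ has_cert_C2xC4) => //.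
have [j ej] : exists j, b = 2 * j + 1.
  by case: (even_cases b) => // -[j ej]; move: hb; rewrite ej !parityE.
have [[m em]|[m em]] := even_cases n; last first.
  have eD : discZ V = 16 * n ^ 2 * b ^ 4 * (n + 2 * b) ^ 2 * (n + b) ^ 4.
    by rewrite /V /discZ /b2Z /b4Z /b6Z /b8Z /=; ring.
  move=> [_ [_ [h12 _]]]; move: h12.
  (* 16 does not divide [a + 4 b = 4 (n + b)], so 2 exactly divides [n + b] and the discriminant has
     valuation 8. *)
  have [k ek] : exists k, n + b = 2 * (2 * k + 1).
    clear - em ej en h16; case: (even_cases (m + j + 1)) => -[k ek].
      by case: h16; exists k; lia.
    by exists k; lia.
  apply: (pow2_odd_ndvd _ 8 (n ^ 2 * b ^ 4 * (n + 2 * b) ^ 2 * (2 * k + 1) ^ 4)) => //.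
    by rewrite em !parityE /= hb.
  by rewrite eD ek; ring.
have -> : V = Weierstrass (2 * (2 * m)) (- (n * b) - b ^ 2)
    (4 * (- (m * b * (2 * m + b)))) 0 0.
  by rewrite /V em; congr Weierstrass; ring.
(* [x^2 + a2 = 4 m^2 - 2 m b - b^2] is -1 or 1 modulo 4, and [z] is even or odd, according to the
   parity of [m]: the two cases of [tate_irreducible2]. *)
have [[i ei]|[i ei]] := even_cases m.
  apply: (tate_irreducible2 _ _ _ (m ^ 2 - i * b - j ^ 2 - j)); left; split.
    by rewrite em ei ej; ring.
  by apply/dvd2_even; rewrite ei !parityE /= ?orbT.
apply: (tate_irreducible2 _ _ _ (m ^ 2 - i * b - j ^ 2 - j - j - 1)); right; split.
- by rewrite em ei ej; ring.
- by exists m; ring.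
by rewrite ei !parityE /= hb.
Qed.

Lemma minimal_C2xC4_1 : ~ (4 | a) -> minimal_scaling 1 (EZ C2xC4 a b d).
Proof.
move=> h4.
apply: (has_cert_minimal _ _ _ (EZ C2xC4 a b d) _ _ _ has_cert_C2xC4) => //; first by change_identity.
move=> red; have [_ [_ [h12 _]]] := red; move: h12.
case/reducible2_even: red => /= ha _; have hb := even_coprimer ha.
have /dvd2_even [m em] := ha.
have hm : Z.even m = false.
  by apply/negbTE/negP => /dvd2_even [k ek]; apply: h4; exists k; lia.
rewrite (has_cert_C2xC4.2 a b d).2 [disc_coef _]/= /=.
apply: (pow2_odd_ndvd _ 8 (m ^ 2 * b ^ 4 * (m + 4 * b) ^ 2 * (m + 2 * b) ^ 4)) => //.
  by rewrite !parityE /= hm hb.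
by rewrite em; ring.
Qed.

Lemma minimal_C2xC6_1 : ~ (2 | a + b) -> minimal_scaling 1 (EZ C2xC6 a b d).
Proof.
move=> h2.
apply: (has_cert_minimal _ _ _ (EZ C2xC6 a b d) _ _ _ has_cert_C2xC6) => //; first by change_identity.
move=> /reducible2_even [] /=; rewrite !parityE /= => hab _.
by apply/h2/dvd2_even; move: hab; rewrite parityE; case: (Z.even a); case: (Z.even b).
Qed.

Lemma minimal_C2xC6_4 : (4 | a + b) -> minimal_scaling 4 (EZ C2xC6 a b d).
Proof.
move=> [n en]; have eb : b = 4 * n - a by lia.
have ha : Z.even a = false.
  by have := coprime_parity _ _ gab; rewrite eb !parityE /=; case: (Z.even a).
(* [b = 2 m - a] gives [a1 = 4 (m^2 - 5 a^2)], whose quotient by 4 is odd because [m] is even. *)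
pose m := 2 * n; pose a2 := - (a * (3 * a - m) * (a - m) ^ 2).
apply: (has_cert_minimal _ _ _
  (Weierstrass (m ^ 2 - 5 * a ^ 2) a2 ((m - 2 * a) * (m + a) * a2) 0 0)
  _ _ _ has_cert_C2xC6) => //; first by rewrite eb /a2 /m; change_identity.
by move=> /reducible2_even [] /=; rewrite !parityE /= ha.
Qed.

Lemma minimal_C2xC6_16 : (2 | a + b) -> ~ (4 | a + b) -> minimal_scaling 16 (EZ C2xC6 a b d).
Proof.
move=> [m em] h4.
have ha : Z.even a = false.
  have eb : b = 2 * m - a by lia.
  by have := coprime_parity _ _ gab; rewrite eb !parityE /=; case: (Z.even a).
have hm : Z.even m = false.
  by apply/negbTE/negP => /dvd2_even [k ek]; apply: h4; exists k; lia.
have [j ej] : exists j, m = a - 2 * j.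
  have /dvd2_even[j ej] : Z.even (a - m) = true by rewrite parityE hm ha.
  by exists j; lia.
have eb : b = a - 4 * j by lia.
(* Now [m = a - 2 j] gives [m^2 - 5 a^2 = 4 (j^2 - a j - a^2)], with an odd quotient. The new [a2]
   is [- a (a + j) j^2 / 2], integral because [j] or [a + j] is even; each case writes it without
   the division. *)
have [[i ei]|[i ei]] := even_cases j.
  apply: (has_cert_minimal _ _ _
    (Weierstrass (4 * i ^ 2 - 2 * a * i - a ^ 2) (- (2 * a * (a + 2 * i) * i ^ 2))
       (a * (a ^ 2 - 4 * i ^ 2) * i ^ 2 * (a + 4 * i)) 0 0)
    _ _ _ has_cert_C2xC6) => //; first by rewrite eb ei; change_identity.
  by move=> /reducible2_even [] /=; rewrite !parityE /= ha.
have [k ek] : exists k, a + j = 2 * k.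
  have /dvd2_even[k ek] : Z.even (a + j) = true by rewrite ei !parityE /= ha.
  by exists k; lia.
have {}ei : j = 2 * k - a by lia.
apply: (has_cert_minimal _ _ _
  (Weierstrass (j ^ 2 - a * j - a ^ 2) (- (a * k * j ^ 2))
     (a * k * (a - k) * j ^ 2 * (a + 2 * j)) 0 0)
  _ _ _ has_cert_C2xC6) => //; first by rewrite eb ei; change_identity.
by move=> /reducible2_even [] /=; rewrite ei !parityE /= ha.
Qed.

Lemma minimal_C2xC8_1 : ~ (2 | a) -> minimal_scaling 1 (EZ C2xC8 a b d).
Proof.
move=> h2.
apply: (has_cert_minimal _ _ _ (EZ C2xC8 a b d) _ _ _ has_cert_C2xC8) => //; first by change_identity.
move=> /reducible2_even [] /=; rewrite !parityE /= => ha _.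
by apply/h2/dvd2_even; move: ha; case: (Z.even a).
Qed.

Lemma minimal_C2xC8_16 : (2 | a) -> ~ (4 | a) -> minimal_scaling 16 (EZ C2xC8 a b d).
Proof.
move=> h2 h4; have [m em] := h2.
have hm : Z.even m = false.
  by apply/negbTE/negP => /dvd2_even [k ek]; apply: h4; exists k; lia.
pose a2 := - (m * b ^ 2 * (m + b) * (m + 2 * b) ^ 2 * (m ^ 2 + 2 * m * b + 2 * b ^ 2)).
apply: (has_cert_minimal _ _ _
  (Weierstrass (- m ^ 4 - 4 * m ^ 3 * b - 6 * m ^ 2 * b ^ 2 + 4 * b ^ 4) a2
     (- (b * (m + 2 * b) * (m ^ 2 - 2 * b ^ 2) * a2)) 0 0)
  _ _ _ has_cert_C2xC8) => //; first by rewrite em /a2; change_identity.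
by move=> /reducible2_even [] /=; rewrite !parityE /= hm.
Qed.

Lemma minimal_C2xC8_64 : (4 | a) -> minimal_scaling 64 (EZ C2xC8 a b d).
Proof.
move=> [n en]; have hb : Z.even b = false by apply: even_coprimer; rewrite en !parityE orbT.
pose a2 := - (n * b ^ 2 * (2 * n + b) * (n + b) ^ 2 * (2 * n ^ 2 + 2 * n * b + b ^ 2)).
apply: (has_cert_minimal _ _ _
  (Weierstrass (- (4 * n ^ 4) - 8 * n ^ 3 * b - 6 * n ^ 2 * b ^ 2 + b ^ 4) a2
     (- (b * (n + b) * (2 * n ^ 2 - b ^ 2) * a2)) 0 0)
  _ _ _ has_cert_C2xC8) => //; first by rewrite en /a2; change_identity.
by move=> /reducible2_even [] /=; rewrite !parityE /= hb.
Qed.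
End Minimal.

(** * The families with a non-semistable parameter *)

Definition squarefreeZ (n : Z) : Prop := forall k, (k ^ 2 | n) -> Z.abs k = 1.

Lemma squarefreeZ_ndvd n p : squarefreeZ n -> Znumtheory.prime p -> ~ (p ^ 2 | n).
Proof. by move=> sq pp /sq; have := prime_ge_2 _ pp; lia. Qed.

Lemma squarefreeZ_cofactor n p x : squarefreeZ n -> Znumtheory.prime p ->
  n = p * x -> ~ (p | x).
Proof.
by move=> sq pp en [y ey]; case: (squarefreeZ_ndvd _ _ sq pp); exists y; rewrite en ey; ring.
Qed.

Lemma pow_dvd_unit p k u x : Znumtheory.prime p -> 0 <= k -> ~ (p | u) ->
  (p ^ k | u * x) -> (p ^ k | x).
Proof.
move=> pp k0 pu h; apply: (Gauss _ u) => //; rewrite -(Z.pow_1_r u).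
exact: rel_prime_pow.
Qed.

Lemma pow_dvd_cancel p i j x : p <> 0 -> 0 <= i -> 0 <= j ->
  (p ^ (i + j) | p ^ i * x) -> (p ^ j | x).
Proof.
move=> p0 i0 j0 [y ey]; exists y; apply: (Z.mul_reg_l _ _ (p ^ i)).
  exact: Z.pow_nonzero.
by rewrite ey Z.pow_add_r //; ring.
Qed.

(** Iterated, this peels factors [p] off [x] one at a time from a divisibility of [x^m]. *)
Lemma pow_dvd_pow p m k x : Znumtheory.prime p -> 0 < m -> 0 <= k ->
  (p ^ (m + k) | x ^ m) -> exists y, x = p * y /\ (p ^ k | y ^ m).
Proof.
move=> pp m0 k0 h; have p0 : p <> 0 by have := prime_pos _ pp; lia.
have [y ey] : (p | x).
  apply: (prime_dvd_pow _ _ m) => //; first by lia.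
  apply: Z.divide_trans h; exists (p ^ (m + k - 1)).
  by rewrite -{3}(Z.pow_1_r p) -Z.pow_add_r ?Z.sub_add //; lia.
exists y; split; first by rewrite ey; ring.
by apply: (pow_dvd_cancel _ m) => //; [lia | rewrite -Z.pow_mul_l Z.mul_comm -ey].
Qed.

Lemma pow_dvd_le p i j x : 0 <= i <= j -> (p ^ j | x) -> (p ^ i | x).
Proof.
move=> ij; apply: Z.divide_trans; exists (p ^ (j - i)).
by rewrite -Z.pow_add_r ?Z.sub_add //; lia.
Qed.

Lemma prime_dvd_of_pow p (j : positive) x : (p ^ Z.pos j | x) -> (p | x).
Proof. by rewrite -{2}(Z.pow_1_r p); apply: pow_dvd_le; lia. Qed.

Lemma prime_dvd_Zpow p n (k : positive) :
  Znumtheory.prime p -> (p | n ^ Z.pos k) -> (p | n).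
Proof. by move=> pp; apply: prime_dvd_pow. Qed.

Lemma dvd_comb p x y u v z : (p | x) -> (p | y) -> z = u * x + v * y -> (p | z).
Proof.
by move=> hx hy ->; apply: Z.divide_add_r; apply: Z.divide_mul_r.
Qed.

Lemma odd_prime_ndvd_pow2 p k : Znumtheory.prime p -> p <> 2 -> 0 <= k -> ~ (p | 2 ^ k).
Proof.
move=> pp p2 k0; apply: prime_ndvd_pow => // h.
by apply: p2; apply: prime_div_prime => //; exact: prime_2.
Qed.

Lemma prime_ndvd_mul p x y : Znumtheory.prime p -> ~ (p | x) -> ~ (p | y) -> ~ (p | x * y).
Proof. by move=> pp px py /(prime_mult _ pp) []. Qed.

Lemma coprime_ndvd p a b : Znumtheory.prime p -> Z.gcd a b = 1 -> (p | a) -> ~ (p | b).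
Proof.
move=> pp g ha hb; have := Z.gcd_greatest _ _ _ ha hb; rewrite g.
by move/Z.divide_1_r_nonneg; have := prime_ge_2 _ pp; lia.
Qed.

(** The discriminant is [- 27 a^4]: if [p^12] divides it then [p^9 | a^4], even for [p = 3]. Two
    factors [p] in [a] account only for [p^8], so [p^3 | a]. *)
Lemma minimal_C3_0 a b d : (forall k, (k ^ 3 | a) -> Z.abs k = 1) ->
  minimal_scaling 1 (EZ C3_0 a b d).
Proof.
move=> cf; exists (EZ C3_0 a b d), 0, 0, 0; split; first by change_identity.
move=> p pp [_ [_ [h12 _]]].
have {}h12 : (p ^ 9 | a ^ 4).
  have {}h12 : (p ^ 12 | 3 ^ 3 * a ^ 4).
    apply: (Z.divide_trans _ _ _ h12); exists (-1).
    by rewrite /EZ /discZ /b2Z /b4Z /b6Z /b8Z /=; ring.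
  have [p3|p3] := Z.eq_dec p 3.
    by apply: (pow_dvd_cancel _ 3) => //; rewrite ?p3 // in h12 *.
  apply: (pow_dvd_le _ _ 12) => //; apply: pow_dvd_unit h12 => //.
  by apply: prime_ndvd_pow => // /(prime_div_prime _ _ pp prime_3).
have [x [ex hx]] := pow_dvd_pow _ 4 5 _ pp erefl (Zle_0_pos _) h12.
have [y [ey hy]] := pow_dvd_pow _ 4 1 _ pp erefl (Zle_0_pos _) hx.
have [z ez] : (p | y) by apply: (prime_dvd_pow _ _ 4) => //; rewrite -(Z.pow_1_r p).
have := cf p; have := prime_ge_2 _ pp => p2.
have -> // : Z.abs p = p by lia.
by move=> h; have : p = 1 by [apply: h; exists z; rewrite ex ey ez; ring]; lia.
Qed.

(** The scaled invariants factor through [k], [e], [b], [c] and forms in [a], [b]. As [k] and [e]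
    are squarefree and coprime, they absorb bounded powers of [p], and what remains forces [p = 3].
    There the coefficient of [a - 27 b] hides the coprimality, and [c6] or the exact power of 3 in
    [a] decides. *)
Lemma minimal_C3 a b d c k e : Z.gcd a b = 1 -> squarefreeZ k -> squarefreeZ e ->
  Z.gcd k e = 1 -> a = c ^ 3 * k ^ 2 * e -> minimal_scaling (c ^ 2 * k) (EZ C3 a b d).
Proof.
move=> gab sk se gke ea.
exists (Weierstrass (c * k * e) 0 (k * e ^ 2 * b) 0 0), 0, 0, 0.
split; first by rewrite ea; change_identity.
move=> p pp [h4 [h6 [h12 _]]].
have p0 : p <> 0 by have := prime_pos _ pp; lia.
have {}h4 : (p ^ 4 | c * k ^ 2 * e ^ 3 * (a - 24 * b)).
  by rewrite (_ : _ * _ = c4Z (Weierstrass (c * k * e) 0 (k * e ^ 2 * b) 0 0)) //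
    /c4Z /b2Z /b4Z /= ea; ring.
have {}h6 : (p ^ 6 | k ^ 2 * e ^ 4 * (a ^ 2 - 36 * a * b + 216 * b ^ 2)).
  apply/Z.divide_opp_r.
  by rewrite (_ : - _ = c6Z (Weierstrass (c * k * e) 0 (k * e ^ 2 * b) 0 0)) //
    /c6Z /b2Z /b4Z /b6Z /= ea; ring.
have {}h12 : (p ^ 12 | k ^ 4 * e ^ 8 * b ^ 3 * (a - 27 * b)).
  by rewrite (_ : _ * _ = discZ (Weierstrass (c * k * e) 0 (k * e ^ 2 * b) 0 0)) //
    /discZ /b2Z /b4Z /b6Z /b8Z /= ea; ring.
have pb : (p | a) -> ~ (p | b) := coprime_ndvd _ _ _ pp gab.
have p_27 : (p | a) -> (p | a - 27 * b) -> p = 3.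
  move=> pa pd; have : (p | 3 ^ 3 * b) by apply: (dvd_comb _ _ _ 1 (-1) _ pa pd); ring.
  case/(prime_mult _ pp) => [/(prime_dvd_Zpow _ _ _ pp) h|/(pb pa) //].
  exact: (prime_div_prime _ _ pp prime_3 h).
(* If 9 | a then 3^3 exactly divides the last factor of c6. *)
have at3 : p = 3 -> ~ (p | e) -> (9 | a) -> False.
  move=> p3 pe [a1 ea1]; rewrite p3 in pe pb pp h6.
  have pa : (3 | a) by exists (3 * a1); rewrite ea1; ring.
  have h : (3 ^ 4 | a ^ 2 - 36 * a * b + 216 * b ^ 2).
    have [[k1 ek]|pk] := Zdivide_dec 3 k.
      apply: (pow_dvd_unit _ _ (k1 ^ 2 * e ^ 4)) => //.
        apply: prime_ndvd_mul => //; apply: prime_ndvd_pow => //.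
        by apply: (squarefreeZ_cofactor k) => //; rewrite ek; ring.
      apply: (pow_dvd_cancel _ 2) => //; move: h6.
      by rewrite ek; congr (_ | _); ring.
    apply: (pow_dvd_le _ _ 6) => //; apply: pow_dvd_unit h6 => //.
    by apply: prime_ndvd_mul => //; apply: prime_ndvd_pow.
  have : (3 ^ 1 | 8 * b ^ 2).
    apply: (pow_dvd_cancel _ 3) => //; case: h => q eq.
    exists (q - a1 ^ 2 + 4 * a1 * b).
    transitivity ((a ^ 2 - 36 * a * b + 216 * b ^ 2) - a ^ 2 + 36 * a * b); first by ring.
    by rewrite eq ea1 -[3 + 1]/4; ring.
  rewrite Z.pow_1_r; apply: prime_ndvd_mul => //; last by apply: prime_ndvd_pow => //; exact: pb.
  by clear; case=> z; lia.
(* If [p | k], then [k^4] absorbs only [p^4], so [p^8 | a - 27 b] and [p = 3]; moreover [k^2] puts 9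
   into [a]. *)
have [pk|pk] := Zdivide_dec p k.
  have pe := coprime_ndvd _ _ _ pp gke pk; have [k1 ek] := pk.
  have pa : (p | a) by rewrite ea ek; exists (c ^ 3 * k1 ^ 2 * p * e); ring.
  have p3 : p = 3.
    apply: (p_27 pa); apply: (prime_dvd_of_pow _ 8) => //.
    apply: (pow_dvd_unit _ _ (k1 ^ 4 * e ^ 8 * b ^ 3)) => //.
      apply: prime_ndvd_mul => //; last by apply: prime_ndvd_pow => //; exact: pb.
      apply: prime_ndvd_mul => //; apply: prime_ndvd_pow => //.
      by apply: (squarefreeZ_cofactor k) => //; rewrite ek; ring.
    by apply: (pow_dvd_cancel _ 4) => //; move: h12; rewrite ek; congr (_ | _); ring.
  by apply: at3 => //; exists (c ^ 3 * k1 ^ 2 * e); rewrite ea ek p3; ring.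
(* If [p | e], then [e^8] leaves [p^4 | a - 27 b], so [p = 3] and [27 | a]. As [e] holds a single 3
   and [k] none, [3 | c]; then [81 | a], and [3 | b]. *)
have [pe|pe] := Zdivide_dec p e.
  have [e1 ee] := pe.
  have pa : (p | a) by rewrite ea ee; exists (c ^ 3 * k ^ 2 * e1); ring.
  have pe1 : ~ (p | e1) by apply: (squarefreeZ_cofactor e) => //; rewrite ee; ring.
  have h : (p ^ 4 | a - 27 * b).
    apply: (pow_dvd_unit _ _ (k ^ 4 * e1 ^ 8 * b ^ 3)) => //.
      apply: prime_ndvd_mul => //; last by apply: prime_ndvd_pow => //; exact: pb.
      by apply: prime_ndvd_mul => //; apply: prime_ndvd_pow.
    by apply: (pow_dvd_cancel _ 8) => //; move: h12; rewrite ee; congr (_ | _); ring.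
  have p3 : p = 3 by apply: (p_27 pa); apply: (prime_dvd_of_pow _ 4).
  have [c1 ec] : (p | c).
    apply: (prime_dvd_pow _ _ 3) => //; case: h => q eq.
    have : (p | k ^ 2 * e1 * c ^ 3).
      exists (q * p ^ 2 + b * p); apply: (Z.mul_reg_l _ _ p) => //.
      transitivity a; first by rewrite ea ee; ring.
      transitivity ((a - 27 * b) + p ^ 3 * b); first by rewrite p3; ring.
      by rewrite eq; ring.
    case/(prime_mult _ pp) => //; case/(prime_mult _ pp) => // /(prime_dvd_Zpow _ _ _ pp) h.
    by case: pk; apply: h.
  case: (pb pa); case: h => q eq.
  exists (c1 ^ 3 * k ^ 2 * e1 - q); apply: (Z.mul_reg_l _ _ (p ^ 3)); first by apply: Z.pow_nonzero.
  have -> : p ^ 3 * b = a - q * p ^ 4 by rewrite -eq p3; ring.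
  by rewrite ea ee ec; ring.
(* From here [p] divides neither [k] nor [e], so any [p] in [a] comes from the cube [c^3]. *)
have pa_c : (p | a) -> (p | c).
  rewrite ea => /(prime_mult _ pp)[/(prime_mult _ pp)[|]|//] /(prime_dvd_Zpow _ _ _ pp) h; last by case: pk; apply: h.
  by apply: h.
have p9 : p = 3 -> (p | a) -> (9 | a).
  move=> p3 /pa_c [c1 ec]; exists (3 * c1 ^ 3 * k ^ 2 * e); rewrite ea ec p3; ring.
have pc4 : (p | a) \/ (p | a - 24 * b).
  case/prime_dvd_of_pow/(prime_mult _ pp): h4; last by right.
  case/(prime_mult _ pp); last by move/(prime_dvd_Zpow _ _ _ pp) => h; case: pe; apply: h.
  case/(prime_mult _ pp); last by move/(prime_dvd_Zpow _ _ _ pp) => h; case: pk; apply: h.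
  by case=> c1 ec; left; exists (c1 ^ 3 * p ^ 2 * k ^ 2 * e); rewrite ea ec; ring.
case/prime_dvd_of_pow/(prime_mult _ pp): h12.
  case/(prime_mult _ pp); last first.
    move/(prime_dvd_Zpow _ _ _ pp) => hb.
    case: pc4 => [/pb //|h].
    by apply: (pb _ hb); apply: (dvd_comb _ _ _ 1 24 _ h hb); ring.
  by case/(prime_mult _ pp) => /(prime_dvd_Zpow _ _ _ pp) h; [case: pk | case: pe]; apply: h.
move=> hd; have p3 : p = 3.
  case: pc4 => [pa|h]; first exact: p_27.
  have : (p | 3 * b) by apply: (dvd_comb _ _ _ 1 (-1) _ h hd); ring.
  case/(prime_mult _ pp) => [|hb]; first by apply: (prime_div_prime _ _ pp prime_3).
  have pa : (p | a) by apply: (dvd_comb _ _ _ 1 27 _ hd hb); ring.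
  by case: (pb pa).
apply: at3 => //; apply: p9 => //.
have hb3 : (p | 27 * b) by rewrite p3; exists (9 * b); ring.
by apply: (dvd_comb _ _ _ 1 1 _ hd hb3); ring.
Qed.

(** * The family C4, with [a = c^2 k] *)

Section FamilyC4.
Variables (b c k : Z).
Hypothesis cop : Z.gcd (c ^ 2 * k) b = 1.
Hypothesis sk : squarefreeZ k.

Let V := Weierstrass (c * k) (- (k * b)) (- (c * k ^ 2 * b)) 0 0.

Lemma c4_C4 : c4Z V = k ^ 2 * (c ^ 4 * k ^ 2 + 16 * c ^ 2 * k * b + 16 * b ^ 2).
Proof. by rewrite /V /c4Z /b2Z /b4Z /=; ring. Qed.

Lemma disc_C4 : discZ V = c ^ 2 * k ^ 7 * b ^ 4 * (c ^ 2 * k + 16 * b).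
Proof. by rewrite /V /discZ /b2Z /b4Z /b6Z /b8Z /=; ring. Qed.

(** If [p | k], then [k^2] absorbs only [p^2] of [p^4], so [p | X]; but [X = 16 b^2] modulo [c^2 k].
    Otherwise [p | X] at once, and each factor of the discriminant is eliminated against [X]. *)
Lemma irreducible_C4_odd p : Znumtheory.prime p -> p <> 2 -> ~ reducible p V.
Proof.
move=> pp p2 []; rewrite c4_C4 => h4 [_ [h12 _]]; move: h12; rewrite disc_C4 => h12.
have p0 : p <> 0 by have := prime_pos _ pp; lia.
have pb : (p | c ^ 2 * k) -> ~ (p | b) := coprime_ndvd _ _ _ pp cop.
pose X := c ^ 4 * k ^ 2 + 16 * c ^ 2 * k * b + 16 * b ^ 2.
have bad : (p | c ^ 2 * k) -> (p | X) -> False.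
  move=> pa pX; have : (p | 2 ^ 4 * b ^ 2).
    by apply: (dvd_comb _ _ _ 1 (- (c ^ 2 * k + 16 * b)) _ pX pa); rewrite /X; ring.
  apply: prime_ndvd_mul => //; first exact: odd_prime_ndvd_pow2.
  by apply: prime_ndvd_pow => //; exact: pb.
have [[k1 ek]|pk] := Zdivide_dec p k.
  have pa : (p | c ^ 2 * k) by exists (c ^ 2 * k1); rewrite ek; ring.
  apply: (bad pa); apply: (prime_dvd_of_pow _ 2).
  apply: (pow_dvd_unit _ _ (k1 ^ 2)) => //.
    apply: prime_ndvd_pow => //; apply: (squarefreeZ_cofactor k) => //.
    by rewrite ek; ring.
  apply: (pow_dvd_cancel _ 2) => //; move: h4; rewrite -/X {1}ek.
  by congr (_ | _); ring.
have {}h4 : (p | X).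
  by case/prime_dvd_of_pow/(prime_mult _ pp): h4 => // /(prime_dvd_Zpow _ _ _ pp).
case/prime_dvd_of_pow/(prime_mult _ pp): h12 => [/(prime_mult _ pp)[/(prime_mult _ pp)[]|]|].
- by move/(prime_dvd_Zpow _ _ _ pp) => -[c1 ec]; apply: bad => //; exists (c1 ^ 2 * p * k); rewrite ec; ring.
- by move/(prime_dvd_Zpow _ _ _ pp).
- move/(prime_dvd_Zpow _ _ _ pp) => hb.
  have : (p | c ^ 4 * k ^ 2).
    by apply: (dvd_comb _ _ _ 1 (- (16 * c ^ 2 * k + 16 * b)) _ h4 hb); rewrite /X; ring.
  apply: prime_ndvd_mul => //; apply: prime_ndvd_pow => //.
  by move=> -[c1 ec]; apply: pb hb; exists (c1 ^ 2 * p * k); rewrite ec; ring.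
move=> hd; have : (p | 2 ^ 4 * b ^ 2).
  by apply: (dvd_comb _ _ _ 1 (- (c ^ 2 * k)) _ h4 hd); rewrite /X; ring.
case/(prime_mult _ pp) => [|/(prime_dvd_Zpow _ _ _ pp) hb].
  exact: odd_prime_ndvd_pow2.
have pa : (p | c ^ 2 * k) by apply: (dvd_comb _ _ _ 1 (-16) _ hd hb); ring.
exact: (pb pa hb).
Qed.

Lemma irreducible_C4_2 : ~ ((16 | c) /\ (4 | k * b + 1)) -> ~ reducible 2 V.
Proof.
move=> hex red; have red' := red; have [_ [_ [h12 kr]]] := red; move: h12; rewrite disc_C4.
have := coprime_parity _ _ cop; rewrite !parityE.
case/reducible2_even: red; rewrite /= !parityE => eck _.
have [[k1 ek]|[k1 ek]] := even_cases k.
  have ok1 : Z.even k1 = false.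
    apply/negbTE/negP => /dvd2_even.
    by apply: (squarefreeZ_cofactor k) => //; exact: prime_2.
  rewrite ek !parityE /= orbT /= => ob.
  have [[c1 ec]|[c1 ec]] := even_cases c; last first.
    move=> h; apply: (pow2_odd_ndvd _ 8 (c ^ 2 * k1 ^ 7 * b ^ 4 * (c ^ 2 * k1 + 8 * b))) h => //.
      by rewrite ec !parityE /= ok1 ob.
    by ring.
  (* Here [c4 / 16] is 4 times an odd number while [c6 / 64] is even, which Kraus allows only if 16
     divides [c4 / 16]. *)
  move=> _; have := kr erefl; rewrite c4_C4.
  have -> : k ^ 2 * (c ^ 4 * k ^ 2 + 16 * c ^ 2 * k * b + 16 * b ^ 2)
    = (4 * (k1 ^ 2 * (4 * c1 ^ 4 * k1 ^ 2 + 8 * c1 ^ 2 * k1 * b + b ^ 2))) * 16.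
    by rewrite ek ec; ring.
  have -> : c6Z V = (2 * (- 4 * k1 ^ 3 * (2 * c1 ^ 2 * k1 - b) ^ 3
      - 72 * c1 ^ 2 * k1 ^ 4 * b * (2 * c1 ^ 2 * k1 - b)
      - 108 * c1 ^ 2 * k1 ^ 4 * b ^ 2)) * 64.
    by rewrite /V /c6Z /b2Z /b4Z /b6Z /= ek ec; ring.
  rewrite !Z.div_mul // => /kraus2_even []; first by rewrite !parityE.
  move=> [q eq] _; have : Z.even (4 * q) = false; last by rewrite parityE.
  have -> : 4 * q = k1 ^ 2 * (4 * c1 ^ 4 * k1 ^ 2 + 8 * c1 ^ 2 * k1 * b + b ^ 2).
    by apply: (Z.mul_reg_l _ _ 4) => //; rewrite eq; ring.
  by rewrite !parityE /= ok1 ob.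
have ok : Z.even k = false by rewrite ek !parityE.
have /dvd2_even [c1 ec] : Z.even c = true by move: eck; rewrite ok orbF.
rewrite ec !parityE orbT /= => ob.
have [[c2 ec1]|[c2 ec1]] := even_cases c1; last first.
  move=> h; apply: (pow2_odd_ndvd _ 4 (c1 ^ 2 * k ^ 7 * b ^ 4 * (c1 ^ 2 * k + 4 * b))) h => //.
    by rewrite ec1 !parityE /= ok ob.
  by ring.
move=> h12; have [b1 eb] : exists b1, b = 2 * b1 + 1.
  by case: (even_cases b) => // -[b1 eb]; move: ob; rewrite eb !parityE.
have eV : V = Weierstrass (2 * (2 * c2 * k)) (- (k * b)) (4 * (- (c2 * k ^ 2 * b))) 0 0.
  by rewrite /V ec ec1; congr Weierstrass; ring.
rewrite eV in red'.
have [q ekb] : exists q, k * b = 4 * q + 1 \/ k * b = 4 * q - 1.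
  have [q [r [eq hr]]] := @Z_mod_cases 4 (k * b) ltac:(clear; lia).
  have : k * b = 2 * (2 * k1 * b1 + k1 + b1) + 1 by rewrite ek eb; ring.
  clear - eq hr => e; have [r1|r3] : r = 1 \/ r = 3 by lia.
    by exists q; left; lia.
  by exists (q + 1); right; lia.
(* Now [c = 4 c2], [x^2 + a2 = 4 c2^2 k^2 - k b], and [z] has the parity of [c2]. Kraus fails if
   [c2] is even and [k b = 1], or [c2] is odd and [k b = -1] modulo 4; in the two mixed cases the
   discriminant has valuation 10 and 9. *)
have [[c3 ec2]|[c3 ec2]] := even_cases c2; case: ekb => ekb.
- apply: (tate_irreducible2 _ _ _ (4 * c3 ^ 2 * k ^ 2 - q)) red'; left; split.
    by transitivity (16 * c3 ^ 2 * k ^ 2 - k * b); [rewrite ec2; ring | rewrite ekb; ring].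
  by apply/dvd2_even; rewrite ec2 !parityE.
- have oc3 : Z.even c3 = false.
    apply/negbTE/negP => /dvd2_even [x ex]; apply: hex; split.
      by exists x; rewrite ec ec1 ec2 ex; ring.
    by exists q; rewrite ekb; ring.
  apply: (pow2_odd_ndvd _ 10 (c3 ^ 2 * k ^ 7 * b ^ 4 * (4 * c3 ^ 2 * k + b))) h12 => //.
    by rewrite !parityE /= oc3 ok ob.
  by rewrite ec1 ec2; ring.
- pose y := 2 * (c3 ^ 2 + c3) * k + 2 * (q - k1 * b1) + 1.
  have ey : c2 ^ 2 * k + b = 2 * y.
    transitivity (4 * (c3 ^ 2 + c3) * k + k + b); first by rewrite ec2; ring.
    transitivity (4 * (c3 ^ 2 + c3) * k + (k * b - 4 * k1 * b1 + 1)).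
      by rewrite ek eb; ring.
    by rewrite ekb /y; ring.
  apply: (pow2_odd_ndvd _ 9 (c2 ^ 2 * k ^ 7 * b ^ 4 * y)) h12 => //.
    by rewrite ec2 /y !parityE /= ok ob.
  transitivity (2 ^ 8 * c2 ^ 2 * k ^ 7 * b ^ 4 * (c2 ^ 2 * k + b)).
    by rewrite ec1; ring.
  by rewrite ey; ring.
apply: (tate_irreducible2 _ _ _ (c2 ^ 2 * k ^ 2 - q)) red'; right; split.
- by transitivity (4 * c2 ^ 2 * k ^ 2 - k * b); [ring | rewrite ekb; ring].
- by exists (c2 * k); ring.
by rewrite ec2 !parityE /= ok ob.
Qed.

Lemma minimal_C4_1 d : ~ ((16 | c) /\ (4 | k * b + 1)) ->
  minimal_scaling c (EZ C4 (c ^ 2 * k) b d).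
Proof.
move=> h; exists V, 0, 0, 0; split; first by rewrite /V; change_identity.
move=> p pp; have [->|p2] := Z.eq_dec p 2; first exact: irreducible_C4_2.
exact: irreducible_C4_odd.
Qed.

(** The shift [s = c] gives the odd coefficient [a1 = c k / 2 + 1]. The hypotheses make
    [a2 = - (k b + c k + 1) / 4] and [a4 = c k^2 b / 16] integral. *)
Lemma minimal_C4_2 d : (16 | c) -> (4 | k * b + 1) ->
  minimal_scaling (2 * c) (EZ C4 (c ^ 2 * k) b d).
Proof.
move=> [c1 ec] [q ekb]; have ekb' : k * b = 4 * q - 1 by clear - ekb; lia.
pose V' := Weierstrass (8 * c1 * k + 1) (- q - 4 * c1 * k) (- (2 * c1 * k ^ 2 * b))
  (c1 * k ^ 2 * b) 0.
have eq : - (4 * q) = - (k * b) - 1 by rewrite ekb'; ring.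
exists V', 0, c, 0; split.
  split=> /=; try by rewrite ec; ring.
  transitivity (c ^ 2 * (- (4 * q)) - c ^ 3 * k); first by rewrite ec; ring.
  by rewrite eq; ring.
move=> p pp; have [->|p2] := Z.eq_dec p 2.
  by move=> /reducible2_even [] /=; rewrite !parityE.
(* [V'] is also a halving of [V], which brings odd primes back to [irreducible_C4_odd]. *)
have hV : changeZ 2 0 1 0 V V'.
  split=> /=; try by rewrite ec; ring.
  transitivity (- (4 * q) - c * k); first by rewrite ec; ring.
  by rewrite eq; ring.
by move/(changeZ_reducible _ _ _ _ _ _ _ hV p2); exact: irreducible_C4_odd.
Qed.
End FamilyC4.

(** * The family C2 x C2 *)

Section FamilyC2xC2.
Variables (a b d : Z).
Hypothesis gab : Z.gcd a b = 1.
Hypothesis sd : squarefreeZ d.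

Let V := EZ C2xC2 a b d.

Lemma c4_C2xC2 : c4Z V = d ^ 2 * (a ^ 2 - a * b + b ^ 2) * 16.
Proof. by rewrite /V /EZ /c4Z /b2Z /b4Z /=; ring. Qed.

Lemma disc_C2xC2 : discZ V = 16 * d ^ 6 * (a ^ 2 * b ^ 2 * (a - b) ^ 2).
Proof. by rewrite /V /EZ /discZ /b2Z /b4Z /b6Z /b8Z /=; ring. Qed.

(** The powers of [d] absorb at most [p^2] of [p^4] and [p^6] of [p^12], so [p] divides
    [X = a^2 - a b + b^2] and one of [a], [b], [a - b]. Modulo these, [X] is [b^2], [a^2] and [a b],
    against coprimality. *)
Lemma irreducible_C2xC2_odd p : Znumtheory.prime p -> p <> 2 -> ~ reducible p V.
Proof.
move=> pp p2 []; rewrite c4_C2xC2 => h4 [_ [h12 _]]; move: h12; rewrite disc_C2xC2 => h12.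
have p0 : p <> 0 by have := prime_pos _ pp; clear; lia.
have pb : (p | a) -> ~ (p | b) := coprime_ndvd _ _ _ pp gab.
pose X := a ^ 2 - a * b + b ^ 2.
have p16 : ~ (p | 16) by exact: (odd_prime_ndvd_pow2 _ 4).
have {}h4 : (p ^ 4 | d ^ 2 * X).
  by apply: (pow_dvd_unit _ _ 16) => //; rewrite Z.mul_comm.
have {}h12 : (p ^ 12 | d ^ 6 * (a ^ 2 * b ^ 2 * (a - b) ^ 2)).
  by apply: (pow_dvd_unit _ _ 16) => //; rewrite Z.mul_assoc.
have [pX pY] : (p | X) /\ (p | a ^ 2 * b ^ 2 * (a - b) ^ 2).
  have [[d1 ed]|pd] := Zdivide_dec p d.
    have pd1 : ~ (p | d1) by apply: (squarefreeZ_cofactor d) => //; rewrite ed; ring.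
    split.
      apply: (prime_dvd_of_pow _ 2); apply: (pow_dvd_unit _ _ (d1 ^ 2)) => //.
        exact: prime_ndvd_pow.
      by apply: (pow_dvd_cancel _ 2) => //; move: h4; rewrite ed; congr (_ | _); ring.
    apply: (prime_dvd_of_pow _ 6); apply: (pow_dvd_unit _ _ (d1 ^ 6)) => //.
      exact: prime_ndvd_pow.
    by apply: (pow_dvd_cancel _ 6) => //; move: h12; rewrite ed; congr (_ | _); ring.
  split.
    by apply: (prime_dvd_of_pow _ 4); apply: pow_dvd_unit h4 => //; exact: prime_ndvd_pow.
  by apply: (prime_dvd_of_pow _ 12); apply: pow_dvd_unit h12 => //; exact: prime_ndvd_pow.
have pa_b : (p | a) -> (p | b).
  move=> pa; apply: (prime_dvd_Zpow _ _ 2 pp).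
  by apply: (dvd_comb _ _ _ 1 (b - a) _ pX pa); rewrite /X; ring.
have pb_a : (p | b) -> (p | a).
  move=> hb; apply: (prime_dvd_Zpow _ _ 2 pp).
  by apply: (dvd_comb _ _ _ 1 (a - b) _ pX hb); rewrite /X; ring.
have pna : ~ (p | a) by move=> pa; exact: (pb pa (pa_b pa)).
have pnb : ~ (p | b) by move=> hb; exact: (pna (pb_a hb)).
case/(prime_mult _ pp): pY => [/(prime_mult _ pp)[]|] /(prime_dvd_Zpow _ _ _ pp) // hd.
have : (p | a * b) by apply: (dvd_comb _ _ _ 1 (b - a) _ pX hd); rewrite /X; ring.
exact: prime_ndvd_mul.
Qed.

(** The shift [s = 1] gives [a1 = 1], and the hypotheses make [a2 = (a d + b d - 1) / 4] and
    [a4 = a b d^2 / 16] integral. *)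
Lemma minimal_C2xC2_2 : (16 | a) -> (4 | b * d - 1) -> minimal_scaling 2 V.
Proof.
move=> [a1 ea] [q ebd].
have ebd' : b * d = 4 * q + 1 by clear - ebd; lia.
pose V' := Weierstrass 1 (4 * a1 * d + q) 0 (a1 * b * d ^ 2) 0.
have hV : changeZ 2 0 1 0 V V'.
  rewrite /V /V' /EZ; split=> /=; try by rewrite ?ea; ring.
  transitivity (16 * a1 * d + (4 * q + 1) - 1); first by ring.
  by rewrite -ebd' ea; ring.
exists V', 0, 1, 0; split=> // p pp.
have [->|p2] := Z.eq_dec p 2; first by move=> /reducible2_even [] /=.
by move/(changeZ_reducible _ _ _ _ _ _ _ hV p2); exact: irreducible_C2xC2_odd.
Qed.

(** If [d] is even, [c6 / 64] is even and [c4 / 16] is 4 times an odd number, against Kraus. If [d]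
    is odd, the discriminant forces [16 | a]; then [c6 / 64 = - (b d)^3 mod 4] must be -1, so
    [b d = 1 mod 4]. *)
Lemma minimal_C2xC2_1 : (2 | a) -> ~ ((16 | a) /\ (4 | b * d - 1)) -> minimal_scaling 1 V.
Proof.
move=> [a1 ea] hex; exists V, 0, 0, 0; split; first by rewrite /V; change_identity.
move=> p pp; have [->|p2] := Z.eq_dec p 2; last exact: irreducible_C2xC2_odd.
move=> [_ [_ [h12 /(_ erefl)]]]; move: h12; rewrite disc_C2xC2 => h12.
have ob : Z.even b = false.
  by apply: (even_coprimer a) => //; rewrite ea !parityE orbT.
pose y := d ^ 3 * (a + b) * (9 * a1 * b - (a + b) ^ 2).
have -> : c6Z V = y * 64.
  by rewrite /V /EZ /c6Z /b2Z /b4Z /b6Z /= /y ea; ring.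
rewrite c4_C2xC2 !Z.div_mul //.
have [[d1 ed]|[d1 ed]] := even_cases d.
  move/kraus2_even => []; first by rewrite /y ed !parityE.
  move=> [q eq] _; have : Z.even (4 * q) = false; last by rewrite parityE.
  have -> : 4 * q = d1 ^ 2 * (a ^ 2 - a * b + b ^ 2).
    by apply: (Z.mul_reg_l _ _ 4) => //; rewrite ed in eq; transitivity (q * 16); [ring | rewrite -eq; ring].
  have od1 : Z.even d1 = false.
    by apply/negbTE/negP => /dvd2_even; apply: (squarefreeZ_cofactor d) => //; exact: prime_2.
  by rewrite !parityE /= od1 ob ea !parityE orbT.
have od : Z.even d = false by rewrite ed !parityE.
move/kraus2_odd => []; first by rewrite !parityE /= od ob ea !parityE orbT.
move=> q ey; apply: hex.
have e6 : (2 ^ 6 | a1 ^ 2).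
  apply: (pow_dvd_unit _ _ (d ^ 6 * b ^ 2 * (a - b) ^ 2)) => //; first exact: prime_2.
    by move/dvd2_even; rewrite !parityE /= od ob ea !parityE orbT.
  apply: (pow_dvd_cancel _ 6) => //; move: h12; rewrite {1}ea.
  by congr (_ | _); ring.
have [a2 [ea1 h2]] := pow_dvd_pow _ 2 4 _ prime_2 erefl (Zle_0_pos _) e6.
have [a3 [ea2 h3]] := pow_dvd_pow _ 2 2 _ prime_2 erefl (Zle_0_pos _) h2.
have [a4 [ea3 _]] := pow_dvd_pow _ 2 0 _ prime_2 erefl (Z.le_refl 0) h3.
have ea' : a = 16 * a4 by rewrite ea ea1 ea2 ea3; ring.
split; first by exists a4; rewrite ea'; ring.
have [b1 eb] : exists b1, b = 2 * b1 + 1.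
  by case: (even_cases b) => // -[b1 eb]; move: ob; rewrite eb !parityE.
(* [b d = 2 s + 1], and [(2 s + 1)^3 - (2 s + 1) = 4 s (s + 1) (2 s + 1)] replaces the cube by [b d]
   modulo 4. *)
pose s := 2 * b1 * d1 + b1 + d1.
exists (d ^ 3 * (- (1024 * a4 ^ 3) + 96 * a4 ^ 2 * b + 6 * a4 * b ^ 2)
  - s * (s + 1) * (2 * s + 1) - q).
have es : b * d = 2 * s + 1 by rewrite eb ed /s; ring.
have ea1' : a1 = 8 * a4 by rewrite ea1 ea2 ea3; ring.
transitivity (y + (b * d) ^ 3 - 4 * s * (s + 1) * (2 * s + 1) - (y + 1)).
  by rewrite es; ring.
by rewrite ey /y ea' ea1'; ring.
Qed.
End FamilyC2xC2.

(** * The family C2 *)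

Section FamilyC2.
Variables (a b d : Z).
Hypothesis sd : squarefreeZ d.
Hypothesis sg : squarefreeZ (Z.gcd a b).

Let V := EZ C2 a b d.

Lemma c4_C2 : c4Z V = (a ^ 2 + 3 * b ^ 2 * d) * 16.
Proof. by rewrite /V /EZ /c4Z /b2Z /b4Z /=; ring. Qed.

Lemma c6_C2 : c6Z V = a * (a ^ 2 - 9 * b ^ 2 * d) * 64.
Proof. by rewrite /V /EZ /c6Z /b2Z /b4Z /b6Z /=; ring. Qed.

Lemma disc_C2 : discZ V = 64 * (b ^ 2 * d * (a ^ 2 - b ^ 2 * d) ^ 2).
Proof. by rewrite /V /EZ /discZ /b2Z /b4Z /b6Z /b8Z /=; ring. Qed.

Lemma sqr_dvd_gcd p : Znumtheory.prime p -> (p ^ 2 | a) -> ~ (p ^ 2 | b).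
Proof.
move=> pp ha hb; apply: (squarefreeZ_ndvd _ _ sg pp).
exact: Z.gcd_greatest.
Qed.

Lemma sqr_dvd_mul_sqr p x : Znumtheory.prime p -> (p ^ 2 | x ^ 2 * d) -> (p | x).
Proof.
move=> pp h; have [//|px] := Zdivide_dec p x.
case: (squarefreeZ_ndvd _ _ sd pp); apply: pow_dvd_unit h => //.
exact: prime_ndvd_pow.
Qed.

(** At 3 the combination [12 b^2 d] of [c4] and [c6] no longer isolates [b], so factors 3 are peeled
    off [a], [b] and [d] by turns. If 3 does not divide [b], [c6] gives the contradiction; if it
    does, then [9 | a], the gcd bounds the power of 3 in [b], and the discriminant decides. *)
Lemma irreducible_C2_at3 : ~ ((3 ^ 4 | a ^ 2 + 3 * b ^ 2 * d) /\
  (3 ^ 6 | a * (a ^ 2 - 9 * b ^ 2 * d)) /\ (3 ^ 12 | b ^ 2 * d * (a ^ 2 - b ^ 2 * d) ^ 2)).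
Proof.
move=> [h4 [h6 h12]]; have pp := prime_3.
have [a1 ea] : (3 | a).
  apply: (prime_dvd_Zpow _ _ 2 pp).
  apply: (dvd_comb _ _ 3 1 (- (b ^ 2 * d)) _ (prime_dvd_of_pow _ _ _ h4) (Z.divide_refl 3)).
  by ring.
have {}h4 : (3 ^ 3 | 3 * a1 ^ 2 + b ^ 2 * d).
  by apply: (pow_dvd_cancel _ 1) => //; move: h4; rewrite ea; congr (_ | _); ring.
have : (3 | b ^ 2 * d).
  apply: (dvd_comb _ _ 3 1 (- a1 ^ 2) _ (prime_dvd_of_pow _ _ _ h4) (Z.divide_refl 3)).
  by ring.
have [[b1 eb] _|pb] := Zdivide_dec 3 b; last first.
  case/(prime_mult _ pp) => [/(prime_dvd_Zpow _ _ _ pp) //|[d1 ed]].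
  have pd1 : ~ (3 | d1) by apply: (squarefreeZ_cofactor d) => //; rewrite ed; ring.
  have {}h4 : (3 ^ 2 | a1 ^ 2 + b ^ 2 * d1).
    by apply: (pow_dvd_cancel _ 1) => //; move: h4; rewrite ed; congr (_ | _); ring.
  have {}h6 : (3 ^ 3 | a1 * (a1 ^ 2 - 3 * (b ^ 2 * d1))).
    by apply: (pow_dvd_cancel _ 3) => //; move: h6; rewrite ea ed; congr (_ | _); ring.
  have [a2 ea1] : (3 | a1).
    case/prime_dvd_of_pow/(prime_mult _ pp): h6 => // h.
    apply: (prime_dvd_Zpow _ _ 2 pp).
    apply: (dvd_comb _ _ 3 1 (b ^ 2 * d1) _ h (Z.divide_refl 3)); ring.
  have : (3 | b ^ 2 * d1).
    apply: (dvd_comb _ _ 3 1 (- (3 * a2 ^ 2)) _ (prime_dvd_of_pow _ _ _ h4) (Z.divide_refl 3)).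
    by rewrite ea1; ring.
  by apply: prime_ndvd_mul => //; exact: prime_ndvd_pow.
have {}h4 : (3 ^ 2 | a1 ^ 2 + 3 * b1 ^ 2 * d).
  by apply: (pow_dvd_cancel _ 1) => //; move: h4; rewrite eb; congr (_ | _); ring.
have [a2 ea1] : (3 | a1).
  apply: (prime_dvd_Zpow _ _ 2 pp).
  apply: (dvd_comb _ _ 3 1 (- (b1 ^ 2 * d)) _ (prime_dvd_of_pow _ _ _ h4) (Z.divide_refl 3)).
  by ring.
have pb1 : ~ (3 | b1).
  move=> [b2 eb1]; apply: (sqr_dvd_gcd _ pp).
    by exists a2; rewrite ea ea1; ring.
  by exists b2; rewrite eb eb1; ring.
have : (3 | b1 ^ 2 * d).
  rewrite -(Z.pow_1_r 3); apply: (pow_dvd_cancel _ 1) => //.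
  apply: (dvd_comb _ _ (3 ^ 2) 1 (- a2 ^ 2) _ h4 (Z.divide_refl _)).
  by rewrite ea1; ring.
case/(prime_mult _ pp) => [/(prime_dvd_Zpow _ _ _ pp) //|[d1 ed]].
have pd1 : ~ (3 | d1) by apply: (squarefreeZ_cofactor d) => //; rewrite ed; ring.
have pbd : ~ (3 | b1 ^ 2 * d1) by apply: prime_ndvd_mul => //; exact: prime_ndvd_pow.
(* With [a = 9 a2], [b = 3 b1], [d = 3 d1], the number divisible by [3^12] is [3^9 y], and [y] is
   prime to 3. *)
pose y := b1 ^ 2 * d1 * (3 * a2 ^ 2 - b1 ^ 2 * d1) ^ 2.
have : (3 ^ 3 | y).
  apply: (pow_dvd_cancel _ 9) => //; move: h12; rewrite ea ea1 eb ed /y.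
  by congr (_ | _); ring.
move/prime_dvd_of_pow; apply: prime_ndvd_mul => //; apply: prime_ndvd_pow => // h.
by apply: pbd; apply: (dvd_comb _ _ 3 (-1) (a2 ^ 2) _ h (Z.divide_refl 3)); ring.
Qed.

(** For [z = b^2 d], [x^2 + 3 z] and [x^2 - 9 z] differ by [12 z], so beyond 3 the conditions on
    [c4] and [c6] give [p | a], then [p | b] as [d] is squarefree. Dividing out leaves exponents 2
    and 3, enough for a second round, which contradicts the squarefree gcd. *)
Lemma irreducible_C2_odd p : Znumtheory.prime p -> p <> 2 -> ~ reducible p V.
Proof.
move=> pp p2 []; rewrite c4_C2 => h4; rewrite c6_C2 => -[h6 [h12 _]].
move: h12; rewrite disc_C2 => h12.
have p2k k : 0 <= k -> ~ (p | 2 ^ k) by apply: odd_prime_ndvd_pow2.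
have {}h4 : (p ^ 4 | a ^ 2 + 3 * b ^ 2 * d).
  by apply: (pow_dvd_unit _ _ (2 ^ 4)); rewrite ?[2 ^ 4 * _]Z.mul_comm //; apply: p2k.
have {}h6 : (p ^ 6 | a * (a ^ 2 - 9 * b ^ 2 * d)).
  by apply: (pow_dvd_unit _ _ (2 ^ 6)); rewrite ?[2 ^ 6 * _]Z.mul_comm //; apply: p2k.
have {}h12 : (p ^ 12 | b ^ 2 * d * (a ^ 2 - b ^ 2 * d) ^ 2).
  by apply: (pow_dvd_unit _ _ (2 ^ 6)) => //; apply: p2k.
have [p3|p3] := Z.eq_dec p 3.
  by rewrite p3 in h4 h6 h12; case: irreducible_C2_at3.
have pn3 : ~ (p | 3) by move=> h; apply: p3; apply: prime_div_prime => //; exact: prime_3.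
have pn12 : ~ (p | 2 ^ 2 * 3) by apply: prime_ndvd_mul => //; apply: p2k.
have step x z : (p | x ^ 2 + 3 * z) -> (p | x * (x ^ 2 - 9 * z)) -> (p | x).
  move=> h /(prime_mult _ pp)[//|h']; apply: (prime_dvd_Zpow _ _ 2 pp).
  have : (p | 2 ^ 2 * 3 * z) by apply: (dvd_comb _ _ _ 1 (-1) _ h h'); ring.
  case/(prime_mult _ pp) => // hz.
  by apply: (dvd_comb _ _ _ 1 (-3) _ h hz); ring.
have step2 x y : (p ^ 2 | x ^ 2 + 3 * (y ^ 2 * d)) -> (p | x) -> (p | y).
  move=> h [x1 ex]; apply: sqr_dvd_mul_sqr => //.
  apply: (pow_dvd_unit _ _ 3) => //.
  by apply: (dvd_comb _ _ (p ^ 2) 1 (- x1 ^ 2) _ h (Z.divide_refl _)); rewrite ex; ring.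
have [a1 ea] : (p | a).
  apply: (step _ (b ^ 2 * d)).
    by rewrite Z.mul_assoc; exact: prime_dvd_of_pow h4.
  by rewrite Z.mul_assoc; exact: prime_dvd_of_pow h6.
have [b1 eb] : (p | b).
  apply: (step2 a); last by exists a1.
  by rewrite Z.mul_assoc; apply: pow_dvd_le h4.
have p0 : p <> 0 by have := prime_pos _ pp; clear; lia.
have {}h4 : (p ^ 2 | a1 ^ 2 + 3 * (b1 ^ 2 * d)).
  by apply: (pow_dvd_cancel _ 2) => //; move: h4; rewrite ea eb; congr (_ | _); ring.
have {}h6 : (p ^ 3 | a1 * (a1 ^ 2 - 9 * (b1 ^ 2 * d))).
  by apply: (pow_dvd_cancel _ 3) => //; move: h6; rewrite ea eb; congr (_ | _); ring.
have pa1 : (p | a1) by apply: step; [exact: prime_dvd_of_pow h4 | exact: prime_dvd_of_pow h6].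
have [b2 eb1] := step2 _ _ h4 pa1; have [a2 ea1] := pa1.
apply: (sqr_dvd_gcd _ pp); first by exists a2; rewrite ea ea1; ring.
by exists b2; rewrite eb eb1; ring.
Qed.

(** The shift [s = 2] with [u = 4] gives [a1 = 1], [a2 = (2 a - 4) / 16] and
    [a4 = (a^2 - b^2 d) / 256]. *)
Lemma minimal_C2_4 a0 b0 : a = 2 * (4 * a0 + 1) -> b = 2 * b0 ->
  (2 ^ 8 | b ^ 2 * d - a ^ 2) -> minimal_scaling 4 V.
Proof.
move=> ea eb [q eq]; pose V' := Weierstrass 1 a0 0 (- q) 0.
have hV : changeZ 4 0 2 0 V V'.
  rewrite /V /EZ /V'; split=> /=; try by rewrite ?ea; ring.
  by transitivity (- (q * 2 ^ 8)); [ring | rewrite -eq; ring].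
exists V', 0, 2, 0; split=> // p pp.
have [->|p2] := Z.eq_dec p 2; first by move=> /reducible2_even [] /=.
by move/(changeZ_reducible _ _ _ _ _ _ _ hV p2); exact: irreducible_C2_odd.
Qed.

(** Serves both cases of [u = 2] with [v2 a = v2 b = 1]. If [V'] were reducible at 2, its
    discriminant [16 m^2 (a0^2 - 4 m)] would force [16 | m], and then [c6 / 64 = - a0^3 mod 4] would
    force [a0 = 1 mod 4]: the excluded pair. *)
Lemma minimal_C2_2 a0 m : a = 2 * a0 -> Z.even a0 = false -> b ^ 2 * d - a ^ 2 = - (16 * m) ->
  ~ ((16 | m) /\ (4 | a0 - 1)) -> minimal_scaling 2 V.
Proof.
move=> ea oa em hex; pose V' := Weierstrass 0 a0 0 m 0.
have hV : changeZ 2 0 0 0 V V'.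
  rewrite /V /EZ /V'; split=> /=; try by rewrite ?ea; ring.
  by transitivity (- (- (16 * m))); [ring | rewrite -em; ring].
exists V', 0, 0, 0; split=> // p pp.
have [->|p2] := Z.eq_dec p 2; last first.
  by move/(changeZ_reducible _ _ _ _ _ _ _ hV p2); exact: irreducible_C2_odd.
move=> [_ [h6 [h12 /(_ erefl)]]].
have [m1 em1] : (2 | m).
  have {}h6 : (2 ^ 1 | a0 * (9 * m - 2 * a0 ^ 2)).
    apply: (pow_dvd_cancel _ 5) => //; move: h6.
    by rewrite /c6Z /b2Z /b4Z /b6Z /=; congr (_ | _); ring.
  apply/dvd2_even; move: h6; rewrite Z.pow_1_r => /dvd2_even.
  by rewrite !parityE /= oa /=; case: (Z.even m).
have h16 : (2 ^ 8 | m ^ 2).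
  apply: (pow_dvd_unit _ _ (a0 ^ 2 - 4 * m)) => //; first exact: prime_2.
    by move/dvd2_even; rewrite !parityE /= oa.
  apply: (pow_dvd_cancel _ 4) => //; move: h12.
  by rewrite /discZ /b2Z /b4Z /b6Z /b8Z /=; congr (_ | _); ring.
have [n1 [en1 hn1]] := pow_dvd_pow _ 2 6 _ prime_2 erefl (Zle_0_pos _) h16.
have [n2 [en2 hn2]] := pow_dvd_pow _ 2 4 _ prime_2 erefl (Zle_0_pos _) hn1.
have [n3 [en3 hn3]] := pow_dvd_pow _ 2 2 _ prime_2 erefl (Zle_0_pos _) hn2.
have [n4 [en4 _]] := pow_dvd_pow _ 2 0 _ prime_2 erefl (Z.le_refl 0) hn3.
have {}em1 : m = 16 * n4 by rewrite en1 en2 en3 en4; ring.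
have -> : c4Z V' = (a0 ^ 2 - 3 * m) * 16 by rewrite /V' /c4Z /b2Z /b4Z /=; ring.
have -> : c6Z V' = (a0 * (72 * n4 - a0 ^ 2)) * 64.
  by rewrite /V' /c6Z /b2Z /b4Z /b6Z /= em1; ring.
rewrite !Z.div_mul // => /kraus2_odd []; first by rewrite em1 !parityE /= oa.
move=> q eq; apply: hex; split; first by exists n4; rewrite em1; ring.
have [s es] : exists s, a0 = 2 * s + 1.
  by case: (even_cases a0) => // -[s es]; move: oa; rewrite es !parityE.
exists (18 * a0 * n4 - s * (s + 1) * (2 * s + 1) - q).
transitivity (72 * a0 * n4 - 4 * s * (s + 1) * (2 * s + 1) - q * 4); last by ring.
by rewrite -eq es; ring.
Qed.

(** [r = - a] turns the quadratic factor [(x + a)^2 - b^2 d] into a pure one and [s = 1] gives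
    [a1 = 1]; then [a2 = - (a + 1) / 4], [a4 = - b^2 d / 16] and [a6 = a b^2 d / 64]. *)
Lemma minimal_C2_2' a0 b0 : a = 4 * a0 - 1 -> b = 8 * b0 -> minimal_scaling 2 V.
Proof.
move=> ea eb.
pose V' := Weierstrass 1 (- a0) 0 (- (4 * b0 ^ 2 * d)) (a * b0 ^ 2 * d).
have hV : changeZ 2 (- a) 1 0 V V'.
  by rewrite /V /EZ /V'; split=> /=; rewrite ?eb; try ring; rewrite ea; ring.
exists V', (- a), 1, 0; split=> // p pp.
have [->|p2] := Z.eq_dec p 2; first by move=> /reducible2_even [] /=.
by move/(changeZ_reducible _ _ _ _ _ _ _ hV p2); exact: irreducible_C2_odd.
Qed.

(** For [a] odd, Kraus rules out [b^2 d] odd; otherwise the discriminant gives [8 | b] and [c6]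
    gives [a = -1 mod 4]. For [a] even, [16 | a^2 + 3 b^2 d] makes [a / 2] and [b / 2] odd, by the
    squarefree gcd, and puts 16 into [b^2 d - a^2]. *)
Lemma minimal_C2_1 :
  ~ ((16 | b ^ 2 * d - a ^ 2) /\
     exists a0 b0, [/\ a = 2 * a0, b = 2 * b0, Z.even a0 = false & Z.even b0 = false]) ->
  ~ ((8 | b) /\ (4 | a + 1)) -> minimal_scaling 1 V.
Proof.
move=> hw hb; exists V, 0, 0, 0; split; first by rewrite /V; change_identity.
move=> p pp; have [->|p2] := Z.eq_dec p 2; last exact: irreducible_C2_odd.
move=> [_ [_ [h12 /(_ erefl)]]]; move: h12; rewrite disc_C2 c4_C2 c6_C2 !Z.div_mul // => h12.
have [[a0 ea]|[a0 ea]] := even_cases a; last first.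
  have oa : Z.even a = false by rewrite ea !parityE.
  have [ebd|obd] := boolP (Z.even b || Z.even d); last first.
    move/kraus2_even => [].
      by rewrite !parityE /= oa; move: obd; case: (Z.even b); case: (Z.even d).
    move=> [q eq] [r er].
    (* [a (c4 / 16) - c6 / 64 = 12 a b^2 d] would be divisible by 8. *)
    have : Z.even (3 * a * (b ^ 2 * d)) = false.
      by rewrite !parityE /= oa; move: obd; case: (Z.even b); case: (Z.even d).
    have -> : 3 * a * (b ^ 2 * d) = 2 * (2 * a * q - r); last by rewrite parityE.
    apply: (Z.mul_reg_l _ _ 4) => //.
    transitivity (a * (a ^ 2 + 3 * b ^ 2 * d) - a * (a ^ 2 - 9 * b ^ 2 * d)); first by ring.
    by rewrite eq er; ring.
  move/kraus2_odd => [].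
    by rewrite !parityE /= oa; move: ebd; case: (Z.even b); case: (Z.even d).
  move=> q eq; apply: hb.
  have h6 : (2 ^ 6 | b ^ 2 * d).
    apply: (pow_dvd_unit _ _ ((a ^ 2 - b ^ 2 * d) ^ 2)) => //; first exact: prime_2.
      move/dvd2_even; rewrite !parityE /= oa.
      by move: ebd; case: (Z.even b); case: (Z.even d).
    by apply: (pow_dvd_cancel _ 6) => //; move: h12; congr (_ | _); ring.
  have [b1 eb] : (2 | b).
    by apply: (sqr_dvd_mul_sqr _ _ prime_2); apply: (pow_dvd_le _ _ 6) => //; clear; lia.
  have {}h6 : (2 ^ 4 | b1 ^ 2 * d).
    by apply: (pow_dvd_cancel _ 2) => //; move: h6; rewrite eb; congr (_ | _); ring.
  have [b2 eb1] : (2 | b1).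
    by apply: (sqr_dvd_mul_sqr _ _ prime_2); apply: (pow_dvd_le _ _ 4) => //; clear; lia.
  have {}h6 : (2 ^ 2 | b2 ^ 2 * d).
    by apply: (pow_dvd_cancel _ 2) => //; move: h6; rewrite eb1; congr (_ | _); ring.
  have [b3 eb2] := sqr_dvd_mul_sqr _ _ prime_2 h6.
  split; first by exists b3; rewrite eb eb1 eb2; ring.
  exists (q + 144 * a * b3 ^ 2 * d - a0 * (a0 + 1) * (2 * a0 + 1)).
  transitivity (q * 4 + 576 * a * b3 ^ 2 * d - 4 * a0 * (a0 + 1) * (2 * a0 + 1)); last by ring.
  by rewrite -eq eb eb1 eb2 ea; ring.
move/kraus2_even => []; first by rewrite ea !parityE.
move=> [q eq] _.
have h4 : (2 ^ 2 | 3 * (b ^ 2 * d)).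
  exists (4 * q - a0 ^ 2); transitivity (a ^ 2 + 3 * b ^ 2 * d - a ^ 2); first by ring.
  by rewrite eq ea; ring.
have n23 : ~ (2 | 3) by clear; case=> z; lia.
have [b0 eb] : (2 | b).
  by apply: (sqr_dvd_mul_sqr _ _ prime_2); apply: pow_dvd_unit h4 => //; exact: prime_2.
have eq' : a0 ^ 2 + 3 * (b0 ^ 2 * d) = 4 * q.
  apply: (Z.mul_reg_l _ _ 4) => //; transitivity (q * 16); last by ring.
  by rewrite -eq ea eb; ring.
have oa0 : Z.even a0 = false.
  apply/negbTE/negP => /dvd2_even [a1 ea0].
  have [b1 eb0] : (2 | b0).
    apply: (sqr_dvd_mul_sqr _ _ prime_2).
    apply: (pow_dvd_unit _ _ 3) => //; first exact: prime_2.
    exists (q - a1 ^ 2); transitivity (a0 ^ 2 + 3 * (b0 ^ 2 * d) - a0 ^ 2); first by ring.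
    by rewrite eq' ea0; ring.
  apply: (sqr_dvd_gcd _ prime_2); first by exists a1; rewrite ea ea0; ring.
  by exists b1; rewrite eb eb0; ring.
apply: hw; split.
  exists (b0 ^ 2 * d - q).
  transitivity (16 * (b0 ^ 2 * d) - 4 * (a0 ^ 2 + 3 * (b0 ^ 2 * d))).
    by rewrite ea eb; ring.
  by rewrite eq'; ring.
exists a0, b0; split=> //; first by rewrite eb; ring.
by have := congr1 Z.even eq'; rewrite !parityE /= oa0; case: (Z.even b0).
Qed.
End FamilyC2.

Local Close Scope Z_scope.

(** * Descent from rational models to integral ones *)

From mathcomp Require Import ring zify ssrZ.

Import Order.TTheory GRing.Theory Num.Theory.
Local Open Scope ring_scope.

Definition c4 {R : comNzRingType} (W : weierstrass R) : R :=
  b2 W ^+ 2 - 24 * b4 W.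
Definition c6 {R : comNzRingType} (W : weierstrass R) : R :=
  - b2 W ^+ 3 + 36 * b2 W * b4 W - 216 * b6 W.

Lemma c4_change_vars {F : fieldType} (u r s t : F) (W : weierstrass F) :
  u != 0 -> c4 (change_vars u r s t W) = c4 W / u ^+ 4.
Proof. by case: W => a1 a2 a3 a4 a6 u0; rewrite /c4 /b4 /b2 /=; field. Qed.

Lemma c6_change_vars {F : fieldType} (u r s t : F) (W : weierstrass F) :
  u != 0 -> c6 (change_vars u r s t W) = c6 W / u ^+ 6.
Proof.
by case: W => a1 a2 a3 a4 a6 u0; rewrite /c6 /b6 /b4 /b2 /=; field.
Qed.

Definition ratZ (x : Z) : rat := (int_of_Z x)%:~R.
Definition modelQ (V : weierstrass Z) : weierstrass rat := map_weierstrass ratZ V.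

Lemma ratZD x y : ratZ (Z.add x y) = ratZ x + ratZ y.
Proof. by rewrite /ratZ -intrD -rmorphD. Qed.
Lemma ratZN x : ratZ (Z.opp x) = - ratZ x.
Proof. by rewrite /ratZ -intrN -rmorphN. Qed.
Lemma ratZB x y : ratZ (Z.sub x y) = ratZ x - ratZ y.
Proof. by rewrite ratZD ratZN. Qed.
Lemma ratZM x y : ratZ (Z.mul x y) = ratZ x * ratZ y.
Proof. by rewrite /ratZ -intrM -rmorphM. Qed.
Lemma ratZX x (n : nat) : ratZ (Z.pow x (Z.of_nat n)) = ratZ x ^+ n.
Proof.
elim: n => // n IH.
by rewrite Nat2Z.inj_succ Z.pow_succ_r ?ratZM ?IH ?exprS //; lia.
Qed.
Lemma ratZ_nat (n : nat) : ratZ (Z.of_nat n) = n%:R.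
Proof. by rewrite /ratZ (_ : int_of_Z _ = n) //; lia. Qed.
Lemma ratZ_inj : injective ratZ.
Proof. by move=> x y /intr_inj /(can_inj int_of_ZK). Qed.
Lemma ratZ_eq0 x : (ratZ x == 0) = (x == Z0).
Proof. by rewrite -(inj_eq ratZ_inj). Qed.

Lemma ratZ2 x : ratZ (Z.pow x 2) = ratZ x ^+ 2. Proof. exact: (ratZX x 2). Qed.
Lemma ratZ3 x : ratZ (Z.pow x 3) = ratZ x ^+ 3. Proof. exact: (ratZX x 3). Qed.
Lemma ratZ4 x : ratZ (Z.pow x 4) = ratZ x ^+ 4. Proof. exact: (ratZX x 4). Qed.
Lemma ratZ6 x : ratZ (Z.pow x 6) = ratZ x ^+ 6. Proof. exact: (ratZX x 6). Qed.
Lemma ratZ12 x : ratZ (Z.pow x 12) = ratZ x ^+ 12. Proof. exact: (ratZX x 12). Qed.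

Lemma c4_modelQ V : c4 (modelQ V) = ratZ (c4Z V).
Proof.
case: V => a1 a2 a3 a4 a6; rewrite /c4 /c4Z /b2Z /b4Z /b2 /b4 /=.
rewrite !(ratZD, ratZN, ratZB, ratZM, ratZ2, ratZ3).
by rewrite (ratZ_nat 2) (ratZ_nat 4) (ratZ_nat 24).
Qed.

Lemma c6_modelQ V : c6 (modelQ V) = ratZ (c6Z V).
Proof.
case: V => a1 a2 a3 a4 a6; rewrite /c6 /c6Z /b2Z /b4Z /b6Z /b2 /b4 /b6 /=.
rewrite !(ratZD, ratZN, ratZB, ratZM, ratZ2, ratZ3).
by rewrite (ratZ_nat 2) (ratZ_nat 4) (ratZ_nat 36) (ratZ_nat 216).
Qed.

Lemma disc_modelQ V : disc (modelQ V) = ratZ (discZ V).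
Proof.
case: V => a1 a2 a3 a4 a6.
rewrite /disc /discZ /b2Z /b4Z /b6Z /b8Z /b2 /b4 /b6 /b8 /=.
rewrite !(ratZD, ratZN, ratZB, ratZM, ratZ2, ratZ3).
by rewrite (ratZ_nat 2) (ratZ_nat 4) (ratZ_nat 8) (ratZ_nat 9) (ratZ_nat 27).
Qed.

Lemma over_rat_int_of_Z V : over_rat (map_weierstrass int_of_Z V) = modelQ V.
Proof. by case: V. Qed.

Lemma prime_Z_of_nat (p : nat) : prime.prime p -> Znumtheory.prime (Z.of_nat p).
Proof.
move=> pp; have p1 := prime_gt1 pp; apply/prime_alt; split; first by lia.
move=> n n1 [q e].
have /(primeP pp).2 : (Z.to_nat n %| p)%N.
  apply/dvdnP; exists (Z.to_nat q).
  have q0 : (Z.le 0 q) by nia.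
  have : Z.of_nat p = Z.of_nat (Z.to_nat q * Z.to_nat n)%coq_nat.
    by rewrite Nat2Z.inj_mul !Z2Nat.id //; lia.
  lia.
lia.
Qed.

Lemma padic_val_ge0 (p : nat) (x : rat) : prime.prime p -> (0 <= padic_val p x)%E ->
  ~~ (p %| `|denq x|)%N.
Proof.
move=> pp; rewrite /padic_val; case: eqP => [->|x0].
  by rewrite (denq_int 0) Euclid_dvd1.
rewrite lee_fin subr_ge0 lez_nat => le.
apply/negP => pd; have : (0 < logn p `|denq x|)%N by rewrite logn_gt0 mem_primes pp pd absz_gt0 denq_neq0.
move=> /leq_trans /(_ le); rewrite logn_gt0 mem_primes => /and3P[_ _ pn].
by have := coprime_num_den x; rewrite /coprime => /eqP g; have := dvdn_gcd p `|numq x| `|denq x|; rewrite g pn pd Euclid_dvd1.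
Qed.

Lemma padic_val_div (p : nat) (n m : int) : prime.prime p -> ~~ (p %| `|m|)%N ->
  padic_val p (n%:~R / m%:~R) = padic_val p n%:~R.
Proof.
move=> pp pm; have m0 : m != 0 by apply: contraNneq pm => ->; rewrite dvdn0.
have [->|n0] := eqVneq n 0; first by rewrite mul0r.
have mq0 : m%:~R != 0 :> rat by rewrite intr_eq0.
have nq0 : n%:~R != 0 :> rat by rewrite intr_eq0.
set x := n%:~R / _; have x0 : x != 0 by rewrite mulf_neq0 ?invr_eq0.
rewrite padic_val_int (negPf n0) /padic_val (negPf x0).
have /(congr1 (fun k : int => logn p `|k|)) : numq x * m = n * denq x.
  apply: (@intr_inj rat); rewrite !intrM.
  have d0 : (denq x)%:~R != 0 :> rat by rewrite intr_eq0 denq_neq0.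
  have -> : (numq x)%:~R = x * (denq x)%:~R by rewrite -{2}(divq_num_den x) divfK.
  by rewrite mulrAC {1}/x divfK.
have nx0 : numq x != 0 by rewrite numq_eq0.
rewrite !abszM !lognM ?absz_gt0 ?denq_neq0 //.
rewrite (logn_coprime (m := `|m|)) ?prime_coprime // addn0 => ->.
by rewrite PoszD addrK.
Qed.

(** [N] is the product of the denominators, and [V] has the coefficients [N^i a_i], as for the
    change of variables with [u = 1 / N]. *)
Lemma integral_rescaling (p : nat) (W : weierstrass rat) : prime.prime p ->
  p_integral p W -> exists (N : nat) (V : weierstrass Z),
  [/\ ~~ (p %| N)%N, (0 < N)%N, c4 (modelQ V) = N%:R ^+ 4 * c4 W,
      c6 (modelQ V) = N%:R ^+ 6 * c6 W & disc (modelQ V) = N%:R ^+ 12 * disc W].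
Proof.
move=> pp; case: W => a1 a2 a3 a4 a6 [/= h1 h2 h3 h4 h6].
pose N := (\prod_(x <- [:: a1; a2; a3; a4; a6]) `|denq x|)%N.
have intN x : x \in [:: a1; a2; a3; a4; a6] -> exists n, ratZ n = N%:R * x.
  move=> hx; exists (Z_of_int ((N %/ `|denq x|)%N%:Z * numq x)).
  have eN : N = (N %/ `|denq x| * `|denq x|)%N.
    by rewrite divnK // /N (big_rem x) //= dvdn_mulr.
  rewrite /ratZ Z_of_intK intrM [in RHS]eN natrM -mulrA; congr (_ * _).
  by rewrite numqE mulrC pmulrn absz_denq.
have pN : ~~ (p %| N)%N.
  by rewrite /N !big_cons big_nil !Euclid_dvdM // !negb_or ?Euclid_dvd1 ?padic_val_ge0.
have N0 : (0 < N)%N by case: (N) pN => //; rewrite dvdn0.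
have NZ : N%:R != 0 :> rat by rewrite pnatr_eq0 -lt0n.
have [n1 e1] := intN a1 ltac:(by rewrite !inE eqxx ?orbT).
have [n2 e2] := intN a2 ltac:(by rewrite !inE eqxx ?orbT).
have [n3 e3] := intN a3 ltac:(by rewrite !inE eqxx ?orbT).
have [n4 e4] := intN a4 ltac:(by rewrite !inE eqxx ?orbT).
have [n6 e6] := intN a6 ltac:(by rewrite !inE eqxx ?orbT).
pose M := Z.of_nat N.
exists N, (Weierstrass n1 (Z.mul M n2) (Z.mul (Z.pow M 2) n3)
  (Z.mul (Z.pow M 3) n4) (Z.mul (Z.mul (Z.pow M 3) (Z.pow M 2)) n6)).
split=> //; rewrite /c4 /c6 /disc /b2 /b4 /b6 /b8 /=;
  by rewrite !(ratZ2, ratZ3, ratZM) /M !ratZ_nat e1 e2 e3 e4 ?e6; ring.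
Qed.

(** With [w = u / u0 = m / n] in lowest terms, [(n N)^k inv(V) = m^k inv(V')]. If [p | m], then [p]
    does not divide [n N] and [V] would be reducible; otherwise the valuation of [disc V] is at most
    that of [disc V'], which is that of [disc W']. *)
Lemma minimal_at (p : nat) (W W' : weierstrass rat) (V : weierstrass Z) :
  prime.prime p -> discZ V <> Z0 -> isomorphic W (modelQ V) -> isomorphic W W' ->
  p_integral p W' -> ~ reducible (Z.of_nat p) V ->
  (padic_val p (disc (modelQ V)) <= padic_val p (disc W'))%E.
Proof.
move=> pp D0 [u0 [r0 [s0 [t0 [u00 eV]]]]] [u [r [s [t [u_0 eW]]]]] pW' nred.
have [N [V' [pN N0 e4 e6 eD]]] := integral_rescaling _ _ pp pW'.
have NZ : N%:R != 0 :> rat by rewrite pnatr_eq0 -lt0n.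
pose w := u / u0.
have w0 : w != 0 by rewrite mulf_neq0 ?invr_eq0.
pose m := Z_of_int (numq w); pose n := Z_of_int (denq w).
have nq0 : ratZ n != 0 by rewrite /ratZ Z_of_intK intr_eq0 denq_neq0.
have ew : w = ratZ m / ratZ n by rewrite /ratZ !Z_of_intK divq_num_den.
have scale (k : nat) (x y y' z : rat) : y = x / u0 ^+ k -> y' = x / u ^+ k ->
    z = N%:R ^+ k * y' ->
    (ratZ n * N%:R) ^+ k * y = ratZ m ^+ k * z.
  move=> -> -> ->.
  have -> : ratZ m = ratZ n * w by rewrite ew mulrC divfK.
  by rewrite /w !exprMn exprVn; field; rewrite !expf_neq0.
have f4 := scale 4%N _ _ _ _ (etrans (congr1 c4 eV) (c4_change_vars u0 r0 s0 t0 W u00))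
  (etrans (congr1 c4 eW) (c4_change_vars u r s t W u_0)) e4.
have f6 := scale 6%N _ _ _ _ (etrans (congr1 c6 eV) (c6_change_vars u0 r0 s0 t0 W u00))
  (etrans (congr1 c6 eW) (c6_change_vars u r s t W u_0)) e6.
have fD := scale 12%N _ _ _ _ (etrans (congr1 (@disc rat) eV) (disc_change_vars r0 s0 t0 W u00))
  (etrans (congr1 (@disc rat) eW) (disc_change_vars r s t W u_0)) eD.

rewrite c4_modelQ in f4; rewrite c6_modelQ in f6; rewrite disc_modelQ in fD.
rewrite c4_modelQ in f4; rewrite c6_modelQ in f6; rewrite disc_modelQ in fD.
case: (boolP (p %| `|numq w|)%N) => pm.
  case: nred; have [m' em] : exists m', m = Z.mul (Z.of_nat p) m'.
    by case/dvdnP: pm => q eq; exists (Z.mul (Z.sgn m) (Z.of_nat q)); rewrite /m; lia.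
  case: V' {e4 e6 eD} f4 f6 fD => v1 v2 v3 v4 v6 f4 f6 fD.
  (* For [m = p m'], the cofactor [m'] is absorbed into [V'] by weights, which leaves the pure
     factor [p^k]. *)
  apply: (@reducible_of_descent _ (Z.mul n (Z.of_nat N)) _
    (Weierstrass (Z.mul m' v1) (Z.mul (Z.pow m' 2) v2) (Z.mul (Z.pow m' 3) v3)
       (Z.mul (Z.pow m' 4) v4) (Z.mul (Z.pow m' 6) v6))).
  - exact: prime_Z_of_nat.
  - case/(prime_mult _ (prime_Z_of_nat _ pp)) => -[k ek].
      have pd : (p %| `|denq w|)%N.
        apply/dvdnP; exists (Z.abs_nat k); rewrite /n in ek; lia.
      have := coprime_num_den w; rewrite /coprime => /eqP g.
      by have := dvdn_gcd p `|numq w| `|denq w|; rewrite g pm pd Euclid_dvd1.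
    by case/negP: pN; apply/dvdnP; exists (Z.abs_nat k); lia.
  - apply: ratZ_inj; rewrite !(ratZ4, ratZM) ratZ_nat f4 em.
    by rewrite -c4Z_weight -!ratZ4 -!ratZM Z.pow_mul_l Z.mul_assoc.
  - apply: ratZ_inj; rewrite !(ratZ6, ratZM) ratZ_nat f6 em.
    by rewrite -c6Z_weight -!ratZ6 -!ratZM Z.pow_mul_l Z.mul_assoc.
  apply: ratZ_inj; rewrite !(ratZ12, ratZM) ratZ_nat fD em.
  by rewrite -discZ_weight -!ratZ12 -!ratZM Z.pow_mul_l Z.mul_assoc.
have D0' : discZ V' <> Z0.
  move=> D0'; move: fD; rewrite D0' [ratZ Z0](mulr0z 1) mulr0 => /eqP.
  rewrite mulf_eq0 expf_eq0 /= mulf_eq0 (negPf nq0) (negPf NZ) ratZ_eq0.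
  by move/eqP: D0 => /negPf ->.
have -> : disc W' = (int_of_Z (discZ V'))%:~R / (N%:Z ^+ 12)%:~R.
  rewrite disc_modelQ /ratZ in eD; rewrite eD rmorphXn /= -pmulrn.
  by rewrite mulrC mulKf // expf_neq0.
rewrite padic_val_div //; last by rewrite abszX Euclid_dvdX // negb_and pN.
rewrite disc_modelQ !padic_val_int.
case: eqP => [/(congr1 Z_of_int)|d0]; first by rewrite int_of_ZK.
case: eqP => [/(congr1 Z_of_int)|d0']; first by rewrite int_of_ZK.
rewrite lee_fin lez_nat.
have /(congr1 (fun k : int => logn p `|k|)) :
   (denq w * N) ^+ 12 * int_of_Z (discZ V) = numq w ^+ 12 * int_of_Z (discZ V').
  apply: (@intr_inj rat); have intX (x : int) k : (x ^+ k)%:~R = x%:~R ^+ k :> rat by rewrite rmorphXn.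
  rewrite !(intX, intrM).
  by rewrite /ratZ !Z_of_intK in fD.
rewrite !(abszX, abszM) lognM; first last.
- by rewrite absz_gt0; apply/eqP.
- by rewrite expn_gt0 muln_gt0 absz_gt0 denq_neq0 N0.
rewrite lognM; first last.
- by rewrite absz_gt0; apply/eqP.
- by rewrite expn_gt0 absz_gt0 numq_eq0 w0.
rewrite (@logn_coprime p (`|numq w| ^ 12)) ?coprimeXr ?prime_coprime // add0n => <-.
by rewrite leq_addl.
Qed.

Lemma minimal_discriminant_of_model (W : weierstrass rat) (V : weierstrass Z) (D : rat) :
  discZ V <> Z0 -> isomorphic W (modelQ V) ->
  (forall p, Znumtheory.prime p -> ~ reducible p V) ->
  D = ratZ (discZ V) -> minimal_discriminant W D.
Proof.
move=> D0 iso nred eD; exists (map_weierstrass int_of_Z V).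
rewrite /global_minimal_model over_rat_int_of_Z; split; last by rewrite disc_modelQ.
split=> // p pp W' isoW' intW'.
by apply: (@minimal_at p W W') => //; apply/nred/prime_Z_of_nat.
Qed.

Lemma ratZ_Z_of_int (n : int) : ratZ (Z_of_int n) = n%:~R.
Proof. by rewrite /ratZ Z_of_intK. Qed.

Lemma ratZ5 x : ratZ (Z.pow x 5) = ratZ x ^+ 5. Proof. exact: (ratZX x 5). Qed.

Lemma intrX (n : int) k : (n ^+ k)%:~R = n%:~R ^+ k :> rat.
Proof. exact: rmorphXn. Qed.

Lemma intr_natr k : (k%:R : int)%:~R = k%:R :> rat.
Proof. exact: rmorph_nat. Qed.

Lemma over_rat_E T a b d :
  over_rat (E T a b d) = modelQ (EZ T (Z_of_int a) (Z_of_int b) (Z_of_int d)).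
Proof.
case: T; rewrite /over_rat /modelQ /map_weierstrass /E /EZ /=; congr Weierstrass => //;
  rewrite ?(ratZ2, ratZ3, ratZ4, ratZ5, ratZ6, ratZM, ratZB, ratZD, ratZN);
  rewrite ?(intrX, intrM, intrB, intrD, intrN, intr_natr) ?ratZ_Z_of_int //;
  rewrite ?(ratZ_nat 2, ratZ_nat 3, ratZ_nat 4, ratZ_nat 5, ratZ_nat 6, ratZ_nat 8,
    ratZ_nat 10, ratZ_nat 14, ratZ_nat 19, ratZ_nat 22, ratZ_nat 24, ratZ_nat 64,
    ratZ_nat 90, ratZ_nat 116, ratZ_nat 198) //.
Qed.

Lemma isomorphic_changeZ u r s t W V : u <> Z0 -> changeZ u r s t W V ->
  isomorphic (modelQ W) (modelQ V).
Proof.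
move=> /eqP u0; case: W V => w1 w2 w3 w4 w6 [v1 v2 v3 v4 v6] [/= e1 e2 e3 e4 e6].
exists (ratZ u), (ratZ r), (ratZ s), (ratZ t); rewrite ratZ_eq0; split=> //.
have uq : ratZ u != 0 by rewrite ratZ_eq0.
rewrite /modelQ /map_weierstrass /=.
have div_eq k x y : ratZ u ^+ k * x = y -> x = y / ratZ u ^+ k.
  by move=> <-; rewrite mulrAC mulfV ?mul1r // expf_neq0.
congr Weierstrass.
- by rewrite -[ratZ u]expr1; apply: div_eq; rewrite expr1 -ratZM e1 !(ratZM, ratZD) (ratZ_nat 2).
- apply: div_eq; rewrite -ratZ2 -ratZM e2 !(ratZ2, ratZM, ratZB, ratZD) (ratZ_nat 3); ring.
- apply: div_eq; rewrite -ratZ3 -ratZM e3 !(ratZ2, ratZM, ratZB, ratZD) (ratZ_nat 2); ring.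
- by apply: div_eq; rewrite -ratZ4 -ratZM e4 !(ratZ2, ratZM, ratZB, ratZD) (ratZ_nat 2) (ratZ_nat 3); ring.
by apply: div_eq; rewrite -ratZ6 -ratZM e6 !(ratZ2, ratZ3, ratZM, ratZB, ratZD); ring.
Qed.

Lemma minimal_discriminant_of_scaling T a b d (u : nat) : gamma T a b d != 0 ->
  (0 < u)%N ->
  minimal_scaling (Z.of_nat u) (EZ T (Z_of_int a) (Z_of_int b) (Z_of_int d)) ->
  minimal_discriminant (over_rat (E T a b d))
    ((u%:R : rat) ^- 12 * (gamma T a b d)%:~R).
Proof.
move=> g0 u0 [V [r [s [t [hV irr]]]]].
have uq : u%:R != 0 :> rat by rewrite pnatr_eq0 -lt0n.
have eg : (gamma T a b d)%:~R = u%:R ^+ 12 * ratZ (discZ V).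
  rewrite /gamma -disc_over_rat over_rat_E disc_modelQ -(changeZ_disc _ _ _ _ _ _ hV).
  by rewrite !(ratZ12, ratZM) ratZ_nat.
apply: (@minimal_discriminant_of_model _ V) => //.
- move=> D0; move: g0; rewrite -(intr_eq0 rat) eg D0.
  by rewrite (_ : ratZ Z0 = 0) // mulr0 eqxx.
- rewrite over_rat_E; apply: isomorphic_changeZ hV; clear - u0; lia.
by rewrite eg mulKf // expf_neq0.
Qed.

(** * The scaling factors in terms of valuations *)

Lemma dvdn_absz (m : nat) (n : int) :
  (m %| `|n|)%N <-> Z.divide (Z.of_nat m) (Z_of_int n).
Proof.
split=> [/dvdnP[q eq]|[q eq]]; last by apply/dvdnP; exists (Z.abs_nat q); lia.
by exists (Z.mul (Z.sgn (Z_of_int n)) (Z.of_nat q)); lia.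
Qed.

Lemma v2_ge (k : nat) (n : int) :
  ((Posz k)%:E <= v2 n)%E <-> Z.divide (Z.of_nat (2 ^ k)) (Z_of_int n).
Proof.
rewrite /v2 padic_val_int; case: eqP => [->|/eqP n0].
  by rewrite leey; split=> // _; exists Z0.
by rewrite lee_fin lez_nat -pfactor_dvdn ?absz_gt0 //; exact: dvdn_absz.
Qed.

Lemma v2_le (k : nat) (n : int) :
  (v2 n <= (Posz k)%:E)%E <-> ~ Z.divide (Z.of_nat (2 ^ k.+1)) (Z_of_int n).
Proof.
rewrite -v2_ge /v2 padic_val_int; case: eqP => _; first by rewrite leey; split=> // -[].
by rewrite !lee_fin !lez_nat leqNgt; split; [move/negP | move/negP].
Qed.

Lemma v2_eq (k : nat) (n : int) : v2 n = (Posz k)%:E <->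
  Z.divide (Z.of_nat (2 ^ k)) (Z_of_int n) /\
  ~ Z.divide (Z.of_nat (2 ^ k.+1)) (Z_of_int n).
Proof.
rewrite -v2_le -v2_ge; split=> [->|[h1 h2]]; first by rewrite lexx.
by apply/eqP; rewrite eq_le h1 h2.
Qed.

Lemma eqmodz_divide (m : nat) (a c : int) : (0 < m)%N ->
  (a = c %[mod m])%Z <-> Z.divide (Z.of_nat m) (Z.sub (Z_of_int a) (Z_of_int c)).
Proof.
move=> m0; have -> : Z.sub (Z_of_int a) (Z_of_int c) = Z_of_int (a - c) by lia.
rewrite -dvdn_absz; split=> [/eqP|h]; last apply/eqP.
  by rewrite eqz_mod_dvd.
by rewrite eqz_mod_dvd.
Qed.

Lemma squarefreeZ_of (n : int) : squarefree n -> squarefreeZ (Z_of_int n).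
Proof.
move=> sq k [q eq]; have := sq (int_of_Z k).
have -> : (int_of_Z k ^+ 2 %| n)%Z.
  apply/dvdzP; exists (int_of_Z q); apply: (can_inj Z_of_intK).
  by rewrite eq rmorphM rmorphXn /= !int_of_ZK; lia.
by move=> /(_ isT); lia.
Qed.

Lemma gcd_Z_of_int (a b : int) : Z.gcd (Z_of_int a) (Z_of_int b) = Z_of_int (gcdz a b).
Proof. lia. Qed.

Lemma exists_unique_value (P : nat -> Prop) (S : nat -> Prop) (n : nat) :
  P n -> (forall m, P m -> m = n) -> S n -> (exists u, P u) /\ forall u, P u -> S u.
Proof. by move=> Pn uniq Sn; split; [exists n | move=> u /uniq ->]. Qed.

(** [c] is the largest integer with [c^n | m]: if [j^n] divides the cofactor, [(c j)^n] divides
    [m]. *)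
Lemma max_power_factor (n m : nat) : (0 < n)%N -> (0 < m)%N ->
  exists c q, m = (c ^ n * q)%N /\ forall j, (j ^ n %| q)%N -> j = 1%N.
Proof.
move=> n0 m0; pose P := [pred c : nat | (c ^ n %| m)%N].
have exP : exists c, P c by exists 1%N; rewrite /= exp1n dvd1n.
have bound c : P c -> (c <= m)%N.
  move=> /= /(dvdn_leq m0); apply: leq_trans.
  by case: c => // c; rewrite -{1}[c.+1]expn1 leq_pexp2l.
case: (ex_maxnP exP bound) => c /= /dvdnP[q eq] cmax.
have c0 : (0 < c)%N by case: c eq {cmax} => // eq; rewrite eq exp0n // muln0 in m0.
exists c, q; split=> [|j jq]; first by rewrite mulnC.
have : (c * j <= c)%N by apply: cmax; rewrite expnMn eq mulnC dvdn_mul.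
rewrite -{2}[c]muln1 leq_pmul2l // => j1.
apply/eqP; rewrite eqn_leq j1 /=; case: j jq {j1} => //; rewrite exp0n // dvd0n => /eqP q0.
by rewrite eq q0 mul0n in m0.
Qed.

Lemma squarefree_nat (n : nat) : (forall j, (j ^ 2 %| n)%N -> j = 1%N) ->
  squarefree n%:Z.
Proof. by move=> sq k; rewrite dvdzE abszX => /sq; lia. Qed.

Lemma square_decomposition (a : int) : 0 < a ->
  exists c k : int, [/\ 0 < c, squarefree k & a = c ^+ 2 * k].
Proof.
case: a => // m m0; have [c [q [em hq]]] := @max_power_factor 2 m isT m0.
exists c%:Z, q%:Z; split; [|exact: squarefree_nat|by rewrite em PoszM -rmorphXn].
by rewrite ltz_nat; case: c em => // em; rewrite em in m0.
Qed.

(** After the cube part, [k^2] is the square part of the cubefree cofactor [q]. A square dividing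
    [k], or a common factor of [k] and [e], would put a cube into [q]. *)
Lemma cube_decomposition (a : int) : 0 < a ->
  exists c k e : int, [/\ 0 < c, 0 < k /\ squarefree k, 0 < e /\ squarefree e,
    gcdz k e = 1 & a = c ^+ 3 * k ^+ 2 * e].
Proof.
case: a => // m m0; have [c [q [em hq]]] := @max_power_factor 3 m isT m0.
have q0 : (0 < q)%N by case: q em {hq} => // em; rewrite em muln0 in m0.
have [k [e [eq he]]] := @max_power_factor 2 q isT q0.
exists c%:Z, k%:Z, e%:Z; split.
- by rewrite ltz_nat; case: c em => // em; rewrite em in m0.
- split; first by rewrite ltz_nat; case: k eq => // eq; rewrite eq in q0.
  apply: squarefree_nat => j jk; apply: hq; rewrite eq dvdn_mulr //.
  by apply: (@dvdn_trans (j ^ 4)); [exact: dvdn_exp2l | rewrite (expnM j 2 2) dvdn_exp2r].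
- split; last exact: squarefree_nat.
  by rewrite ltz_nat; case: e eq {he} => // eq; rewrite eq muln0 in q0.
- congr Posz; apply: hq; rewrite eq expnSr dvdn_mul ?dvdn_gcdr //.
  by rewrite dvdn_exp2r ?dvdn_gcdl.
by rewrite em eq mulnA !PoszM -!rmorphXn.
Qed.

Lemma bool_cases (P : bool) : P /\ ~ ~ P \/ ~ P /\ ~ P.
Proof. by case: P; [left | right]; split. Qed.

(** * Existence of u_T and the scaling it selects *)

Section Values.
Variables (a b d : int).
Let A := Z_of_int a.
Let B := Z_of_int b.
Let D := Z_of_int d.

Let scalable T (u : nat) := minimal_scaling (Z.of_nat u) (EZ T A B D).
Let main T := (exists u, is_u T a b d u) /\ forall u, is_u T a b d u -> scalable T u.

(** Since [u] is specified by equivalences, its existence amounts to the conditions being exclusive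
    and exhaustive. *)
Lemma two_values T m n (P Q : Prop) : (0 < m)%N -> (0 < n)%N -> m <> n ->
  (forall u, is_u T a b d u <-> (0 < u)%N /\ (u = m <-> P) /\ (u = n <-> Q)) ->
  P /\ ~ Q \/ ~ P /\ Q -> (P -> scalable T m) -> (Q -> scalable T n) -> main T.
Proof.
move=> m0 n0 mn isuE [[p q]|[p q]] hm hn.
  apply: (@exists_unique_value _ _ m); last exact: hm.
    by apply/isuE; split=> //; split; split.
  by move=> u /isuE [_ [/iffRL h _]]; apply: h.
apply: (@exists_unique_value _ _ n); last exact: hn.
  by apply/isuE; split=> //; split; split=> // e; case: mn.
by move=> u /isuE [_ [_ /iffRL h]]; apply: h.
Qed.

Lemma three_values T m n k (P Q R : Prop) : (0 < m)%N -> (0 < n)%N -> (0 < k)%N ->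
  m <> n -> n <> k -> m <> k ->
  (forall u, is_u T a b d u <->
    (0 < u)%N /\ [/\ u = m <-> P, u = n <-> Q & u = k <-> R]) ->
  [\/ [/\ P, ~ Q & ~ R], [/\ ~ P, Q & ~ R] | [/\ ~ P, ~ Q & R]] ->
  (P -> scalable T m) -> (Q -> scalable T n) -> (R -> scalable T k) -> main T.
Proof.
move=> m0 n0 k0 mn nk mk isuE [[p q r]|[p q r]|[p q r]] hm hn hk.
- apply: (@exists_unique_value _ _ m); last exact: hm.
    by apply/isuE; split=> //; split; split.
  by move=> u /isuE [_ [/iffRL h _ _]]; apply: h.
- apply: (@exists_unique_value _ _ n); last exact: hn.
    by apply/isuE; split=> //; split; split=> // e; case: mn.
  by move=> u /isuE [_ [_ /iffRL h _]]; apply: h.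
apply: (@exists_unique_value _ _ k); last exact: hk.
  by apply/isuE; split=> //; split; split=> // e; by [case: mk | case: nk].
by move=> u /isuE [_ [_ _ /iffRL h]]; apply: h.
Qed.

Lemma ZdivideP (m x : Z) : Z.divide m x \/ ~ Z.divide m x.
Proof. by case: (Zdivide_dec m x) => h; [left | right]. Qed.

Lemma dvdz_divide (m : nat) (n : int) : (m %| n)%Z <-> Z.divide (Z.of_nat m) (Z_of_int n).
Proof. exact: dvdn_absz. Qed.

Section Coprime.
Hypothesis gab : gcdz a b = 1.

Let gAB : Z.gcd A B = Zpos xH. Proof. by rewrite gcd_Z_of_int gab. Qed.

Lemma main_C5 : main C5.
Proof.
by apply: (@exists_unique_value _ _ 1%N) => // [m []//|]; exact: minimal_C5.
Qed.

Lemma main_C7 : main C7.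
Proof.
by apply: (@exists_unique_value _ _ 1%N) => // [m []//|]; exact: minimal_C7.
Qed.

Lemma main_C9 : main C9.
Proof.
by apply: (@exists_unique_value _ _ 1%N) => // [m []//|]; exact: minimal_C9.
Qed.

Lemma main_C6 : main C6.
Proof.
have := v2_ge 3 (a + b); rewrite rmorphD -/A -/B /= => v3.
apply: (@two_values C6 2%N 1%N _ _ _ _ _ (fun=> iff_refl _)) => //.
- exact: bool_cases.
- by move=> /v3; exact: minimal_C6_2.
by move=> h; apply: minimal_C6_1 => // /v3.
Qed.

Lemma main_C8 : main C8.
Proof.
have := v2_eq 1 a; rewrite -/A => v1.
apply: (@two_values C8 2%N 1%N _ _ _ _ _ (fun=> iff_refl _)) => //.
- by case: (v2 a =P 1%:E) => h; [left | right]; split.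
- by move=> /v1 [h2 h4]; exact: minimal_C8_2.
move=> h; apply: minimal_C8_1 => //.
have [h2|h2] := ZdivideP (Z.of_nat (2 ^ 1)) A; last by left.
have [h4|h4] := ZdivideP (Z.of_nat (2 ^ 2)) A; first by right.
by case: h; apply/v1.
Qed.

Lemma main_C10 : main C10.
Proof.
have := dvdz_divide 2 a; rewrite -/A => v1.
apply: (@two_values C10 2%N 1%N _ _ _ _ _ (fun=> iff_refl _)) => //.
- exact: bool_cases.
- by move=> /v1; exact: minimal_C10_2.
by move=> h; apply: minimal_C10_1 => // /v1.
Qed.

Lemma main_C12 : main C12.
Proof.
have := dvdz_divide 2 a; rewrite -/A => v1.
apply: (@two_values C12 2%N 1%N _ _ _ _ _ (fun=> iff_refl _)) => //.
- exact: bool_cases.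
- by move=> /v1; exact: minimal_C12_2.
by move=> h; apply: minimal_C12_1 => // /v1.
Qed.

Lemma main_C2xC4 : main C2xC4.
Proof.
have := v2_le 1 a; have := v2_ge 2 a; have := v2_eq 2 a; rewrite -/A => v2e v2g v2l.
have := v2_ge 4 (a + 4 * b); have := v2_le 3 (a + 4 * b).
rewrite rmorphD rmorphM -/A -/B /= => w3 w4.
(* The two divisibilities already give [v2 a = 2]: if [8 | a], then [b] would be even as well. *)
have n8 : Z.divide 4 A -> Z.divide 16 (A + Z_of_int 4 * B) -> ~ Z.divide 8 A.
  move=> _ [r er] [q eq].
  have hA : Z.divide 2 A by exists (Z.mul 4 q); lia.
  have hB : Z.divide 2 B by exists (Z.sub (Z.mul 2 r) q); lia.
  by have := coprime_parity A B gAB; rewrite !(dvd2_even _).1.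
apply: (@three_values C2xC4 4%N 2%N 1%N _ _ _ _ _ _ _ _ _ (fun=> iff_refl _)) => //.
- have [h4|h4] := ZdivideP (Z.of_nat (2 ^ 2)) A; last first.
    by constructor 3; split; [case=> /v2e [] | case=> /v2g | apply/v2l].
  have [h16|h16] := ZdivideP (Z.of_nat (2 ^ 4)) (A + Z_of_int 4 * B).
    constructor 1; split; last by move/v2l.
      by split; [apply/v2e; split=> //; exact: n8 | apply/w4].
    by case=> _ /w3.
  constructor 2; split; last by move/v2l.
    by case=> _ /w4.
  by split; [apply/v2g | apply/w3].
- by move=> [/v2e[h _] /w4]; exact: minimal_C2xC4_4.
- by move=> [/v2g h /w3]; exact: minimal_C2xC4_2.
by move=> /v2l; exact: minimal_C2xC4_1.
Qed.

Lemma main_C2xC6 : main C2xC6.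
Proof.
have := v2_eq 1 (a + b); have := v2_ge 2 (a + b); have := v2_eq 0 (a + b).
rewrite rmorphD -/A -/B /= => v0 v2g v1.
have z1 : Z.divide (Z.of_nat (2 ^ 0)) (A + B) by exact: Z.divide_1_l.
have z42 : Z.divide (Z.of_nat (2 ^ 2)) (A + B) -> Z.divide (Z.of_nat (2 ^ 1)) (A + B).
  by apply: Z.divide_trans; exists 2.
apply: (@three_values C2xC6 16%N 4%N 1%N _ _ _ _ _ _ _ _ _ (fun=> iff_refl _)) => //.
- have [h2|h2] := ZdivideP (Z.of_nat (2 ^ 1)) (A + B); last first.
    by constructor 3; split; [case/v1 | move/v2g/z42 | apply/v0].
  have [h4|h4] := ZdivideP (Z.of_nat (2 ^ 2)) (A + B).
    by constructor 2; split; [case/v1 | apply/v2g | case/v0].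
  by constructor 1; split; [apply/v1 | move/v2g | case/v0].
- by move=> /v1 [h2 h4]; exact: minimal_C2xC6_16.
- by move=> /v2g; exact: minimal_C2xC6_4.
by move=> /v0 [_ h]; exact: minimal_C2xC6_1.
Qed.

Lemma main_C2xC8 : main C2xC8.
Proof.
have := v2_eq 1 a; have := v2_ge 2 a; have := v2_eq 0 a; rewrite -/A => v0 v2g v1.
have z1 : Z.divide (Z.of_nat (2 ^ 0)) A by exact: Z.divide_1_l.
have z42 : Z.divide (Z.of_nat (2 ^ 2)) A -> Z.divide (Z.of_nat (2 ^ 1)) A.
  by apply: Z.divide_trans; exists 2.
apply: (@three_values C2xC8 64%N 16%N 1%N _ _ _ _ _ _ _ _ _ (fun=> iff_refl _)) => //.
- have [h2|h2] := ZdivideP (Z.of_nat (2 ^ 1)) A; last first.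
    by constructor 3; split; [move/v2g/z42 | case/v1 | apply/v0].
  have [h4|h4] := ZdivideP (Z.of_nat (2 ^ 2)) A.
    by constructor 1; split; [apply/v2g | case/v1 | case/v0].
  by constructor 2; split; [move/v2g | apply/v1 | case/v0].
- by move=> /v2g; exact: minimal_C2xC8_64.
- by move=> /v1 [h2 h4]; exact: minimal_C2xC8_16.
by move=> /v0 [_ h]; exact: minimal_C2xC8_1.
Qed.
End Coprime.

Lemma main_C3_0 : cubefree a -> main C3_0.
Proof.
move=> cf; apply: (@exists_unique_value _ _ 1%N) => // [m []//|].
apply: minimal_C3_0 => k [q eq]; have := cf (int_of_Z k).
have -> : (int_of_Z k ^+ 3 %| a)%Z.
  apply/dvdzP; exists (int_of_Z q); apply: (can_inj Z_of_intK).
  by rewrite rmorphM rmorphXn /= !int_of_ZK -/A eq; lia.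
by move=> /(_ isT); lia.
Qed.

Lemma main_C3 : gcdz a b = 1 -> 0 < a -> main C3.
Proof.
move=> gab a0; split.
  have [c [k [e dec]]] := @cube_decomposition a a0.
  have [c0 [k0 _] _ _ _] := dec.
  exists `|(c ^+ 2 * k)%R|%N; split; first by rewrite absz_gt0 mulf_neq0 ?expf_neq0 ?gt_eqF.
  by exists c, k, e; split=> //; rewrite abszE ger0_norm // mulr_ge0 ?exprn_ge0 // ltW.
move=> u [u0 [c [k [e [[c0 [k0 sk] [e0 se] gke ea] eu]]]]].
have -> : scalable C3 u = minimal_scaling
    (Z.mul (Z.pow (Z_of_int c) 2) (Z_of_int k)) (EZ C3 A B D).
  by rewrite /scalable; congr minimal_scaling; lia.
apply: (@minimal_C3 _ _ _ _ _ (Z_of_int e)).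
- by rewrite gcd_Z_of_int gab.
- exact: squarefreeZ_of.
- exact: squarefreeZ_of.
- by rewrite gcd_Z_of_int gke.
by rewrite /A ea; lia.
Qed.

(** If [b k = 3 mod 4], then [k] is odd and [v2 a = 2 v2 c]; so [v2 a] is even, and being at least 8
    means [16 | c], the form in which the scalings are proved. *)
Lemma main_C4 : gcdz a b = 1 -> 0 < a -> main C4.
Proof.
move=> gab a0.
have v8 := v2_ge 8 a; have v7 := v2_le 7 a; rewrite -/A in v8 v7.
split.
  have [c [k [c0 sk ea]]] := @square_decomposition a a0.
  case: (boolP ((8%:E <= v2 a)%E && (b * k == 3 %[mod 4])%Z)) => [/andP[/v8 h /eqP hk]|h].
    exists `|(2 * c)%R|%N; split; first by rewrite absz_gt0 mulf_neq0 ?gt_eqF.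
    exists c, k; split=> //; split=> [_|]; first by clear - c0; lia.
    by case=> // /v7.
  exists `|c|%N; split; first by rewrite absz_gt0 gt_eqF.
  exists c, k; split=> //; split=> [[h8 _ hk]|_]; last by clear - c0; lia.
  by case/andP: h; split=> //; apply/eqP.
move=> u [u0 [c [k [[c0 sk ea] [h1 h2]]]]].
pose c' := Z_of_int c; pose k' := Z_of_int k.
have eA : A = Z.mul (Z.pow c' 2) k' by rewrite /A ea; lia.
have cop : Z.gcd (Z.mul (Z.pow c' 2) k') B = Zpos xH by rewrite -eA gcd_Z_of_int gab.
have sk' := @squarefreeZ_of k sk.
have mod3 : (b * k = 3 %[mod 4])%Z <-> Z.divide 4 (Z.add (Z.mul k' B) 1).
  rewrite (@eqmodz_divide 4) //; split=> -[q eq].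
    by exists (Z.add q 1); rewrite /k' /B; lia.
  by exists (Z.sub q 1); rewrite /k' /B in eq; lia.
rewrite /scalable eA.
have [[h16 h3]|h16] : (Z.divide 16 c' /\ Z.divide 4 (Z.add (Z.mul k' B) 1)) \/
    ~ (Z.divide 16 c' /\ Z.divide 4 (Z.add (Z.mul k' B) 1)).
- by clear; case: (ZdivideP 16 c'); case: (ZdivideP 4 (Z.add (Z.mul k' B) 1)); tauto.
- rewrite (_ : Z.of_nat u = Z.mul 2 c'); first exact: minimal_C4_2.
  suff : u%:Z = 2 * c by clear; rewrite /c'; lia.
  apply: h1; split; last exact/mod3.
    apply/v8; case: h16 => q eq; exists (Z.mul (Z.pow q 2) k').
    by rewrite eA eq; clear; lia.
  exists (logn 2 `|c|)%:Z; rewrite /v2 padic_val_int gt_eqF //; congr (_%:E).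
  have k0 : (0 < `|k|)%N by move: a0; rewrite ea absz_gt0; case: eqP => // ->; rewrite mulr0.
  have nk : coprime 2 `|k|%N.
    rewrite prime_coprime //; apply/negP => /dvdn_absz [r er].
    by case: h3 => q; rewrite /k' er; clear; lia.
  rewrite ea abszM abszX lognM ?expn_gt0 ?k0 ?absz_gt0 ?gt_eqF //.
  by rewrite lognX (logn_coprime nk) addn0 PoszM.
rewrite (_ : Z.of_nat u = c'); first exact: minimal_C4_1.
suff : u%:Z = c by clear; rewrite /c'; lia.
apply: h2; have [h3|h3] := ZdivideP 4 (Z.add (Z.mul k' B) 1); last by right=> /mod3.
left; apply/v7; rewrite eA => h; apply: h16; split=> //.
have n2k : ~ Z.divide 2 k'.
  by case: h3 => q eq [r er]; move: eq; rewrite er; clear; lia.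
have {}h : Z.divide (Z.pow 2 (2 + 6)) (Z.pow c' 2).
  by apply: pow_dvd_unit n2k _ => //; [exact: prime_2 | rewrite Z.mul_comm].
have [y [-> h6]] := pow_dvd_pow _ 2 6 _ prime_2 erefl (Zle_0_pos _) h.
have [z [-> h4]] := pow_dvd_pow _ 2 4 _ prime_2 erefl (Zle_0_pos _) h6.
have [t [-> h2']] := pow_dvd_pow _ 2 2 _ prime_2 erefl (Zle_0_pos _) h4.
have [w [-> _]] := pow_dvd_pow _ 2 0 _ prime_2 erefl (Z.le_refl 0) h2'.
by exists w; clear; lia.
Qed.

Lemma main_C2xC2 : gcdz a b = 1 -> (2 %| a)%Z -> squarefree d -> main C2xC2.
Proof.
move=> gab a2 sd.
have gAB : Z.gcd A B = Zpos xH by rewrite gcd_Z_of_int gab.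
have v4 := v2_ge 4 a; have v3 := v2_le 3 a; rewrite -/A in v4 v3.
have mod1 := @eqmodz_divide 4 (b * d) 1 isT.
rewrite rmorphM -/B -/D /= in mod1.
apply: (@two_values C2xC2 2%N 1%N _ _ _ _ _ (fun=> iff_refl _)) => //.
- have [h|h] := ZdivideP (Z.of_nat (2 ^ 4)) A.
    have [h1|h1] := ZdivideP (Z.of_nat 4) (Z.sub (Z.mul B D) 1).
      left; split; first by split; [apply/v4 | apply/mod1].
      by case=> [/v3|]; [|apply; apply/mod1].
    right; split; first by case=> _ /mod1.
    by right=> /mod1.
  right; split; first by case=> /v4.
  by left; apply/v3.
- move=> [/v4 h /mod1 h1]; exact: (@minimal_C2xC2_2 A B D gAB (@squarefreeZ_of d sd)).
move=> h; apply: (@minimal_C2xC2_1 A B D gAB (@squarefreeZ_of d sd)); first exact: ((dvdz_divide 2 a).1 a2).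
by case: h => [/v3 h|h] [h1 h2]; apply: h => //; apply/mod1.
Qed.
Lemma main_C2 : squarefree d -> squarefree (gcdz a b) -> main C2.
Proof.
move=> sd sg.
have sD := @squarefreeZ_of d sd.
have sG : squarefreeZ (Z.gcd A B) by rewrite gcd_Z_of_int; exact: squarefreeZ_of.
pose w := b ^+ 2 * d - a ^+ 2.
have ew : Z_of_int w = Z.sub (Z.mul (Z.pow B 2) D) (Z.pow A 2) by rewrite /w /A /B /D; lia.
have w8 := v2_ge 8 w; have w4 := v2_ge 4 w; have w7 := v2_le 7 w.
rewrite ew in w8 w4 w7.
have va := v2_eq 1 a; have vb := v2_eq 1 b; have vb3 := v2_ge 3 b; rewrite -/A -/B in va vb vb3.
have a2 := @eqmodz_divide 8 a 2 isT; have a6 := @eqmodz_divide 8 a 6 isT.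
have a3 := @eqmodz_divide 4 a 3 isT.
rewrite -/A in a2 a6 a3.
pose four := [/\ (8%:E <= v2 w)%E, v2 a = 1%:E, v2 b = 1%:E & (a = 2 %[mod 8])%Z].
pose two := [\/ [/\ (8%:E <= v2 w)%E, v2 a = 1%:E, v2 b = 1%:E & (a = 6 %[mod 8])%Z],
  [/\ (4%:E <= v2 w)%E, (v2 w <= 7%:E)%E, v2 a = 1%:E & v2 b = 1%:E]
  | (3%:E <= v2 b)%E /\ (a = 3 %[mod 4])%Z].
have d4 : four \/ ~ four.
  case: (boolP [&& (8%:E <= v2 w)%E, v2 a == 1%:E, v2 b == 1%:E & (a == 2 %[mod 8])%Z]).
    by case/and4P => h1 /eqP h2 /eqP h3 /eqP h4; left.
  move=> /negP h; right=> -[h1 /eqP h2 /eqP h3 /eqP h4]; apply: h.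
  exact/and4P.
have d2 : two \/ ~ two.
  case: (boolP [|| [&& (8%:E <= v2 w)%E, v2 a == 1%:E, v2 b == 1%:E & (a == 6 %[mod 8])%Z],
    [&& (4%:E <= v2 w)%E, (v2 w <= 7%:E)%E, v2 a == 1%:E & v2 b == 1%:E]
    | (3%:E <= v2 b)%E && (a == 3 %[mod 4])%Z]).
    case/or3P; first by case/and4P => h1 /eqP h2 /eqP h3 /eqP h4; left; constructor 1.
      by case/and4P => h1 h2 /eqP h3 /eqP h4; left; constructor 2.
    by case/andP => h1 /eqP h2; left; constructor 3.
  move=> /negP h; right=> h'; apply: h; apply/or3P; case: h'.
  - by move=> [h1 /eqP h2 /eqP h3 /eqP h4]; constructor 1; apply/and4P.
  - by move=> [h1 h2 /eqP h3 /eqP h4]; constructor 2; apply/and4P.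
  by move=> [h1 /eqP h2]; constructor 3; apply/andP.
have excl : four -> ~ two.
  move=> [h1 h2 h3 h4] [[_ _ _ h]|[_ h _ _]|[h _]].
  - by move/a2: h4 => [q]; move/a6: h => [r]; clear; lia.
  - by move/w7: h; apply; apply/w8.
  by move/vb: h3 => [_ []]; apply: Z.divide_trans (vb3.1 h); exists 2.
have halves x : Z.divide (Z.of_nat (2 ^ 1)) x -> ~ Z.divide (Z.of_nat (2 ^ 2)) x ->
    exists2 y, x = Z.mul 2 y & Z.even y = false.
  move=> [y ey] n4; exists y; first by rewrite ey; clear; lia.
  by apply/negbTE/negP => /dvd2_even [z ez]; apply: n4; exists z; rewrite ey ez; clear; lia.
apply: (@three_values C2 4%N 2%N 1%N _ _ _ _ _ _ _ _ _ (fun=> iff_refl _)) => //;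
  rewrite -/w -/four -/two.
- case: d4 => h4; first by constructor 1; split=> //; [exact: excl | case].
  case: d2 => h2; first by constructor 2; split=> //; case.
  by constructor 3.
- move=> [/w8 hw _ /vb[[b0 eb] _] /a2 [q eq]].
  apply: (@minimal_C2_4 A B D sD sG q b0) => //; first by move: eq; clear; lia.
  by rewrite eb Z.mul_comm.
(* In terms of [minimal_C2_2], the first alternative contradicts [a0 = 1 mod 4] and the second
   [16 | m]. *)
- move=> [[/w8 hw /va[h1 h2] _ /a6 [q eq]]|[/w4 hw /w7 hw' /va[h1 h2] _]|[/vb3 [b0 eb] /a3 [q eq]]].
  + have [a0 ea oa] := halves _ h1 h2; have [m em] := hw.
    apply: (@minimal_C2_2 A B D sD sG a0 (Z.opp (Z.mul 16 m))) => //.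
      by rewrite em; clear; lia.
    by case=> _ [r er]; move: eq er; rewrite ea; clear; lia.
  + have [a0 ea oa] := halves _ h1 h2; have [m em] := hw.
    apply: (@minimal_C2_2 A B D sD sG a0 (Z.opp m)) => //.
      by rewrite em; clear; lia.
    by case=> -[r er] _; apply: hw'; exists (Z.opp r); rewrite em; move: er; clear; lia.
  apply: (@minimal_C2_2' A B D sD sG (Z.add q 1) b0); first by move: eq; clear; lia.
  by rewrite eb Z.mul_comm.
move=> [n4 n2]; apply: (@minimal_C2_1 A B D sD sG).
  (* Here [16 | w] with [a / 2] and [b / 2] odd. If [2^8] does not divide [w] this is the second
     alternative of [two]; otherwise [a] is 2 or 6 modulo 8, giving [four] or the first
     alternative. *)
  move=> [hw [a0 [b0 [ea eb oa ob]]]].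
  have half x y : x = Z.mul 2 y -> Z.even y = false ->
      Z.divide (Z.of_nat (2 ^ 1)) x /\ ~ Z.divide (Z.of_nat (2 ^ 2)) x.
    move=> -> oy; split; first by exists y; clear; lia.
    by move=> [z ez]; have ey : y = Z.mul 2 z; [move: ez; clear; lia | rewrite ey parityE in oy].
  have ha := va.2 (half _ _ ea oa); have hb := vb.2 (half _ _ eb ob).
  have [h8|h8] := ZdivideP (Z.of_nat (2 ^ 8)) (Z.sub (Z.mul (Z.pow B 2) D) (Z.pow A 2)).
    have [[q eq]|[q eq]] := even_cases a0; first by rewrite eq parityE in oa.
    have [[r er]|[r er]] := even_cases q.
      by apply: n4; split=> //; [apply/w8 | apply/a2; exists r; rewrite ea eq er; clear; lia].
    by apply: n2; constructor 1; split=> //; [apply/w8 | apply/a6; exists r; rewrite ea eq er; clear; lia].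
  by apply: n2; constructor 2; split=> //; [apply/w4 | apply/w7].
move=> [h8 [q eq]]; apply: n2; constructor 3; split; first by apply/vb3.
by apply/a3; exists (Z.sub q 1); move: eq; clear; lia.
Qed.

Lemma main_theorem T : param_cond T a b d -> main T.
Proof.
case: T => -[_].
- by case=> _ _ sd sg; exact: main_C2.
- by case=> _ cf; exact: main_C3_0.
- by case=> gab a0; exact: main_C3.
- by case=> gab a0; exact: main_C4.
- by case=> gab _; exact: main_C5.
- by case=> gab _; exact: main_C6.
- by case=> gab _; exact: main_C7.
- by case=> gab _; exact: main_C8.
- by case=> gab _; exact: main_C9.
- by case=> gab _; exact: main_C10.
- by case=> gab _; exact: main_C12.
- by case=> gab a2 _ sd; exact: main_C2xC2.
- by case=> gab _; exact: main_C2xC4.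
- by case=> gab _; exact: main_C2xC6.
by case=> gab _; exact: main_C2xC8.
Qed.
End Values.

Theorem theorem4p4 (T : torsion) (a b d : int) (hP : param_cond T a b d) :
  (exists u : nat, is_u T a b d u) /\
  forall u : nat, is_u T a b d u ->
    minimal_discriminant (over_rat (E T a b d))
      ((u%:R : rat) ^- 12 * (gamma T a b d)%:~R).
Proof.
have [ex min] := @main_theorem a b d T hP; split=> // u isu.
by apply: minimal_discriminant_of_scaling (min u isu); [case: hP | case: isu].
Qed.
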